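(* Let $f:X\to Y$ be a globular subdivision of multipointed $d$-spaces. Let $\widetilde{X}:\lambda\to\mathcal{M}\mathbf{dTop}$ be a cellular decomposition of $X$, with $\widetilde{X}_{\nu+1}$ the pushout of $\mathrm{Glob}^{top}(\mathbf{S}^{n_\nu-1})\subset\mathrm{Glob}^{top}(\mathbf{D}^{n_\nu})$ along $g_\nu:\mathrm{Glob}^{top}(\mathbf{S}^{n_\nu-1})\to\widetilde{X}_\nu$ and $\widehat{g_\nu}:\mathrm{Glob}^{top}(\mathbf{D}^{n_\nu})\to\widetilde{X}_{\nu+1}$ the canonical map, for all $\nu<\lambda$; let $c_\nu$ be the corresponding globular cell and let $F(c_\nu)\subset|\mathrm{Glob}^{top}(\mathbf{D}^{n_\nu})|\setminus|\mathrm{Glob}^{top}(\mathbf{S}^{n_\nu-1})|$ be the finite set corresponding to $f(c_\nu)\cap Y^0$. Then there exist a transfinite tower of cellular multipointed $d$-spaces $\widetilde{Y}:\lambda\to\mathcal{M}\mathbf{dTop}$ and a map of transfinite towers $\widetilde{X}\to\widetilde{Y}$ whose colimit is the globular subdivision $f:X\to Y$, such that for all $\nu<\lambda$: (a) the maps $\widetilde{X}_\nu\to\widetilde{Y}_\nu$ and $\widetilde{X}_{\nu+1}\to\widetilde{Y}_{\nu+1}$ are globular subdivisions; (b) there is a map $\mathrm{Glob}^{top}(\mathbf{D}^{n_\nu})_{F(c_\nu)}\to\widetilde{Y}_{\nu+1}$ such that the square with top map the composite $\mathrm{Glob}^{top}(\mathbf{S}^{n_\nu-1})\xrightarrow{g_\nu}\widetilde{X}_\nu\to\widetilde{Y}_\nu$,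 left map the inclusion $\mathrm{Glob}^{top}(\mathbf{S}^{n_\nu-1})\subset\mathrm{Glob}^{top}(\mathbf{D}^{n_\nu})_{F(c_\nu)}$, right map $\widetilde{Y}_\nu\to\widetilde{Y}_{\nu+1}$ and bottom map $\mathrm{Glob}^{top}(\mathbf{D}^{n_\nu})_{F(c_\nu)}\to\widetilde{Y}_{\nu+1}$ is a pushout square whose left and right maps are q-cofibrations, and such that the two composites $\mathrm{Glob}^{top}(\mathbf{D}^{n_\nu})\to\mathrm{Glob}^{top}(\mathbf{D}^{n_\nu})_{F(c_\nu)}\to\widetilde{Y}_{\nu+1}$ and $\mathrm{Glob}^{top}(\mathbf{D}^{n_\nu})\xrightarrow{\widehat{g_\nu}}\widetilde{X}_{\nu+1}\to\widetilde{Y}_{\nu+1}$ are equal, where the first map $\mathrm{Glob}^{top}(\mathbf{D}^{n_\nu})\to\mathrm{Glob}^{top}(\mathbf{D}^{n_\nu})_{F(c_\nu)}$ is the globular subdivision which is the identity on underlying spaces. Moreover, for all $\nu<\lambda$, the connection maps of the globular subdivision $\widetilde{X}_\nu\to\widetilde{Y}_\nu$ are the restrictions to $\widetilde{Y}_\nu^0$ of the connection maps of the globular subdivision $\widetilde{X}_{\nu+1}\to\widetilde{Y}_{\nu+1}$.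
   Context: **Multipointed $d$-spaces.** $\mathbf{Top}$ denotes either the category of $\Delta$-generated spaces or that of $\Delta$-Hausdorff $\Delta$-generated spaces (either choice); it is bicomplete and cartesian closed with internal hom $\mathbf{TOP}(-,-)$, and $\Delta$-kelleyfication is the right adjoint of the inclusion of $\Delta$-generated spaces into topological spaces. $\mathcal{M}$ is the set of nondecreasing surjective maps $[0,1]\to[0,1]$. The normalized composition $\gamma_1*_N\gamma_2$ of paths with $\gamma_1(1)=\gamma_2(0)$ is $\gamma_1(2t)$ for $t\le 1/2$ and $\gamma_2(2t-1)$ for $t\ge 1/2$. A multipointed $d$-space is a triple $X=(|X|,X^0,\mathbb{P}^{top}X)$ with $|X|$ a space (the underlying space), $X^0\subset|X|$ a set (the states) and $\mathbb{P}^{top}X$ a set of continuous maps $[0,1]\to|X|$ (the execution paths) such that $\gamma(0),\gamma(1)\in X^0$ for every execution path $\gamma$, and $\mathbb{P}^{top}X$ is closed under $\gamma\mapsto\gamma\phi$ for $\phi\in\mathcal{M}$ and under normalized composition. A map $f:X\to Y$ is a continuous map $|X|\to|Y|$ taking $X^0$ to $Y^0$ and execution paths to execution paths. The category is denoted $\mathcal{M}\mathbf{dTop}$. $\mathbb{P}^{top}_{\alpha,\beta}X$ is the set of execution paths from $\alpha$ to $\beta$ with the $\Delta$-kelleyfication of the topology induced by $\mathbf{TOP}([0,1],|X|)$. A set $S$ is viewed as $(S,S,\varnothing)$. The topological globe $\mathrm{Glob}^{top}(Z)$ of a space $Z$ has underlying space the quotient of $\{0,1\}\sqcup(Z\times[0,1])$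 by $(z,0)=0$, $(z,1)=1$ for all $z$, states $\{0,1\}$, and execution paths $t\mapsto(z,\phi(t))$ with $z\in Z$, $\phi\in\mathcal{M}$. $\mathbf{D}^n$ is the closed unit disk of $\mathbb{R}^n$, $\mathbf{S}^{n-1}$ its boundary sphere, $\mathbf{D}^0=\{0\}$, $\mathbf{S}^{-1}=\varnothing$. The q-model structure of multipointed $d$-spaces is the combinatorial model structure with generating cofibrations $\{\mathrm{Glob}^{top}(\mathbf{S}^{n-1})\subset\mathrm{Glob}^{top}(\mathbf{D}^n)\mid n\ge0\}\cup\{\varnothing\to\{0\},\{0,1\}\to\{0\}\}$; weak equivalences are the maps bijective on states and inducing weak homotopy equivalences $\mathbb{P}^{top}_{\alpha,\beta}X\to\mathbb{P}^{top}_{f(\alpha),f(\beta)}Y$ for all states; fibrations are the maps inducing Serre fibrations on these spaces. **Towers and cellular multipointed $d$-spaces.** A transfinite tower is a colimit-preserving functor from a transfinite ordinal $\lambda$ (viewed as a poset). A cellular decomposition of $X$ is a transfinite tower $\widetilde{X}:\lambda\to\mathcal{M}\mathbf{dTop}$ with colimit $X$ such that $\widetilde{X}_0=(X^0,X^0,\varnothing)$ with $X^0$ discrete and such that for all $\nu<\lambda$, $\widetilde{X}_{\nu+1}$ is a pushout of $\mathrm{Glob}^{top}(\mathbf{S}^{n_\nu-1})\subset\mathrm{Glob}^{top}(\mathbf{D}^{n_\nu})$ ($n_\nu\ge0$) along some map $g_\nu$ to $\widetilde{X}_\nu$. $X$ is cellular if it has a cellular decomposition. The globular cells of $X$ are the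 cells $c_\nu=|\mathrm{Glob}^{top}(\mathbf{D}^{n_\nu})|\setminus|\mathrm{Glob}^{top}(\mathbf{S}^{n_\nu-1})|$ (identified via $\widehat{g_\nu}$ with their homeomorphic images in $|X|$), with initial state $c_\nu^-=\widehat{g_\nu}(0)$ and final state $c_\nu^+=\widehat{g_\nu}(1)$ in $X^0$, together with the points $\alpha\in X^0$, for which $\alpha^-=\alpha^+=\alpha$. As a set $|X|$ is the disjoint union of the globular cells. **Globular subdivision and connection maps.** A map $f:X\to Y$ is a globular subdivision if $X$ and $Y$ are cellular and $f$ induces a homeomorphism $|X|\cong|Y|$. Identify $|X|=|Y|$. Each $\alpha\in Y^0$ lies in a unique globular cell $c_\alpha$ of (a chosen cellular decomposition of) $X$; set $\alpha^\pm=c_\alpha^\pm$. The maps $\alpha\mapsto\alpha^-$, $\alpha\mapsto\alpha^+$ from $Y^0$ to $X^0$ (independent of the chosen decomposition) are the connection maps of $f$. **The object $\mathrm{Glob}^{top}(\mathbf{D}^n)_F$.** Let $F$ be a finite subset of $|\mathrm{Glob}^{top}(\mathbf{D}^n)|\setminus|\mathrm{Glob}^{top}(\mathbf{S}^{n-1})|$. $\mathrm{Glob}^{top}(\mathbf{D}^n)_F$ is the multipointed $d$-space with underlying space $|\mathrm{Glob}^{top}(\mathbf{D}^n)|$, set of states $\{0,1\}\cup F$, $\mathbb{P}^{top}_{\alpha,\alpha}=\varnothing$ for every state $\alpha$, and, for states $\alpha\ne\beta$, $\mathbb{P}^{top}_{\alpha,\beta}$ the set of directed paths of $\mathrm{Glob}^{top}(\mathbf{D}^n)$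 from $\alpha$ to $\beta$, i.e. the paths from $\alpha$ to $\beta$ of the form $t\mapsto(z,\psi(t))$ with $z\in\mathbf{D}^n$ and $\psi:[0,1]\to[0,1]$ nondecreasing continuous. *)

(* Defs.v *)
From HB Require Import structures.
From mathcomp Require Import all_boot all_order all_algebra.
From mathcomp Require Import all_classical all_reals topology normedtype.
Set Implicit Arguments.
Unset Strict Implicit.
Unset Printing Implicit Defensive.
Import Order.TTheory GRing.Theory Num.Theory.
Import numFieldNormedType.Exports.
Local Open Scope classical_set_scope.
Local Open Scope ring_scope.

Section UnitInterval.
Context {R : realType}.

Definition itv01 : set R := `[0, 1].

Lemma clamp_subproof (x : R) : Num.max 0 (Num.min 1 x) \in itv01.
Proof.
by apply/mem_set; rewrite /itv01 /= in_itv /= le_max lexx ge_max ler01 ge_min lexx.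
Qed.

(* The nearest point of [0, 1]. *)
Definition clamp (x : R) : itv01 := exist (fun y => y \in itv01) _ (clamp_subproof x).

Definition i0 : itv01 := clamp 0.
Definition i1 : itv01 := clamp 1.

Lemma val_itv01 (t : itv01) : 0 <= val t <= 1.
Proof. by have := set_mem (valP t); rewrite /itv01 /= in_itv. Qed.

Lemma clampK (x : R) : 0 <= x <= 1 -> val (clamp x) = x.
Proof. by move=> /andP[x0 x1] /=; rewrite (min_idPr x1) (max_idPr x0). Qed.

Lemma val_i0 : val i0 = 0. Proof. by rewrite clampK // lexx ler01. Qed.
Lemma val_i1 : val i1 = 1. Proof. by rewrite clampK // lexx ler01. Qed.

Lemma valcK (t : itv01) : clamp (val t) = t.
Proof. by apply: val_inj; rewrite clampK // val_itv01. Qed.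

Lemma continuous_setval {T : topologicalType} (A : set T) :
  continuous (set_val : A -> T).
Proof. exact: initial_continuous. Qed.

Lemma continuous_to_set {S T : topologicalType} (A : set T) (f : S -> A) :
  continuous (fun x => set_val (f x)) -> continuous f.
Proof. by move=> cf; apply: continuous_comp_initial. Qed.

Lemma continuous_pairf {S T U : topologicalType} (f : S -> T) (g : S -> U) :
  continuous f -> continuous g -> continuous (fun x => (f x, g x)).
Proof. by move=> cf cg x; exact: (cvg_pair (cf x) (cg x)). Qed.

Lemma clamp_continuous : continuous clamp.
Proof.
apply: continuous_to_set => x.
have cmin : {for x, continuous (fun y : R => Num.min 1 y)}.
  by apply: (@continuous_min R R (fun=> 1) id x); [exact: cvg_cst|exact: cvg_id].
by apply: (@continuous_max R R (fun=> 0) (fun y => Num.min 1 y) x); [exact: cvg_cst|exact: cmin].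
Qed.

Definition nondecreasing01 (phi : itv01 -> itv01) :=
  forall s t : itv01, val s <= val t -> val (phi s) <= val (phi t).

(* The set M of nondecreasing surjective maps of the unit interval, which are
   automatically continuous. *)
Definition reparam (phi : itv01 -> itv01) :=
  nondecreasing01 phi /\ set_surj setT setT phi.

(* Normalized composition; meaningful when g1 i1 = g2 i0. *)
Definition concat {T : Type} (g1 g2 : itv01 -> T) : itv01 -> T :=
  fun t => if val t <= 2^-1 then g1 (clamp (2 * val t))
           else g2 (clamp (2 * val t - 1)).

End UnitInterval.

Section PathContinuity.
Context {R : realType}.
Local Notation I := (@itv01 R).

Lemma reparam_continuous (phi : I -> I) : reparam phi -> continuous phi.
Proof.
move=> [mono surj]; apply: continuous_to_set => t.
have surj' (y : R) : 0 <= y <= 1 -> exists s : I, val (phi s) = y.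
  move=> y01; have [s _ sy] := surj (clamp y) Logic.I.
  by exists s; rewrite sy clampK.
suff : forall e : R, 0 < e -> \forall s \near t, `|val (phi t) - val (phi s)| < e by move=> H; apply/(@cvgrPdist_lt _ R^o _ (nbhs t) (nbhs_filter t)).
move=> e e0.
have /andP[pt0 pt1] := val_itv01 (phi t).
have ct (U : set R) : open U -> U (val t) -> \forall s \near t, U (val s).
  by move=> oU Ut; apply: (@continuous_setval _ I t); exact: open_nbhs_nbhs.
have up : \forall s \near t, val (phi s) < val (phi t) + e.
  have [lt1|ge1] := ltP (val (phi t) + e / 2) 1; last first.
    near=> s; have /andP[_ ps1] := val_itv01 (phi s).
    apply: (le_lt_trans ps1); apply: (le_lt_trans ge1).
    by rewrite ltrD2l ltr_pdivrMr // ltr_pMr // ltr1n.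
  have [|s ps] := surj' (val (phi t) + e / 2).
    by rewrite (ltW lt1) andbT addr_ge0 // divr_ge0 // ltW.
  have ts : val t < val s.
    rewrite ltNge; apply/negP => /mono; rewrite ps.
    by rewrite leNgt ltrDl divr_gt0.
  have : \forall r \near t, val r < val s.
    exact: (ct [set x | x < val s] (@open_lt _ _)).
  apply: filterS => r /ltW /mono; rewrite ps => /le_lt_trans; apply.
  by rewrite ltrD2l ltr_pdivrMr // ltr_pMr // ltr1n.
have dn : \forall s \near t, val (phi t) - e < val (phi s).
  have [lt0|le0] := ltP 0 (val (phi t) - e / 2); last first.
    near=> s; have /andP[ps0 _] := val_itv01 (phi s).
    apply: lt_le_trans ps0; apply: lt_le_trans le0.
    by rewrite ltrD2l ltrN2 ltr_pdivrMr // ltr_pMr // ltr1n.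
  have [|s ps] := surj' (val (phi t) - e / 2).
    by rewrite (ltW lt0) /= lerBlDr (le_trans pt1) // lerDl divr_ge0 // ltW.
  have st : val s < val t.
    rewrite ltNge; apply/negP => /mono; rewrite ps.
    by rewrite leNgt ltrBlDr ltrDl divr_gt0.
  have : \forall r \near t, val s < val r.
    exact: (ct [set x | val s < x] (@open_gt _ _)).
  apply: filterS => r /ltW /mono; rewrite ps => /(lt_le_trans _); apply.
  by rewrite ltrD2l ltrN2 ltr_pdivrMr // ltr_pMr // ltr1n.
near=> s; rewrite ltr_distlC; apply/andP; split; first by near: s.
by near: s.
Unshelve. all: by end_near. Qed.

Lemma concat_continuous (T : topologicalType) (g1 g2 : I -> T) :
  continuous g1 -> continuous g2 -> g1 i1 = g2 i0 -> continuous (concat g1 g2).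
Proof.
move=> cg1 cg2 g12.
pose p1 (t : I) : I := clamp (2 * val t).
pose p2 (t : I) : I := clamp (2 * val t - 1).
have cval : continuous (val : I -> R) := @continuous_setval _ _.
have caff (a b : R) : continuous (fun t : I => a * val t + b).
  have ca : continuous (fun x : R => a * x + b).
    by move=> x; apply: cvgD; [apply: cvgM; [exact: cvg_cst|exact: cvg_id]|exact: cvg_cst].
  move=> t; apply: (@continuous_comp _ _ _ (val : I -> R) (fun x : R => a * x + b)).
    exact: cval.
  exact: ca.
have cp1 : continuous p1.
  move=> t; have /funext E : p1 =1 clamp \o (fun t : I => 2 * val t + 0).
    by move=> s; rewrite /p1 /= addr0.
  by rewrite E; apply: continuous_comp; [exact: caff|exact: clamp_continuous].
have cp2 : continuous p2.
  move=> t; apply: (@continuous_comp _ _ _ (fun t : I => 2 * val t - 1) clamp).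
    exact: caff.
  exact: clamp_continuous.
have cl A : closed A -> closed (concat g1 g2 @^-1` A).
  move=> cA.
  have -> : concat g1 g2 @^-1` A =
     ((val @^-1` [set x : R | x <= 2^-1]) `&` ((g1 \o p1) @^-1` A)) `|`
     ((val @^-1` [set x : R | 2^-1 <= x]) `&` ((g2 \o p2) @^-1` A)).
    apply/seteqP; split=> [t|t] /=; rewrite /concat.
      by case: leP => h Ht; [left|right]; split=> //; exact: ltW.
    move=> [[h H]|[h H]]; first by rewrite h.
    case: leP => // h'; have tE : val t = 2^-1 by apply/le_anti; rewrite h h'.
    suff -> : g1 (clamp (2 * val t)) = g2 (p2 t) by [].
    by rewrite /p2 tE mulfV ?pnatr_eq0 // subrr.
  apply: closedU; apply: closedI.
  - by apply: closed_comp; [move=> ? _; exact: cval|exact: closed_le].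
  - apply: closed_comp => // t _.
    by apply: continuous_comp; [exact: cp1|exact: cg1].
  - by apply: closed_comp; [move=> ? _; exact: cval|exact: closed_ge].
  - apply: closed_comp => // t _.
    by apply: continuous_comp; [exact: cp2|exact: cg2].
by apply/continuous_closedP.
Qed.

End PathContinuity.

Section DeltaSpaces.
Context {R : realType}.
Local Notation I := (@itv01 R).

Definition simplex (n : nat) : set 'rV[R]_n.+1 :=
  [set x | (forall i, 0 <= x 0 i) /\ \sum_i x 0 i = 1].
Arguments simplex n _ : clear implicits.

(* The open subsets of the Delta-kelleyfication of T. *)
Definition delta_open (T : topologicalType) (U : set T) :=
  forall (n : nat) (s : simplex n -> T), continuous s -> open (s @^-1` U).

Definition delta_generated (T : topologicalType) :=
  forall U : set T, delta_open U -> open U.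

Definition delta_hausdorff (T : topologicalType) :=
  forall g : I -> T, continuous g -> closed (range g).

(* Membership in Top: Delta-generated spaces when dH = false, Delta-Hausdorff
   Delta-generated spaces when dH = true. *)
Definition in_Top (dH : bool) (T : topologicalType) :=
  delta_generated T /\ (dH -> delta_hausdorff T).

Lemma open_delta_open (T : topologicalType) (U : set T) : open U -> delta_open U.
Proof. by move=> oU n s /continuousP; apply. Qed.

Lemma delta_openT (T : topologicalType) : delta_open [set: T].
Proof. by apply: open_delta_open; exact: openT. Qed.

Lemma delta_openI (T : topologicalType) : setI_closed (@delta_open T).
Proof. by move=> U V dU dV n s cs; apply: openI; [exact: dU|exact: dV]. Qed.

Lemma delta_open_bigU (T : topologicalType) (J : Type) (f : J -> set T) :
  (forall i, delta_open (f i)) -> delta_open (\bigcup_i f i).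
Proof. by move=> df n s cs; apply: bigcup_open => i _; exact: df. Qed.

Lemma delta_open_preimage (S T : topologicalType) (f : S -> T) (U : set T) :
  continuous f -> delta_open U -> delta_open (f @^-1` U).
Proof.
move=> cf dU n s cs; apply: (dU n (f \o s)) => x.
by apply: continuous_comp; [exact: cs|exact: cf].
Qed.

Lemma delta_open_path (T : topologicalType) (U : set T) (g : I -> T) :
  delta_open U -> continuous g -> open (g @^-1` U).
Proof.
move=> dU cg.
pose e (t : I) : 'rV[R]_2 := \row_i (if i == 0 then 1 - val t else val t).
have eP t : e t \in simplex 1.
  apply/mem_set; split=> [i|].
    by rewrite mxE; have := val_itv01 t; case: ifP => _ /andP[? ?]; rewrite ?subr_ge0.
  by rewrite big_ord_recl big_ord1 !mxE /= subrK.
pose e' (t : I) : simplex 1 := exist (fun y => y \in simplex 1) (e t) (eP t).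
pose p (x : simplex 1) : I := clamp (val x 0 1).
have pe t : p (e' t) = t by rewrite /p /e' /= mxE /= valcK.
have cp : continuous p.
  move=> x; apply: (@continuous_comp _ _ _ (fun x : simplex 1 => val x 0 1) clamp).
    apply: (@continuous_comp _ _ _ (set_val : simplex 1 -> _)
             (fun M : 'rV[R]_2 => M 0 1)); first exact: continuous_setval.
    exact: coord_continuous.
  exact: clamp_continuous.
have ce : continuous e'.
  have cval : continuous (val : I -> R) := @continuous_setval _ _.
  have ci i : continuous (fun s : I => e s 0 i).
    have [->|/negPf i0] := eqVneq i 0.
      have -> : (fun s : I => e s 0 0) = (fun s : I => 1 - val s).
        by apply/funext => s; rewrite mxE eqxx.
      move=> t; apply: (@continuousB _ R^o I (fun=> 1) val t); last exact: (cval t).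
      exact: cst_continuous.
    by have -> : (fun s : I => e s 0 i) = val by apply/funext => s; rewrite mxE i0.
  apply: continuous_to_set => t A [P Pn PA].
  have : \forall s \near t, forall i, P 0 i (e s 0 i).
    by apply: (@filter_forall _ _ (fun i s => P 0 i (e s 0 i)) (nbhs t) (nbhs_filter t)) => i; exact: ci (Pn 0 i).
  by apply: filterS => s Ps; apply: PA => j i; rewrite ord1; exact: Ps.
have oU : open ((g \o p) @^-1` U).
  by apply: dU => x; apply: continuous_comp; [exact: cp|exact: cg].
have -> : g @^-1` U = e' @^-1` ((g \o p) @^-1` U).
  by apply/seteqP; split=> t /=; rewrite pe.
by move/continuousP: ce; apply.
Qed.

Lemma hausdorff_in_Top dH (T : topologicalType) :
  delta_generated T -> hausdorff_space T -> in_Top dH T.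
Proof.
move=> dT hT; split=> // _ g cg.
apply: (compact_closed hT); apply: continuous_compact.
  exact/continuous_subspaceT.
have -> : [set: I] = clamp @` `[0, 1].
  by apply/seteqP; split=> // t _; exists (val t); rewrite ?valcK //= in_itv /= val_itv01.
apply: continuous_compact; last exact: segment_compact.
exact/continuous_subspaceT/clamp_continuous.
Qed.

End DeltaSpaces.

Section MultipointedDSpaces.
Context (R : realType) (dH : bool).
Local Notation I := (@itv01 R).

Record mdspace := MDSpace {
  mdcar :> topologicalType;
  states : set mdcar;
  expath : set (I -> mdcar);
  mdcar_in_Top : in_Top (R := R) dH mdcar;
  expath_continuous : forall g, expath g -> continuous g;
  expath_states : forall g, expath g -> states (g i0) /\ states (g i1);
  expath_reparam : forall g phi, expath g -> reparam phi -> expath (g \o phi);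
  expath_concat : forall g1 g2, expath g1 -> expath g2 -> g1 i1 = g2 i0 ->
    expath (concat g1 g2) }.

Record mdhom (X Y : mdspace) := MDHom {
  mdfun :> X -> Y;
  mdhom_continuous : continuous mdfun;
  mdhom_states : forall x, states x -> states (mdfun x);
  mdhom_expath : forall g, expath g -> expath (mdfun \o g) }.

Lemma mdhom_ext (X Y : mdspace) (f g : mdhom X Y) : f =1 g -> f = g.
Proof.
case: f g => [f f1 f2 f3] [g g1 g2 g3] /= /funext fg.
by subst g; congr MDHom; exact: Prop_irrelevance.
Qed.

Program Definition mdid (X : mdspace) : mdhom X X := @MDHom X X idfun _ _ _.
Next Obligation. by move=> X x; exact: cvg_id. Qed.
Next Obligation. by []. Qed.
Next Obligation. by []. Qed.

Program Definition mdcomp (X Y Z : mdspace) (g : mdhom Y Z) (f : mdhom X Y) :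
  mdhom X Z := @MDHom X Z (g \o f) _ _ _.
Next Obligation.
by move=> X Y Z g f x; apply: continuous_comp; apply: mdhom_continuous.
Qed.
Next Obligation. by move=> X Y Z g f x sx /=; do 2!apply: mdhom_states. Qed.
Next Obligation.
move=> X Y Z g f p px.
exact: (mdhom_expath g (mdhom_expath f px)).
Qed.

Definition is_pushout (A B C P : mdspace) (f : mdhom A B) (g : mdhom A C)
    (h : mdhom B P) (k : mdhom C P) :=
  mdcomp h f = mdcomp k g /\
  forall (W : mdspace) (u : mdhom B W) (v : mdhom C W),
    mdcomp u f = mdcomp v g ->
    exists! w : mdhom P W, mdcomp w h = u /\ mdcomp w k = v.

(* A set S viewed as the multipointed d-space (S, S, set0). *)
Section SetObject.
Variable S : choiceType.

Lemma discrete_open (T : choiceType) (U : set (discrete_topology T)) : open U.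
Proof. by rewrite openE => x Ux; apply/principal_filterP. Qed.

Lemma discrete_in_Top (T : choiceType) :
  in_Top (R := R) dH (discrete_topology T).
Proof.
split=> [U _|_ g _]; first exact: discrete_open.
by rewrite -openC; exact: discrete_open.
Qed.

Program Definition mdset : mdspace :=
  @MDSpace (discrete_topology S) setT set0 (discrete_in_Top S) _ _ _ _.
Next Obligation. by []. Qed.
Next Obligation. by []. Qed.
Next Obligation. by []. Qed.
Next Obligation. by []. Qed.

End SetObject.

Program Definition mdset_map (S S' : choiceType) (f : S -> S') :
  mdhom (mdset S) (mdset S') := @MDHom (mdset S) (mdset S') f _ _ _.
Next Obligation.
by move=> S S' f; apply/continuousP => A _; exact: discrete_open.
Qed.
Next Obligation. by []. Qed.
Next Obligation. by []. Qed.

End MultipointedDSpaces.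
Notation "g '\oM' f" := (mdcomp g f) (at level 50, left associativity).

Section Globe.
Context {R : realType}.
Local Notation I := (@itv01 R).
Variable Z : topologicalType.

Definition opn01 : set R := `]0, 1[.

(* As a set, the quotient of {0,1} + Z * [0,1] that identifies (z,0) with 0 and
   (z,1) with 1 is the disjoint union of {0,1} and Z * ]0,1[. *)
Definition globe : Type := (bool + Z * opn01)%type.
HB.instance Definition _ := Choice.on globe.

Definition globe_pole (b : bool) : globe := inl b.

(* The image of (z,t) in the quotient. *)
Definition globe_pt (z : Z) (t : I) : globe :=
  if insub (val t) is Some u then inr (z, u) else globe_pole (val t == 1).

(* The final topology for the quotient map, Z * [0,1] being the product in Top,
   that is the Delta-kelleyfication of the product topology. *)
Definition globe_open (U : set globe) :=
  delta_open (R := R) [set p : Z * I | U (globe_pt p.1 p.2)].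

Lemma globe_openT : globe_open setT.
Proof. exact: delta_openT. Qed.

Lemma globe_openI : setI_closed globe_open.
Proof. by move=> U V oU oV; exact: delta_openI oU oV. Qed.

Lemma globe_open_bigU (J : Type) (f : J -> set globe) :
  (forall i, globe_open (f i)) -> globe_open (\bigcup_i f i).
Proof. by move=> of_; have := delta_open_bigU of_. Qed.

HB.instance Definition _ :=
  isOpenTopological.Build globe globe_openT globe_openI globe_open_bigU.

Lemma globe_openE (U : set globe) : open U = globe_open U.
Proof. by []. Qed.

Lemma globe_ptP z (t : I) : [\/ val t = 0 /\ globe_pt z t = globe_pole false,
  val t = 1 /\ globe_pt z t = globe_pole true |
  exists u : opn01, val u = val t /\ globe_pt z t = inr (z, u)].
Proof.
have /andP[t0 t1] := val_itv01 t.
rewrite /globe_pt; case: insubP => [u _ ut|/negP nt].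
  by constructor 3; exists u.
have [->|/eqP tn1] := val t =P 1; first by constructor 2.
have [->|/eqP tn0] := val t =P 0.
  by constructor 1; split=> //; rewrite eq_sym oner_eq0.
case: nt; apply/mem_set.
by rewrite /opn01 /= in_itv /= !lt_neqAle t0 t1 eq_sym tn0 tn1.
Qed.

Lemma opn01P (u : opn01) : 0 < val u < 1.
Proof. by have := set_mem (valP u); rewrite /opn01 /= in_itv. Qed.

Lemma globe_pt0 z : globe_pt z i0 = globe_pole false.
Proof.
have [[_ ->]|[e _]|[u [e _]]] := globe_ptP z i0 => //.
  by move/eqP: e; rewrite val_i0 eq_sym oner_eq0.
by have := opn01P u; rewrite e val_i0 ltxx.
Qed.

Lemma globe_pt1 z : globe_pt z i1 = globe_pole true.
Proof.
have [[e _]|[_ ->]|[u [e _]]] := globe_ptP z i1 => //.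
  by move/eqP: e; rewrite val_i1 oner_eq0.
by have := opn01P u; rewrite e val_i1 ltxx andbF.
Qed.

Definition globe_time (x : globe) : R :=
  match x with inl b => b%:R | inr (_, u) => val u end.

Lemma globe_time_pt z (t : I) : globe_time (globe_pt z t) = val t.
Proof.
by have [[-> ->]|[-> ->]|[u [<- ->]]] := globe_ptP z t.
Qed.

Lemma globe_inr z (u : opn01) : inr (z, u) = globe_pt z (clamp (val u)).
Proof.
have /andP[/ltW u0 /ltW u1] := opn01P u.
by rewrite /globe_pt clampK ?u0 ?u1 // valK.
Qed.

(* Two representations of a point that is not a pole agree. *)
Lemma globe_pt_inj z z' (t t' : I) : globe_pt z t = globe_pt z' t' ->
  val t = val t' /\ (0 < val t < 1 -> z = z').
Proof.
move=> e; have tt : val t = val t' by rewrite -(globe_time_pt z) e globe_time_pt.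
split=> // /andP[t0 t1]; move: e.
have [[e0 _]|[e1 _]|[u [_ ->]]] := globe_ptP z t.
- by rewrite e0 ltxx in t0.
- by rewrite e1 ltxx in t1.
have [[e0 _]|[e1 _]|[u' [_ ->]]] := globe_ptP z' t'.
- by rewrite tt e0 ltxx in t0.
- by rewrite tt e1 ltxx in t1.
by case.
Qed.

Lemma globe_pt_continuous z : continuous (globe_pt z).
Proof.
apply/continuousP => U oU.
apply: (@delta_open_path R _ _ (fun t : I => (z, t)) oU).
by apply: continuous_pairf => t; [exact: cst_continuous|exact: cvg_id].
Qed.

Lemma globe_delta_generated : delta_generated (R := R) globe.
Proof.
move=> U dU; rewrite globe_openE => n s cs.
apply: (dU n (fun x => globe_pt (s x).1 (s x).2)).
by apply/continuousP => V oV; exact: (oV n s cs).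
Qed.

Lemma globe_hausdorff : hausdorff_space Z -> hausdorff_space globe.
Proof.
move=> hZ.
have ctime : continuous globe_time.
  apply/continuousP => A oA; rewrite globe_openE; apply: open_delta_open.
  have -> : [set p : Z * I | (globe_time @^-1` A) (globe_pt p.1 p.2)] =
      [set p : Z * I | A (val p.2)].
    by apply/seteqP; split=> p /=; rewrite globe_time_pt.
  have c : continuous (fun p : Z * I => val p.2 : R).
    move=> p; apply: (@continuous_comp _ _ _ snd (val : I -> R)).
      exact: cvg_snd.
    exact: continuous_setval.
  by move/continuousP: c; apply.
rewrite open_hausdorff => x y xy.
have [txy|txy] := eqVneq (globe_time x) (globe_time y); last first.
  have := @Rhausdorff R; rewrite open_hausdorff => /(_ _ _ txy)[[A B] /= [xA yB]].
  move=> [oA oB AB]; exists (globe_time @^-1` A, globe_time @^-1` B) => /=.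
    by split; apply/mem_set; apply: set_mem.
  split; [by move/continuousP: ctime; apply|by move/continuousP: ctime; apply|].
  by rewrite -preimage_setI (eqP AB) preimage_set0.
case: x y xy txy => [b|[z u]] [b'|[z' u']] //= xy.
- by move/eqP; rewrite eqr_nat => /eqP e; case/negP: xy; case: b b' e => [] [].
- move=> e; have ub : val u' = b%:R := esym e.
  by have := opn01P u'; rewrite ub; case: (b); rewrite ltxx ?andbF.
- move=> e; have ub : val u = b'%:R := e.
  by have := opn01P u; rewrite ub; case: (b'); rewrite ltxx ?andbF.
move=> /val_inj e; subst u'.
have zz : z != z' by apply: contraNneq xy => ->.
move: hZ; rewrite open_hausdorff => /(_ _ _ zz)[[A B] /= [zA zB]] [oA oB AB].
pose cone (C : set Z) : set globe :=
  [set x | if x is inr (w, _) then C w else False].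
have cone_open C : open C -> open (cone C).
  move=> oC; rewrite globe_openE; apply: open_delta_open.
  have -> : [set p : Z * I | cone C (globe_pt p.1 p.2)] =
      (fst @^-1` C) `&` ((fun p : Z * I => val p.2) @^-1` opn01).
    apply/seteqP; split=> -[w t] /=.
      have [[_ ->]|[_ ->]|[v [vt ->]]] := globe_ptP w t => //= Cw.
      by split=> //; rewrite -vt /opn01 /= in_itv /= opn01P.
    move=> [Cw]; rewrite /opn01 /= in_itv /= => /andP[t0 t1].
    have [[e ->]|[e ->]|[v [vt ->]]] := globe_ptP w t => //=.
      by rewrite e ltxx in t0.
    by rewrite e ltxx in t1.
  apply: openI; first by apply: open_comp => // p _; exact: cvg_fst.
  apply: open_comp; last exact: interval_open.
  move=> p _; apply: (@continuous_comp _ _ _ snd (val : I -> R)).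
    exact: cvg_snd.
  exact: continuous_setval.
exists (cone A, cone B) => /=; first by split; apply/mem_set; exact: set_mem.
split; [exact: cone_open|exact: cone_open|].
apply/eqP/seteqP; split=> // -[b|[w v]] /= []// Aw Bw.
by have : (A `&` B) w by []; rewrite (eqP AB).
Qed.

End Globe.
Arguments globe R Z : clear implicits.
Arguments globe_pole {R Z} b.

Section GlobeObject.
Context (R : realType) (dH : bool).
Local Notation I := (@itv01 R).
Local Notation mdspace := (mdspace R dH).
Local Notation globe := (globe R).

Section Glob.
Variables (Z : topologicalType) (hZ : hausdorff_space Z).

Lemma globe_in_Top : in_Top (R := R) dH (globe Z).
Proof.
by apply: hausdorff_in_Top; [exact: globe_delta_generated|exact: globe_hausdorff].
Qed.

Definition globe_state : set (globe Z) := range globe_pole.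

Definition globe_expath : set (I -> globe Z) :=
  [set g | exists z phi, reparam phi /\ g = globe_pt z \o phi].

Lemma reparam01 (phi : I -> I) : reparam phi -> phi i0 = i0 /\ phi i1 = i1.
Proof.
move=> [mono surj]; split; apply/val_inj/le_anti/andP; split.
- have [s _ se] := surj i0 Logic.I; rewrite -{2}se; apply: mono.
  by rewrite val_i0; have /andP[] := val_itv01 s.
- by rewrite val_i0; have /andP[] := val_itv01 (phi i0).
- by rewrite val_i1; have /andP[] := val_itv01 (phi i1).
- have [s _ se] := surj i1 Logic.I; rewrite -{1}se; apply: mono.
  by rewrite val_i1; have /andP[] := val_itv01 s.
Qed.

Lemma reparam_comp (phi psi : I -> I) :
  reparam phi -> reparam psi -> reparam (phi \o psi).
Proof.
move=> [mp sp] [mq sq]; split=> [s t st|t _]; first exact/mp/mq.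
have [s _ <-] := sp t Logic.I; have [r _ <-] := sq s Logic.I.
by exists r.
Qed.

Lemma globe_expath_ends g : globe_expath g ->
  g i0 = globe_pole false /\ g i1 = globe_pole true.
Proof.
move=> [z [phi [rp ->]]] /=; have [-> ->] := reparam01 rp.
by rewrite globe_pt0 globe_pt1.
Qed.

(* The Hausdorff hypothesis ensures that the globe is Delta-Hausdorff; it holds
   for disks and spheres, the only spaces Z that are used. *)
Program Definition Glob : mdspace :=
  @MDSpace R dH (globe Z) globe_state globe_expath globe_in_Top _ _ _ _.
Next Obligation.
move=> g [z [phi [rp ->]]] t; apply: continuous_comp.
  exact: reparam_continuous.
exact: globe_pt_continuous.
Qed.
Next Obligation.
by move=> g /globe_expath_ends[-> ->]; split; exact: imageT.
Qed.
Next Obligation.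
move=> g phi [z [psi [rp ->]]] rphi; exists z, (psi \o phi).
by split=> //; exact: reparam_comp.
Qed.
Next Obligation.
by move=> g1 g2 /globe_expath_ends[_ ->] /globe_expath_ends[-> _].
Qed.

End Glob.
Arguments globe_state {Z} _.

Section GlobMap.
Variables (Z Z' : topologicalType) (hZ : hausdorff_space Z).
Variables (hZ' : hausdorff_space Z') (f : Z -> Z') (cf : continuous f).

Definition globe_map (x : globe Z) : globe Z' :=
  match x with inl b => inl b | inr (z, u) => inr (f z, u) end.

Lemma globe_map_pt z (t : I) : globe_map (globe_pt z t) = globe_pt (f z) t.
Proof. by rewrite /globe_pt; case: insubP. Qed.

Lemma globe_map_continuous : continuous globe_map.
Proof.
apply/continuousP => U oU; rewrite globe_openE /globe_open.
have -> : [set p : Z * I | (globe_map @^-1` U) (globe_pt p.1 p.2)] =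
    (fun p : Z * I => (f p.1, p.2)) @^-1` [set p : Z' * I | U (globe_pt p.1 p.2)].
  by apply/seteqP; split=> p /=; rewrite globe_map_pt.
apply: delta_open_preimage; last exact: oU.
apply: continuous_pairf => p; last exact: cvg_snd.
by apply: continuous_comp; [exact: cvg_fst|exact: cf].
Qed.

Program Definition Glob_map : mdhom (Glob hZ) (Glob hZ') :=
  @MDHom R dH (Glob hZ) (Glob hZ') globe_map globe_map_continuous _ _.
Next Obligation. by move=> _ [b _ <-]; exists b. Qed.
Next Obligation.
move=> _ [z [phi [rp ->]]]; exists (f z), phi; split=> //.
by apply/funext => t /=; rewrite globe_map_pt.
Qed.

End GlobMap.

Section Disk.
Variable n : nat.

Definition disk : set 'rV[R]_n := [set x | \sum_i x 0 i ^+ 2 <= 1].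
Definition sphere : set 'rV[R]_n := [set x | \sum_i x 0 i ^+ 2 = 1].

Lemma rV_hausdorff (A : set 'rV[R]_n) : hausdorff_space A.
Proof.
rewrite open_hausdorff => x y /eqP xy.
have [i xyi] : exists i, val x 0 i != val y 0 i.
  apply: contrapT => H; apply: xy; apply/val_inj/rowP => i.
  by apply/eqP/negPn/negP => h; apply: H; exists i.
have := @Rhausdorff R; rewrite open_hausdorff => /(_ _ _ xyi).
move=> [[U V] /= [xU yV]] [oU oV UV].
have c : continuous (fun x : A => val x 0 i).
  move=> z; apply: (@continuous_comp _ _ _ (set_val : A -> _)
             (fun M : 'rV[R]_n => M 0 i)); first exact: continuous_setval.
  exact: coord_continuous.
exists ((fun x : A => val x 0 i) @^-1` U, (fun x : A => val x 0 i) @^-1` V) => /=.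
  by split; apply/mem_set; exact: set_mem.
split; [by move/continuousP: c; apply|by move/continuousP: c; apply|].
by rewrite -preimage_setI (eqP UV) preimage_set0.
Qed.

Arguments rV_hausdorff A : clear implicits.

Lemma sphere_disk_subproof (x : sphere) : val x \in disk.
Proof. by apply/mem_set; rewrite /disk /= (set_mem (valP x)). Qed.

Definition sphere_disk (x : sphere) : disk :=
  exist (fun y => y \in disk) (val x) (sphere_disk_subproof x).

Lemma sphere_disk_continuous : continuous sphere_disk.
Proof. by apply: continuous_to_set => x; exact: continuous_setval. Qed.

(* Glob(S^(n-1)), Glob(D^n) and the inclusion between them. *)
Definition GlobS : mdspace := Glob (rV_hausdorff sphere).
Definition GlobD : mdspace := Glob (rV_hausdorff disk).
Definition GlobSD : mdhom GlobS GlobD :=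
  Glob_map (rV_hausdorff sphere) (rV_hausdorff disk) sphere_disk_continuous.

Section GlobF.
Variable F : set GlobD.

Definition globF_state : set (globe disk) := globe_state `|` F.

Definition globF_expath : set (I -> globe disk) :=
  [set g | [/\ globF_state (g i0), globF_state (g i1), g i0 <> g i1 &
    exists z psi, [/\ nondecreasing01 psi, continuous psi &
      g = globe_pt z \o psi]]].

Lemma concat_i0 (T : Type) (g1 g2 : I -> T) : concat g1 g2 i0 = g1 i0.
Proof. by rewrite /concat val_i0 invr_ge0 ler0n mulr0. Qed.

Lemma concat_i1 (T : Type) (g1 g2 : I -> T) : concat g1 g2 i1 = g2 i1.
Proof.
rewrite /concat val_i1 leNgt invf_lt1 ?ltr0n // ltr1n /=.
by rewrite mulr1 -[2]/(1 + 1) addrK.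
Qed.

Lemma concat_nondecreasing (p1 p2 : I -> I) : nondecreasing01 p1 ->
  nondecreasing01 p2 -> p1 i1 = p2 i0 -> nondecreasing01 (concat p1 p2).
Proof.
move=> m1 m2 e s t st.
have mono_clamp (x y : R) : x <= y -> val (clamp x) <= val (clamp y).
  by move=> xy /=; apply: le_max2 => //; apply: le_min2.
rewrite /concat; case: (leP (val s)) => hs; case: (leP (val t)) => ht.
- by apply: m1; apply: mono_clamp; rewrite ler_pM2l.
- apply: (@le_trans _ _ (val (p1 i1))).
    by apply: m1; rewrite val_i1; have /andP[] := val_itv01 (clamp (2 * val s)).
  rewrite e; apply: m2; rewrite val_i0.
  by have /andP[] := val_itv01 (clamp (2 * val t - 1)).
- by have := lt_le_trans hs (le_trans st ht); rewrite ltxx.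
- by apply: m2; apply: mono_clamp; rewrite lerD2r ler_pM2l.
Qed.

(* Glob(D^n)_F. The definition makes sense for every set F of points, finite or
   not. *)
Program Definition GlobF : mdspace :=
  @MDSpace R dH (globe disk) globF_state globF_expath
    (globe_in_Top (rV_hausdorff disk)) _ _ _ _.
Next Obligation.
move=> g [_ _ _ [z [psi [_ cpsi ->]]]] t.
by apply: continuous_comp; [exact: cpsi|exact: globe_pt_continuous].
Qed.
Next Obligation. by move=> g []. Qed.
Next Obligation.
move=> g phi [s0 s1 s01 [z [psi [mpsi cpsi ge]]]] rphi; subst g.
have [p0 p1] := reparam01 rphi.
split; rewrite /= ?p0 ?p1; [exact: s0|exact: s1|exact: s01|].
exists z, (psi \o phi); split=> //.
  by move=> s t st; apply/mpsi/rphi.1.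
by move=> t; apply: continuous_comp; [exact: reparam_continuous|exact: cpsi].
Qed.
Next Obligation.
move=> g1 g2 [s10 s11 n1 [z1 [p1 [m1 c1 e1]]]] [s20 s21 n2 [z2 [p2 [m2 c2 e2]]]].
subst g1 g2 => /= /globe_pt_inj[e ez].
have lt01 (p : I -> I) (z : disk) : nondecreasing01 p ->
    globe_pt z (p i0) <> globe_pt z (p i1) -> val (p i0) < val (p i1).
  move=> mp ne; rewrite lt_neqAle; apply/andP; split.
    by apply/eqP => /val_inj H; apply: ne; rewrite H.
  by apply: mp; rewrite val_i0 val_i1 ler01.
have l1 := lt01 _ _ m1 n1; have l2 := lt01 _ _ m2 n2.
have z12 : z1 = z2.
  apply: ez; apply/andP; split.
    by apply: le_lt_trans l1; have /andP[] := val_itv01 (p1 i0).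
  by rewrite e; apply: (lt_le_trans l2); have /andP[] := val_itv01 (p2 i1).
subst z2; move/val_inj: e => e.
have E : concat (globe_pt z1 \o p1) (globe_pt z1 \o p2) =
    globe_pt z1 \o concat p1 p2.
  by apply/funext => t; rewrite /concat /=; case: ifP.
split; rewrite ?concat_i0 ?concat_i1 //=.
  move=> /globe_pt_inj[h _]; have := lt_trans l1.
  by rewrite e h => /(_ _ l2); rewrite ltxx.
exists z1, (concat p1 p2); split=> //; first exact: concat_nondecreasing.
exact: concat_continuous.
Qed.

Program Definition GlobDF : mdhom GlobD GlobF :=
  @MDHom R dH GlobD GlobF idfun _ _ _.
Next Obligation. by move=> x; exact: cvg_id. Qed.
Next Obligation. by move=> x sx; left. Qed.
Next Obligation.
move=> g pg; have [g0 g1] := globe_expath_ends pg.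
have [z [phi [rp ge]]] := pg.
split; rewrite /= ?g0 ?g1 //; [by left; exact: imageT..|].
by exists z, phi; split=> //; [exact: rp.1|exact: reparam_continuous].
Qed.

Definition GlobSF : mdhom GlobS GlobF := mdcomp GlobDF GlobSD.

End GlobF.

Definition globe_interior : set GlobD := ~` range GlobSD.

End Disk.
End GlobeObject.

Section ModelStructure.
Context (R : realType) (dH : bool).
Local Notation mdspace := (mdspace R dH).

Variant generating_cofibration : forall A B : mdspace, mdhom A B -> Prop :=
| gc_globe (n : nat) : generating_cofibration (GlobSD R dH n)
| gc_empty : generating_cofibration
    (mdset_map R dH (fun x : void => match x return unit with end))
| gc_fold : generating_cofibration (mdset_map R dH (fun _ : bool => tt)).

Definition has_lifting (A B X Y : mdspace) (i : mdhom A B) (p : mdhom X Y) :=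
  forall (u : mdhom A X) (v : mdhom B Y), p \oM u = v \oM i ->
    exists h : mdhom B X, h \oM i = u /\ p \oM h = v.

(* In a cofibrantly generated model category the trivial fibrations are the maps
   with the right lifting property against the generating cofibrations, and the
   cofibrations those with the left lifting property against trivial
   fibrations. *)
Definition trivial_q_fibration (X Y : mdspace) (p : mdhom X Y) :=
  forall (A B : mdspace) (i : mdhom A B),
    generating_cofibration i -> has_lifting i p.

Definition q_cofibration (A B : mdspace) (i : mdhom A B) :=
  forall (X Y : mdspace) (p : mdhom X Y),
    trivial_q_fibration p -> has_lifting i p.

End ModelStructure.

Section Towers.

(* A nonzero ordinal; its elements are the smaller ordinals and \bot is 0. *)
Record wellOrder := WellOrder {
  wo_disp : Order.disp_t;
  wo_car :> bOrderType wo_disp;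
  wo_wf : well_founded (fun x y : wo_car => (x < y)%O) }.

Definition is_succ (L : wellOrder) (u v : L) :=
  (u < v)%O /\ forall w : L, (u < w)%O -> (v <= w)%O.

Definition is_limit (L : wellOrder) (v : L) :=
  v <> \bot%O /\ forall u : L, ~ is_succ u v.

Lemma is_succ_le (L : wellOrder) (u v : L) : is_succ u v -> (u <= v)%O.
Proof. by move=> [/ltW]. Qed.

Context (R : realType) (dH : bool).
Local Notation mdspace := (mdspace R dH).

(* Colimit preservation means X_v = colim_(u < v) X_u for limit ordinals v. *)
Record tower (L : wellOrder) := Tower {
  tower_ob :> L -> mdspace;
  tower_map : forall u v : L, (u <= v)%O -> mdhom (tower_ob u) (tower_ob v);
  tower_map_id : forall (u : L) (h : (u <= u)%O),
    tower_map h = mdid (tower_ob u);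
  tower_map_comp : forall (u v w : L)
      (uv : (u <= v)%O) (vw : (v <= w)%O) (uw : (u <= w)%O),
    tower_map vw \oM tower_map uv = tower_map uw;
  tower_map_lim : forall v : L, is_limit v ->
    forall (W : mdspace) (k : forall u : L, (u < v)%O -> mdhom (tower_ob u) W),
    (forall (u u' : L) (uu' : (u <= u')%O) (h : (u < v)%O) (h' : (u' < v)%O),
      k u' h' \oM tower_map uu' = k u h) ->
    exists! w : mdhom (tower_ob v) W,
      forall (u : L) (h : (u < v)%O), w \oM tower_map (ltW h) = k u h }.

Definition is_cocone (L : wellOrder) (T : tower L) (C : mdspace)
    (k : forall u : L, mdhom (T u) C) :=
  forall (u v : L) (uv : (u <= v)%O), k v \oM tower_map T uv = k u.

Definition is_colimit (L : wellOrder) (T : tower L) (C : mdspace)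
    (k : forall u : L, mdhom (T u) C) :=
  is_cocone k /\
  forall (W : mdspace) (k' : forall u : L, mdhom (T u) W), is_cocone k' ->
    exists! w : mdhom C W, forall u : L, w \oM k u = k' u.

Definition tower_next (L : wellOrder) (T : tower L) (u v : L)
  (h : is_succ u v) : mdhom (T u) (T v) := tower_map T (is_succ_le h).

Record cell_attachment (L : wellOrder) (T : tower L) (u v : L)
    (h : is_succ u v) := CellAttachment {
  cell_dim : nat;
  cell_attach : mdhom (GlobS R dH cell_dim) (T u);
  cell_char : mdhom (GlobD R dH cell_dim) (T v);
  cell_pushout : is_pushout cell_attach (GlobSD R dH cell_dim)
                            (tower_next T h) cell_char }.

(* The tower is indexed by the ordinals u < L, and a cell is attached for every
   u < L such that u + 1 < L. For L = m + 1 the colimit is the last object X_m,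
   so that finite cell complexes are covered. *)
Record cellular_decomposition (X : mdspace) := CellularDecomposition {
  cd_ord : wellOrder;
  cd_tower :> tower cd_ord;
  cd_leg : forall u : cd_ord, mdhom (cd_tower u) X;
  cd_colimit : is_colimit cd_leg;
  cd_bot_discrete : forall U : set (cd_tower \bot%O), open U;
  cd_bot_states : @states R dH (cd_tower \bot%O) = setT;
  cd_bot_expath : @expath R dH (cd_tower \bot%O) = set0;
  cd_bot_bij : set_bij setT (@states R dH X) (cd_leg \bot%O);
  cd_cell : forall (u v : cd_ord) (h : is_succ u v),
    cell_attachment cd_tower h }.

Arguments cd_leg {X} _ _.
Arguments cd_tower {X} _.

Definition cellular (X : mdspace) := inhabited (cellular_decomposition X).

Section Cells.
Variables (X : mdspace) (D : cellular_decomposition X).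
Variables (u v : cd_ord D) (h : is_succ u v).

Definition cd_dim : nat := cell_dim (cd_cell h).

(* The composite of the characteristic map with the map to the colimit. *)
Definition cd_char : mdhom (GlobD R dH cd_dim) X :=
  cd_leg D v \oM cell_char (cd_cell h).

Definition globular_cell : set X := cd_char @` globe_interior (n := cd_dim).

(* c^- for s = false, c^+ for s = true. *)
Definition cell_end (s : bool) : X := cd_char (globe_pole s).

End Cells.

(* x^- (s = false) or x^+ (s = true), where a point x that lies in no cell c_u
   is a state and forms a globular cell by itself. *)
Definition cell_end_of (X : mdspace) (D : cellular_decomposition X) (s : bool)
    (x : X) : X :=
  xget x [set a | exists (u v : cd_ord D) (h : is_succ u v),
    globular_cell h x /\ a = cell_end h s].

Definition globular_subdivision (X Y : mdspace) (f : mdhom X Y) :=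
  [/\ cellular X, cellular Y &
    exists g : Y -> X, [/\ continuous g, cancel f g & cancel g f]].

Lemma subdivision_inverse (X Y : mdspace) (f : mdhom X Y) :
  globular_subdivision f ->
  exists g : Y -> X, [/\ continuous g, cancel f g & cancel g f].
Proof. by case. Qed.

(* The connection maps a |-> a^- and a |-> a^+ of the globular subdivision f
   computed with the cellular decomposition D of X. Only their values on the
   states of Y are meaningful. *)
Definition connection_map (X Y : mdspace) (f : mdhom X Y)
    (sf : globular_subdivision f) (D : cellular_decomposition X) (s : bool)
    (a : Y) : X :=
  cell_end_of D s (projT1 (cid (subdivision_inverse sf)) a).

(* The subset of Glob(D^n) that corresponds to f(c) `&` Y^0. *)
Definition cell_states (X Y : mdspace) (f : mdhom X Y)
    (D : cellular_decomposition X) (u v : cd_ord D) (h : is_succ u v) :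
    set (GlobD R dH (cd_dim h)) :=
  globe_interior (n := cd_dim h) `&` [set x | states (f (cd_char h x))].

End Towers.
Arguments cd_leg {R dH X} _ _.
Arguments cd_tower {R dH X} _.
Arguments cell_states {R dH X Y} f {D u v} h _.

(* Main.v *)
(* A relative cell structure on i : A -> X is a well-ordered family of maps
   Glob(D^n) -> X, injective with disjoint images on the open cells, such that X
   has the final topology and its execution paths are generated, under
   reparametrisation and composition, by those of A and by the cell fibres
   t |-> c(z,t) with z interior; the fibres over boundary points come from earlier
   cells. Cellular decompositions, of X or of its stages, give such structures
   (bump functions extended along the tower show that cells embed); conversely such a
   structure makes i a q-cofibration, and X cellular when A is empty. They compose,
   and each cell can be replaced by a relative cell structure of
   Glob(S^(n-1)) -> Glob(D^n)_F. The latter exists for finite F by induction on the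
   dimension and the number of points: a point of F is removed by cutting the ball
   along a slice through it that is a graph over the disk of dimension n-1 (or the
   interval at its time if n = 0).

   The stage Y_u is X_u with f^-1(Y^0) as states and, as execution paths, the paths
   whose image in Y is one. Every cell fibre of Y is a segment of a cell fibre of X,
   so the execution paths of Y_u are generated by segments of cell fibres of X_u
   between states. This gives the pushout squares, the colimits and, by refinement
   of the cells, cellularity of Y_u. *)

Require Import Defs.
From HB Require Import structures.
From mathcomp Require Import all_boot all_order all_algebra.
From mathcomp Require Import all_classical all_reals topology normedtype.
From mathcomp Require Import realfun numfun.
From mathcomp Require Import lra.
Set Implicit Arguments.
Unset Strict Implicit.
Unset Printing Implicit Defensive.
Import Order.TTheory GRing.Theory Num.Theory.
Import numFieldNormedType.Exports.
Local Open Scope classical_set_scope.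
Local Open Scope ring_scope.

(** Pushouts and colimits are given by universal properties only, while the arguments concern
    points, open sets and paths. Two kinds of test objects bridge the gap. Injective maps through
    which all legs factor show that a colimit is generated by its legs. Maps to an object in which
    every continuous path is an execution path are just continuous maps; for the unit interval, the
    Tietze theorem turns the attachment of one cell into a lifting property, which passes to
    transfinite colimits by the argument that also yields q-cofibrations. In the converse direction
    the obstacle is that a stage carries the final topology of its cells and not that of a subspace
    of X, so a cell structure must ask for attaching maps that are continuous in this finer sense.
    Execution paths of Glob(D^n)_F have distinct ends. Cutting a path may therefore leave constant
    pieces, which are absorbed by reparametrisation. Slices have height proportional to the chord of
    the ball: both halves are then balls again, and the rim of the slice is the equator of the
    sphere. *)

Local Notation diskT R n := (@disk R n).
Local Notation sphereT R n := (@sphere R n).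

(** * Paths generated by reparametrisation and composition *)

Section MonotonePaths.
Context {R : realType}.
Local Notation I := (@itv01 R).

Lemma clamp_mono (x y : R) : x <= y -> val (clamp x) <= val (clamp y).
Proof. by move=> xy /=; apply: le_max2 => //; apply: le_min2. Qed.

Lemma i0_le (t : I) : val (@i0 R) <= val t.
Proof. by rewrite val_i0; have /andP[] := val_itv01 t. Qed.

Lemma le_i1 (t : I) : val t <= val (@i1 R).
Proof. by rewrite val_i1; have /andP[] := val_itv01 t. Qed.

Lemma itv01_inj (s t : I) : val s = val t -> s = t.
Proof. exact: val_inj. Qed.

(** The ends are free, so these parametrise segments of a fibre, constant ones included; without
    surjectivity, continuity has to be required. *)
Definition monotone_path (psi : I -> I) := nondecreasing01 psi /\ continuous psi.

Definition affine_path (a b : R) (t : I) : I := clamp (a + b * val t).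

Lemma affine_path_monotone (a b : R) : 0 <= b -> monotone_path (affine_path a b).
Proof.
move=> b0; split=> [s t st|].
  by apply: clamp_mono; rewrite lerD2l; exact: ler_wpM2l.
have cf : continuous (fun x : R => a + b * x).
  by move=> x; apply: cvgD; [exact: cvg_cst|apply: cvgM; [exact: cvg_cst|exact: cvg_id]].
move=> t; apply: (@continuous_comp _ _ _ (fun t : I => a + b * val t) clamp).
  apply: (@continuous_comp _ _ _ (val : I -> R) (fun x => a + b * x)).
    exact: (@continuous_setval R).
  exact: cf.
exact: clamp_continuous.
Qed.

Lemma monotone_path_comp (p q : I -> I) :
  monotone_path p -> monotone_path q -> monotone_path (p \o q).
Proof.
move=> [mp cp] [mq cq]; split=> [s t st|t]; first exact/mp/mq.
by apply: continuous_comp; [exact: cq|exact: cp].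
Qed.

Lemma monotone_path_ivt (psi : I -> I) (y : R) : monotone_path psi ->
  val (psi i0) <= y <= val (psi i1) -> exists t, val (psi t) = y.
Proof.
move=> [mpsi cpsi] y01.
pose f (x : R) : R := val (psi (clamp x)).
have cf : continuous f.
  move=> x; apply: (@continuous_comp _ _ _ (psi \o clamp) (val : I -> R)).
    by apply: continuous_comp; [exact: clamp_continuous|exact: cpsi].
  exact: (@continuous_setval R).
have f0 : f 0 = val (psi i0) by [].
have f1 : f 1 = val (psi i1) by [].
have [||c _ fc] := @IVT R f 0 1 y ler01.
- by apply: continuous_subspaceT => x; exact: cf.
- have le01 : val (psi i0) <= val (psi i1) by apply: mpsi; exact: i0_le.
  by rewrite f0 f1 (min_idPl le01) (max_idPr le01).
by exists (clamp c).
Qed.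

Lemma monotone_path_reparam (psi : I -> I) : monotone_path psi ->
  psi i0 = i0 -> psi i1 = i1 -> reparam psi.
Proof.
move=> hp p0 p1; split=> [|y _]; first exact: hp.1.
have [|t ty] := monotone_path_ivt (y := val y) hp.
  by rewrite p0 p1 i0_le le_i1.
by exists t => //; exact: val_inj.
Qed.

Lemma reparam_monotone (psi : I -> I) : reparam psi -> monotone_path psi.
Proof. by move=> rp; split; [exact: rp.1|exact: reparam_continuous]. Qed.

Lemma reparam_id : reparam (@idfun I).
Proof. by split=> // t _; exists t. Qed.

(** Surjectivity gives a section by choice, in general discontinuous; it serves to undo a
    reparametrisation pointwise. *)
Lemma reparam_section (phi : I -> I) :
  reparam phi -> exists sigma, cancel sigma phi.
Proof.
move=> [_ surj]; have /choice[sigma sK] : forall t, exists s, phi s = t.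
  by move=> t; have [s _ <-] := surj t Logic.I; exists s.
by exists sigma.
Qed.

Lemma concat_comp {T U : Type} (j : T -> U) (g1 g2 : I -> T) :
  concat (j \o g1) (j \o g2) = j \o concat g1 g2.
Proof. by apply/funext => t; rewrite /concat /=; case: ifP. Qed.

Lemma concat_left (T : Type) (g1 g2 : I -> T) (t : I) :
  val t <= 2^-1 -> concat g1 g2 t = g1 (clamp (2 * val t)).
Proof. by rewrite /concat => ->. Qed.

Lemma concat_right (T : Type) (g1 g2 : I -> T) (t : I) : g1 i1 = g2 i0 ->
  2^-1 <= val t -> concat g1 g2 t = g2 (clamp (2 * val t - 1)).
Proof.
move=> e; rewrite /concat; case: (leP (val t)) => // h1 h2.
have -> : val t = 2^-1 by apply/le_anti; rewrite h1.
by rewrite mulfV ?pnatr_eq0 // subrr.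
Qed.

End MonotonePaths.

Section GeneratedPaths.
Context {R : realType}.
Local Notation I := (@itv01 R).

(** Paths in a bare type: generation is combinatorial and can be transported along functions before
    any continuity is known. *)
Inductive gen {T : Type} (P : set (I -> T)) : (I -> T) -> Prop :=
| gen_base g : P g -> gen P g
| gen_reparam g phi : gen P g -> reparam phi -> gen P (g \o phi)
| gen_concat g1 g2 : gen P g1 -> gen P g2 -> g1 i1 = g2 i0 ->
    gen P (concat g1 g2).

Lemma gen_comp {T U : Type} (j : T -> U) (P : set (I -> T)) (Q : set (I -> U)) g :
  (forall p, P p -> gen Q (j \o p)) -> gen P g -> gen Q (j \o g).
Proof.
move=> PQ; elim=> [p /PQ//|p phi _ IH rphi|p q _ IHp _ IHq e].
  exact: (gen_reparam IH rphi).
by rewrite -concat_comp; apply: gen_concat => //=; rewrite e.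
Qed.

Lemma gen_trans {T : Type} (P Q : set (I -> T)) g :
  (forall p, P p -> gen Q p) -> gen P g -> gen Q g.
Proof. by move=> PQ /(@gen_comp _ _ id _ Q); apply. Qed.

Lemma gen_sub {T : Type} (P Q : set (I -> T)) g : P `<=` Q -> gen P g -> gen Q g.
Proof. by move=> PQ; apply: gen_trans => p /PQ; exact: gen_base. Qed.

Lemma gen_point {T : Type} (P : set (I -> T)) g t :
  gen P g -> exists p s, P p /\ g t = p s.
Proof.
move=> G; elim: G t => [p Pp|p phi _ IH _|p q _ IHp _ IHq _] t.
- by exists p, t.
- exact: IH.
by rewrite /concat; case: ifP => _; [exact: IHp|exact: IHq].
Qed.

Lemma gen_start {T : Type} (P : set (I -> T)) g :
  gen P g -> exists2 p, P p & g i0 = p i0.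
Proof.
elim=> [p Pp|p phi _ [q Pq e] rphi|p q _ [r Pr e] _ _ _]; first by exists p.
  by exists q => //=; rewrite (reparam01 rphi).1.
by exists r => //; rewrite concat_i0.
Qed.

Lemma gen_end {T : Type} (P : set (I -> T)) g :
  gen P g -> exists2 p, P p & g i1 = p i1.
Proof.
elim=> [p Pp|p phi _ [q Pq e] rphi|p q _ _ _ [r Pr e] _]; first by exists p.
  by exists q => //=; rewrite (reparam01 rphi).2.
by exists r => //; rewrite concat_i1.
Qed.

(** Each piece of [j \o g] is a piece of [g] read through [j]: the halves of a concatenation are
    restrictions of [g], and a reparametrisation is undone by a section. Injectivity of [j]
    transfers the resulting identities to [g]. *)
Lemma gen_lift {T U : Type} (j : T -> U) (P : set (I -> U)) g :
  injective j -> gen P (j \o g) -> gen [set p | P (j \o p)] g.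
Proof.
move=> ij G; have [h e] : {h | j \o g = h} by exists (j \o g).
rewrite e in G; elim: G g e => [p Pp|p phi _ IH rphi|p q _ IHp _ IHq pq] g e.
- by apply: gen_base; rewrite /= e.
- have [sg sK] := reparam_section rphi.
  have e' : j \o (g \o sg) = p.
    by apply/funext => t /=; rewrite -[j _]/((j \o g) _) e /= sK.
  suff -> : g = (g \o sg) \o phi by apply: gen_reparam => //; exact: IH.
  apply/funext => t; apply: ij; rewrite -[RHS]/((j \o (g \o sg)) (phi t)) e'.
  by rewrite -[LHS]/((j \o g) t) e.
pose g1 t := g (affine_path 0 2^-1 t); pose g2 t := g (affine_path 2^-1 2^-1 t).
have jg t : j (g t) = concat p q t by rewrite -e.
have e1 : j \o g1 = p.
  apply/funext => t /=; have /andP[t0 t1] := val_itv01 t.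
  have v : val (affine_path 0 2^-1 t) = 2^-1 * val t by rewrite clampK ?add0r //; lra.
  rewrite /g1 jg concat_left v; last lra.
  by rewrite mulVKf ?pnatr_eq0 // valcK.
have e2 : j \o g2 = q.
  apply/funext => t /=; have /andP[t0 t1] := val_itv01 t.
  have v : val (affine_path 2^-1 2^-1 t) = 2^-1 + 2^-1 * val t by rewrite clampK //; lra.
  rewrite /g2 jg concat_right // v; last lra.
  by rewrite (_ : _ - 1 = val t) ?valcK //; lra.
have -> : g = concat g1 g2.
  apply/funext => t; apply: ij; rewrite jg -[RHS]/((j \o _) t) -concat_comp.
  by rewrite e1 e2.
apply: gen_concat; [exact: IHp|exact: IHq|].
by apply: ij; rewrite -[LHS]/((j \o g1) i1) -[RHS]/((j \o g2) i0) e1 e2.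
Qed.

(** Induction on the generation: an interval containing the time is pulled back along a
    reparametrisation and halved by a concatenation. This allows a path to be compared, around one
    time, with a single generator. *)
Lemma gen_local {T : Type} (P : set (I -> T)) g (t : I) : gen P g ->
  exists a b p phi, [/\ 0 <= a /\ b <= 1, a < b, a <= val t <= b,
    P p /\ reparam phi & forall s, g (affine_path a (b - a) s) = p (phi s)].
Proof.
move=> G; elim: G t => [p Pp|p phi _ IH rphi|p q _ IHp _ IHq pq] t.
- exists 0, 1, p, idfun; split; [by []|exact: ltr01|exact: val_itv01| |].
    by split=> //; exact: reparam_id.
  by move=> s; rewrite /affine_path subr0 add0r mul1r valcK.
- have [a [b [r [psi [[a0 b1] ab /andP[at_ tb] [Pr rpsi] E]]]]] := IH (phi t).
  have mphi := reparam_monotone rphi.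
  have /(monotone_path_ivt mphi)[s1 s1a] : val (phi i0) <= a <= val (phi i1).
    by rewrite (reparam01 rphi).1 (reparam01 rphi).2 val_i0 val_i1 a0 (le_trans (ltW ab)).
  have /(monotone_path_ivt mphi)[s2 s2b] : val (phi i0) <= b <= val (phi i1).
    by rewrite (reparam01 rphi).1 (reparam01 rphi).2 val_i0 val_i1 b1 (le_trans a0 (ltW ab)).
  (* A preimage of [a] that is not after [t]: if the one found is later, monotonicity forces [phi t]
     to have value [a], and [t] itself serves. Likewise for [b']. *)
  have [a' [pa' a't]] : exists a', val (phi a') = a /\ val a' <= val t.
    have [h|/ltW h] := leP (val s1) (val t); first by exists s1.
    exists t; split=> //; apply/le_anti; rewrite at_ andbT -s1a.
    exact: mphi.1.
  have [b' [pb' tb']] : exists b', val (phi b') = b /\ val t <= val b'.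
    have [h|/ltW h] := leP (val t) (val s2); first by exists s2.
    exists t; split=> //; apply/le_anti; rewrite tb /= -s2b.
    exact: mphi.1.
  have a'b' : val a' < val b'.
    by rewrite ltNge; apply/negP => /mphi.1; rewrite pa' pb' leNgt ab.
  have /andP[a'0 _] := val_itv01 a'; have /andP[_ b'1] := val_itv01 b'.
  pose h : I -> I := affine_path (val a') (val b' - val a').
  (* [phi] on the interval from [a'] to [b'], with source and target both rescaled to the unit
     interval. *)
  pose chi : I -> I := affine_path (- (a / (b - a))) (b - a)^-1 \o phi \o h.
  have ba0 : b - a > 0 by rewrite subr_gt0.
  have ba : b - a != 0 by rewrite gt_eqF.
  have mh : monotone_path h by apply: affine_path_monotone; rewrite subr_ge0 ltW.
  have hi0 : h i0 = a' by rewrite /h /affine_path val_i0 mulr0 addr0 valcK.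
  have hi1 : h i1 = b' by rewrite /h /affine_path val_i1 mulr1 addrC subrK valcK.
  have achi s : affine_path a (b - a) (chi s) = phi (h s).
    have l1 : a <= val (phi (h s)) by rewrite -pa' -hi0; apply/mphi.1/mh.1/i0_le.
    have l2 : val (phi (h s)) <= b by rewrite -pb' -hi1; apply/mphi.1/mh.1/le_i1.
    rewrite -[RHS]valcK; congr clamp.
    have E1 : - (a / (b - a)) + (b - a)^-1 * val (phi (h s)) =
       (val (phi (h s)) - a) / (b - a) by rewrite mulrBl addrC mulrC.
    rewrite /chi /comp {1}/affine_path E1 clampK; last first.
      rewrite divr_ge0 ?subr_ge0 ?(ltW ab) //= ler_pdivrMr // mul1r.
      by rewrite lerD2r.
    by rewrite mulrCA mulfV // mulr1 addrC subrK.
  have rchi : reparam chi.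
    apply: monotone_path_reparam.
    - apply: monotone_path_comp => //; apply: monotone_path_comp => //.
      by apply: affine_path_monotone; rewrite invr_ge0 ltW.
    - apply: itv01_inj; rewrite /chi /= hi0 /affine_path pa' mulrC addrC subrr.
      exact: erefl.
    - rewrite /chi /= hi1 /affine_path pb' (_ : _ + _ = 1) //.
      by rewrite addrC mulrC -mulrBl mulfV.
  exists (val a'), (val b'), r, (psi \o chi); split=> //.
  - by rewrite a't tb'.
  - by split=> //; exact: reparam_comp.
  - by move=> s /=; rewrite -E achi.
have [t2|t2] := leP (val t) 2^-1.
  have [a [b [r [psi [[a0 b1] ab /andP[at_ tb] [Pr rpsi] E]]]]] :=
    IHp (clamp (2 * val t)).
  have /andP[t0 t1] := val_itv01 t.
  rewrite clampK in at_ tb; last lra.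
  exists (2^-1 * a), (2^-1 * b), r, psi; split=> //; [lra|lra|lra|].
  move=> s; rewrite -E; have /andP[s0 s1] := val_itv01 s.
  have c0 : 0 <= (b - a) * val s by apply: mulr_ge0 => //; lra.
  have c1 : (b - a) * val s <= b - a by apply: ler_piMr => //; lra.
  rewrite /affine_path -mulrBr -mulrA -mulrDr concat_left clampK; [|lra|lra|lra].
  by congr (p (clamp _)); lra.
have [a [b [r [psi [[a0 b1] ab /andP[at_ tb] [Pr rpsi] E]]]]] :=
  IHq (clamp (2 * val t - 1)).
have /andP[t0 t1] := val_itv01 t.
rewrite clampK in at_ tb; last lra.
exists (2^-1 * (a + 1)), (2^-1 * (b + 1)), r, psi; split=> //; [lra|lra|lra|].
move=> s; rewrite -E; have /andP[s0 s1] := val_itv01 s.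
have c0 : 0 <= (b - a) * val s by apply: mulr_ge0 => //; lra.
have c1 : (b - a) * val s <= b - a by apply: ler_piMr => //; lra.
have -> : 2^-1 * (b + 1) - 2^-1 * (a + 1) = 2^-1 * (b - a) by lra.
rewrite /affine_path -mulrA -mulrDr concat_right // clampK; [|lra|lra|lra].
by congr (q (clamp _)); lra.
Qed.

(** [concat] always breaks at 1/2; the piecewise affine [th] moves the break [m] there, and [g] is
    the concatenation of its two restrictions composed with [th]. *)
Lemma gen_glue {T : Type} (P : set (I -> T)) (g : I -> T) (m : I) : 0 < val m < 1 ->
  gen P (g \o affine_path 0 (val m)) -> gen P (g \o affine_path (val m) (1 - val m)) ->
  gen P g.
Proof.
move=> /andP[m0 m1] G1 G2; have m0' : val m != 0 by rewrite gt_eqF.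
have m1' : 0 < 1 - val m by lra.
pose l (t : I) : I := clamp (val t / val m).
pose r (t : I) : I := clamp ((val t - val m) / (1 - val m)).
have ll t : val t <= val m -> val (l t) = val t / val m.
  move=> tm; have /andP[t0 t1] := val_itv01 t.
  by rewrite clampK // divr_ge0 ?(ltW m0) //= ler_pdivrMr // mul1r.
have rr t : val m <= val t -> val (r t) = (val t - val m) / (1 - val m).
  move=> tm; have /andP[t0 t1] := val_itv01 t.
  by rewrite clampK // divr_ge0 ?subr_ge0 ?(ltW m1) //= ler_pdivrMr // mul1r lerD2r.
have lK t : val t <= val m -> affine_path 0 (val m) (l t) = t.
  move=> tm; rewrite -[RHS]valcK; congr clamp.
  by rewrite add0r ll // mulrC divfK.
have rK t : val m <= val t -> affine_path (val m) (1 - val m) (r t) = t.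
  move=> tm; rewrite -[RHS]valcK; congr clamp.
  by rewrite rr // mulrC divfK ?gt_eqF // addrC subrK.
have mr : monotone_path r.
  have -> : r = affine_path (- (val m / (1 - val m))) (1 - val m)^-1.
    apply/funext => t; rewrite /r /affine_path mulrBl addrC; congr (clamp (_ + _)).
    exact: mulrC.
  by apply: affine_path_monotone; rewrite invr_ge0 ltW.
have ml : monotone_path l.
  have -> : l = affine_path 0 (val m)^-1.
    by apply/funext => t; rewrite /l /affine_path add0r mulrC.
  by apply: affine_path_monotone; rewrite invr_ge0 ltW.
pose th (t : I) : I := if val t <= val m then clamp (2^-1 * val (l t))
   else clamp (2^-1 + 2^-1 * val (r t)).
have lv t : 0 <= val (l t) <= 1 := val_itv01 (l t).
have rv t : 0 <= val (r t) <= 1 := val_itv01 (r t).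
have thl t : val t <= val m -> val (th t) = 2^-1 * val (l t).
  by move=> tm; rewrite /th tm clampK //; have := lv t; lra.
have thr t : val m < val t -> val (th t) = 2^-1 + 2^-1 * val (r t).
  by move=> tm; rewrite /th leNgt tm clampK //; have := rv t; lra.
have e12 : (g \o affine_path 0 (val m)) i1 = (g \o affine_path (val m) (1 - val m)) i0.
  by rewrite /= /affine_path val_i0 val_i1 mulr1 mulr0 add0r addr0.
have -> : g = concat (g \o affine_path 0 (val m)) (g \o affine_path (val m) (1 - val m)) \o th.
  apply/funext => t; rewrite [RHS]/comp; have [tm|tm] := leP (val t) (val m).
    rewrite concat_left thl //; last by have := lv t; lra.
    by rewrite mulrA mulfV ?pnatr_eq0 // mul1r valcK /= lK.
  rewrite concat_right // thr //; last by have := rv t; lra.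
  rewrite [_ - 1](_ : _ = val (r t)); last lra.
  by rewrite valcK /= rK // ltW.
apply: gen_reparam; first exact: gen_concat.
split=> [s t st|y _].
  have [tm|tm] := leP (val t) (val m).
    have sm := le_trans st tm.
    by rewrite !thl // ler_pM2l ?invr_gt0 ?ltr0n //; apply: ml.1.
  have [sm|sm] := leP (val s) (val m).
    by rewrite thl // thr //; have := lv s; have := rv t; lra.
  by rewrite !thr // lerD2l ler_pM2l ?invr_gt0 ?ltr0n //; apply: mr.1.
have /andP[y0 y1] := val_itv01 y.
have [y2|y2] := leP (val y) 2^-1.
  have y2' : 2 * val y <= 1 by lra.
  have y0' : 0 <= 2 * val y by lra.
  have B := mulr_ge0 (ltW m0) y0'; have B' := ler_piMr (ltW m0) y2'.
  have v : val (clamp (val m * (2 * val y))) = val m * (2 * val y) by rewrite clampK //; lra.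
  exists (clamp (val m * (2 * val y))) => //; apply: itv01_inj.
  rewrite thl; last by rewrite v.
  by rewrite ll v // [_ * _ / _]mulrC mulKf //; lra.
have y2' : 2 * val y - 1 <= 1 by lra.
have y0' : 0 < 2 * val y - 1 by lra.
have B := mulr_gt0 m1' y0'; have B' := ler_piMr (ltW m1') y2'.
have v : val (clamp (val m + (1 - val m) * (2 * val y - 1))) =
    val m + (1 - val m) * (2 * val y - 1) by rewrite clampK //; lra.
exists (clamp (val m + (1 - val m) * (2 * val y - 1))) => //; apply: itv01_inj.
rewrite thr; last by rewrite v; lra.
rewrite rr v; last lra.
by rewrite [val m + _ - _]addrC addKr [_ * _ / _]mulrC mulKf ?gt_eqF //; lra.
Qed.

(** A segment that crosses the break of a concatenation is cut there, which is possible because the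
    break is an end of a generator and so lies in [S]. The constant alternative is kept because [Q]
    may contain no constant path. *)
Lemma gen_cut {T : Type} (S : set T) (P Q : set (I -> T)) :
  (forall p, P p -> S (p i0) /\ S (p i1)) ->
  (forall p psi, P p -> monotone_path psi -> S (p (psi i0)) -> S (p (psi i1)) ->
     gen Q (p \o psi) \/ forall t, p (psi t) = p (psi i0)) ->
  forall g psi, gen P g -> monotone_path psi -> S (g (psi i0)) -> S (g (psi i1)) ->
    gen Q (g \o psi) \/ forall t, g (psi t) = g (psi i0).
Proof.
move=> PS cut g psi G; elim: G psi => [p Pp|p phi _ IH rphi|g1 g2 G1 IH1 G2 IH2 g12] psi mpsi S0 S1.
- exact: cut.
- by apply: (IH (phi \o psi)) => //; apply: monotone_path_comp => //; exact: reparam_monotone.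
have Sm : S (g1 i1) by have [p /PS[_ +] ->] := gen_end G1.
have v0 := val_itv01 (psi i0); have v1 := val_itv01 (psi i1).
have vle : val (psi i0) <= val (psi i1) by apply: mpsi.1; exact: i0_le.
have [h1|h1] := leP (val (psi i1)) 2^-1.
  have E t : concat g1 g2 (psi t) = g1 (affine_path 0 2 (psi t)).
    rewrite concat_left ?/affine_path ?add0r //; apply: le_trans h1.
    by apply: mpsi.1; exact: le_i1.
  have -> : concat g1 g2 \o psi = g1 \o (affine_path 0 2 \o psi) by apply/funext.
  have [|||H|H] := IH1 (affine_path 0 2 \o psi).
  - by apply: monotone_path_comp => //; apply: affine_path_monotone; lra.
  - by rewrite /= -E.
  - by rewrite /= -E.
  - by left.
  - by right=> t; rewrite !E; exact: H.
have aE x : affine_path (-1) 2 x = clamp (2 * val x - 1) by rewrite /affine_path addrC.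
have [h0|h0] := leP 2^-1 (val (psi i0)).
  have E t : concat g1 g2 (psi t) = g2 (affine_path (-1) 2 (psi t)).
    rewrite concat_right ?aE //; apply: (le_trans h0).
    by apply: mpsi.1; exact: i0_le.
  have -> : concat g1 g2 \o psi = g2 \o (affine_path (-1) 2 \o psi) by apply/funext.
  have [|||H|H] := IH2 (affine_path (-1) 2 \o psi).
  - by apply: monotone_path_comp => //; apply: affine_path_monotone; lra.
  - by rewrite /= -E.
  - by rewrite /= -E.
  - by left.
  - by right=> t; rewrite !E; exact: H.
(* The time at which the segment crosses the break; [h0] and [h1] place it strictly between 0 and
   1. *)
have /(monotone_path_ivt mpsi)[m mE] : val (psi i0) <= 2^-1 <= val (psi i1).
  by rewrite (ltW h0) (ltW h1).
have m0 : 0 < val m.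
  rewrite lt_neqAle eq_sym -{2}val_i0 i0_le andbT; apply/eqP => m0.
  by move: h0; rewrite -mE (_ : m = i0) ?ltxx //; apply: itv01_inj; rewrite m0 val_i0.
have m1 : val m < 1.
  rewrite lt_neqAle -{2}val_i1 le_i1 andbT; apply/eqP => m0'.
  by move: h1; rewrite -mE (_ : m = i1) ?ltxx //; apply: itv01_inj; rewrite m0' val_i1.
pose psi1 := affine_path 0 2 \o psi \o affine_path 0 (val m).
pose psi2 := affine_path (-1) 2 \o psi \o affine_path (val m) (1 - val m).
have mpsi1 : monotone_path psi1.
  do 2?apply: monotone_path_comp => //; apply: affine_path_monotone; lra.
have mpsi2 : monotone_path psi2.
  do 2?apply: monotone_path_comp => //; apply: affine_path_monotone; lra.
have a1 t : val (affine_path 0 (val m) t) <= val m.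
  have /andP[t0 t1] := val_itv01 t; have B := mulr_ge0 (ltW m0) t0.
  by have B' := ler_piMr (ltW m0) t1; rewrite clampK add0r; lra.
have a2 t : val m <= val (affine_path (val m) (1 - val m) t).
  have /andP[t0 t1] := val_itv01 t; have m1' : 0 <= 1 - val m by lra.
  have B := mulr_ge0 m1' t0; have B' := ler_piMr m1' t1; rewrite clampK; lra.
have E1 t : concat g1 g2 (psi (affine_path 0 (val m) t)) = g1 (psi1 t).
  rewrite concat_left -?mE; last exact/mpsi.1/a1.
  by rewrite /psi1 /= [in RHS]/affine_path add0r.
have E2 t : concat g1 g2 (psi (affine_path (val m) (1 - val m) t)) = g2 (psi2 t).
  rewrite concat_right // -?mE; last exact/mpsi.1/a2.
  by rewrite /psi2 /= aE.
have l0 : affine_path 0 (val m) i0 = i0.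
  by rewrite /affine_path val_i0 mulr0 addr0.
have l1 : affine_path 0 (val m) i1 = m by rewrite /affine_path val_i1 mulr1 add0r valcK.
have r0 : affine_path (val m) (1 - val m) i0 = m.
  by rewrite /affine_path val_i0 mulr0 addr0 valcK.
have r1 : affine_path (val m) (1 - val m) i1 = i1.
  by rewrite /affine_path val_i1 mulr1 addrC subrK.
have em : concat g1 g2 (psi m) = g1 i1.
  rewrite concat_left mE //; congr (g1 (clamp _)).
  by rewrite mulfV ?pnatr_eq0.
have e1 : g1 (psi1 i1) = g1 i1 by rewrite -E1 l1.
have e2 : g2 (psi2 i0) = g1 i1 by rewrite -E2 r0.
(* If one half is constant, the path is the other half with a pause: [al] covers the unit interval
   on [0, m] and then rests at 1, [ar] rests at 0 until [m]. Both are reparametrisations. *)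
pose al (t : I) := affine_path 0 (val m)^-1 t.
pose ar (t : I) := affine_path (- (val m / (1 - val m))) (1 - val m)^-1 t.
have m1' : 0 < 1 - val m by lra.
have mal : monotone_path al by apply: affine_path_monotone; rewrite invr_ge0 ltW.
have mar : monotone_path ar by apply: affine_path_monotone; rewrite invr_ge0 ltW.
have alK t : val t <= val m -> affine_path 0 (val m) (al t) = t.
  move=> tm; rewrite -[RHS]valcK; congr clamp; have /andP[t0 t1] := val_itv01 t.
  rewrite add0r /al /affine_path add0r mulrC clampK; last first.
    by rewrite mulrC divr_ge0 ?(ltW m0) //= ler_pdivrMr // mul1r.
  by rewrite mulrC mulVKf ?gt_eqF.
have arK t : val m <= val t -> affine_path (val m) (1 - val m) (ar t) = t.
  move=> tm; rewrite -[RHS]valcK; congr clamp; have /andP[t0 t1] := val_itv01 t.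
  rewrite /ar /affine_path [_ + _ * val t](_ : _ = (val t - val m) / (1 - val m)); last first.
    by rewrite mulrBl addrC mulrC.
  rewrite clampK; last by rewrite divr_ge0 ?subr_ge0 ?(ltW m1) //= ler_pdivrMr // mul1r lerD2r.
  by rewrite mulrC divfK ?gt_eqF // addrC subrK.
have [||H1|H1] := IH1 psi1 mpsi1.
- by rewrite -E1 l0.
- by rewrite e1.
- left; have [||H2|H2] := IH2 psi2 mpsi2.
  + by rewrite e2.
  + by rewrite -E2 r1.
  + apply: (@gen_glue _ _ _ m); first by rewrite m0.
      by rewrite (_ : _ \o _ = g1 \o psi1) //; apply/funext => t; exact: E1.
    by rewrite (_ : _ \o _ = g2 \o psi2) //; apply/funext => t; exact: E2.
  + have -> : concat g1 g2 \o psi = (g1 \o psi1) \o al.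
      apply/funext => t /=; have [tm|/ltW tm] := leP (val t) (val m).
        by rewrite -E1 alK.
      have -> : al t = i1.
        apply: itv01_inj; apply/le_anti/andP; split; first exact: le_i1.
        have -> : i1 = al m by rewrite /al /affine_path add0r mulVf ?gt_eqF.
        exact: mal.1.
      by rewrite -(arK t tm) E2 H2 e2 e1.
    apply: gen_reparam => //; apply: monotone_path_reparam => //.
      by rewrite /al /affine_path val_i0 mulr0 addr0.
    apply: itv01_inj; apply/le_anti/andP; split; first exact: le_i1.
    have {1}-> : i1 = al m by rewrite /al /affine_path add0r mulVf ?gt_eqF.
    by apply: mal.1; exact: le_i1.
- have H1' t : g1 (psi1 t) = g1 i1 by rewrite -e1 (H1 t) (H1 i1).
  have [||H2|H2] := IH2 psi2 mpsi2.
  + by rewrite e2.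
  + by rewrite -E2 r1.
  + left; have -> : concat g1 g2 \o psi = (g2 \o psi2) \o ar.
      apply/funext => t /=; have [tm|/ltW tm] := leP (val t) (val m); last by rewrite -E2 arK.
      have -> : ar t = i0.
        apply: itv01_inj; apply/le_anti/andP; split; last exact: i0_le.
        have -> : i0 = ar m by rewrite /ar /affine_path addrC mulrC addrN.
        exact: mar.1.
      by rewrite -(alK t tm) E1 H1' e2.
    apply: gen_reparam => //; apply: monotone_path_reparam => //.
      apply: itv01_inj; apply/le_anti/andP; split; last exact: i0_le.
      have {2}-> : i0 = ar m by rewrite /ar /affine_path addrC mulrC addrN.
      by apply: mar.1; exact: i0_le.
    by rewrite /ar /affine_path val_i1 mulr1 -[X in _ + X]mul1r addrC -mulrBl mulfV ?gt_eqF.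
  + right=> t; have e t' : concat g1 g2 (psi t') = g1 i1.
      have [tm|/ltW tm] := leP (val t') (val m); first by rewrite -(alK t' tm) E1 H1'.
      by rewrite -(arK t' tm) E2 H2 e2.
    by rewrite !e.
Qed.

End GeneratedPaths.

(** * Structures generated by a family of maps *)

Section Image.
Context {R : realType} {dH : bool}.
Local Notation I := (@itv01 R).
Local Notation mdspace := (mdspace R dH).
Context {P : mdspace} {J : Type} {A : J -> mdspace} (k : forall j, mdhom (A j) P).

(** As a set, the union of the images of the legs; below it receives the final topology for the
    legs, in general finer than the subspace topology. *)
Definition image_car : Type := {x : P | `[< exists j a, k j a = x >]}.
HB.instance Definition _ := Choice.on image_car.

Lemma image_in_subproof j (a : A j) : `[< exists j' a', k j' a' = k j a >].
Proof. by apply/asboolP; exists j, a. Qed.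

Definition image_in j (a : A j) : image_car := exist _ (k j a) (image_in_subproof a).

Lemma image_inP (x : image_car) : exists j a, x = image_in (j := j) a.
Proof.
by case: x => x /[dup] /asboolP[j [a e]] h; exists j, a; apply/val_inj; rewrite /= e.
Qed.

Definition image_open (U : set image_car) := forall j, open (@image_in j @^-1` U).

Lemma image_openT : image_open setT.
Proof. by move=> j; exact: openT. Qed.

Lemma image_openI : setI_closed image_open.
Proof. by move=> U V oU oV j; exact: openI (oU j) (oV j). Qed.

Lemma image_open_bigU (K : Type) (f : K -> set image_car) :
  (forall i, image_open (f i)) -> image_open (\bigcup_i f i).
Proof. by move=> of_ j; rewrite preimage_bigcup; apply: bigcup_open => i _; exact: of_. Qed.

HB.instance Definition _ :=
  isOpenTopological.Build image_car image_openT image_openI image_open_bigU.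

Lemma image_openE (U : set image_car) : open U = image_open U.
Proof. by []. Qed.

Lemma image_in_continuous j : continuous (@image_in j).
Proof. by apply/continuousP => U; rewrite image_openE; exact. Qed.

Lemma image_val_continuous : continuous (val : image_car -> P).
Proof.
apply/continuousP => U oU; rewrite image_openE => j.
exact: (proj1 (continuousP _) (@mdhom_continuous _ _ _ _ (k j)) U oU).
Qed.

(** Final topologies for maps from Delta-generated spaces are Delta-generated. The range of a path
    is the preimage of its range in [P] under a continuous injection, hence closed when [P] is
    Delta-Hausdorff. *)
Lemma image_in_Top : in_Top (R := R) dH image_car.
Proof.
split=> [U dU|dHT g cg].
  rewrite image_openE => j.
  apply: (mdcar_in_Top (A j)).1; apply: delta_open_preimage dU.
  exact: image_in_continuous.
have -> : range g = val @^-1` range (val \o g).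
  by apply/seteqP; split=> [_ [t _ <-]|x [t _ /val_inj <-]]; exists t.
apply: preimage_closed; first by move=> ? _; exact: image_val_continuous.
apply: (mdcar_in_Top P).2 => // t.
by apply: continuous_comp; [exact: cg|exact: image_val_continuous].
Qed.

Definition image_state : set image_car :=
  [set x | exists j a, states a /\ x = image_in (j := j) a].

Definition image_leg_path : set (I -> image_car) :=
  [set p | exists j q, expath q /\ p = @image_in j \o q].

Definition image_expath : set (I -> image_car) := gen image_leg_path.

Lemma image_expath_continuous g : image_expath g -> continuous g.
Proof.
elim=> [_ [j [q [eq ->]]]|p phi _ cp rphi|p q _ cp _ cq e] t.
- by apply: continuous_comp; [exact: expath_continuous eq _|exact: image_in_continuous].
- by apply: continuous_comp; [exact: reparam_continuous|exact: cp].
- exact: concat_continuous.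
Qed.

Lemma image_expath_states g : image_expath g -> image_state (g i0) /\ image_state (g i1).
Proof.
move=> G; split.
  have [_ [j [q [eq ->]]] ->] := gen_start G.
  by exists j, (q i0); split=> //; exact: (expath_states eq).1.
have [_ [j [q [eq ->]]] ->] := gen_end G.
by exists j, (q i1); split=> //; exact: (expath_states eq).2.
Qed.

Definition md_image : mdspace :=
  @MDSpace R dH image_car image_state image_expath image_in_Top
    image_expath_continuous image_expath_states
    (fun g phi G => gen_reparam G) (fun g1 g2 G1 => gen_concat G1).

Definition image_leg j : mdhom (A j) md_image.
Proof.
apply: (@MDHom R dH (A j) md_image (@image_in j)) => [|a sa|g eg].
- exact: image_in_continuous.
- by exists j, a.
- by apply: gen_base; exists j, g.
Defined.

Definition image_incl : mdhom md_image P.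
Proof.
apply: (@MDHom R dH md_image P (val : image_car -> P)) => [|x [j [a [sa ->]]]|g G].
- exact: image_val_continuous.
- exact: (mdhom_states (k j) sa).
- elim: G => [_ [j [q [eq ->]]]|p phi _ cp rphi|p q _ cp _ cq e].
  + exact: (mdhom_expath (k j) eq).
  + exact: (expath_reparam cp rphi).
  + by rewrite -concat_comp; apply: expath_concat => //=; rewrite e.
Defined.

Lemma image_incl_inj : injective image_incl.
Proof. exact: val_inj. Qed.

Lemma image_incl_leg j : image_incl \oM image_leg j = k j.
Proof. by apply: mdhom_ext. Qed.

Section Descent.
Context {W : mdspace} (w : image_car -> W).
Hypothesis hw : forall j, exists h : mdhom (A j) W, forall a, w (image_in a) = h a.

(** Topology, states and paths are all generated by the legs, so a function is a map as soon as its
    composites with the legs are. *)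
Definition image_desc : mdhom md_image W.
Proof.
apply: (@MDHom R dH md_image W w) => [|_ [j [a [sa ->]]]|g G].
- apply/continuousP => U oU; rewrite image_openE => j; have [h hE] := hw j.
  have -> : image_in (j := j) @^-1` (w @^-1` U) = h @^-1` U.
    by apply/seteqP; split=> a /=; rewrite hE.
  exact: (proj1 (continuousP _) (@mdhom_continuous _ _ _ _ h) U oU).
- by have [h ->] := hw j; exact: (mdhom_states h sa).
- elim: G => [_ [j [q [eq ->]]]|p phi _ cp rphi|p q _ cp _ cq e].
  + have [h hE] := hw j.
    have -> : w \o (image_in (j := j) \o q) = h \o q by apply/funext => t /=; rewrite hE.
    exact: (mdhom_expath h eq).
  + exact: (expath_reparam cp rphi).
  + by rewrite -concat_comp; apply: expath_concat => //=; rewrite e.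
Defined.

End Descent.

Definition leg_path : set (I -> P) := [set p | exists j q, expath q /\ p = k j \o q].

Record generated_by : Prop := GeneratedBy {
  generated_point : forall x, exists j a, x = k j a;
  generated_open : forall U, (forall j, open (k j @^-1` U)) -> open U;
  generated_state : forall x, states x -> exists j a, states a /\ x = k j a;
  generated_expath : forall g, expath g -> gen leg_path g }.

(** The hypothesis is what a universal property yields: a subobject through which all legs factor is
    everything. Applied to [image_incl], it makes [P] its own image, whose structure is generated by
    construction. *)
Lemma generatedP :
  (forall (W : mdspace) (i : mdhom W P) (k' : forall j, mdhom (A j) W),
     injective i -> (forall j, i \oM k' j = k j) ->
     exists s : mdhom P W, i \oM s = mdid P) -> generated_by.
Proof.
move=> /(_ _ _ _ image_incl_inj image_incl_leg)[s si].
have sK x : val (s x) = x by rewrite -[RHS]/(mdid P x) -si.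
split.
- by move=> x; have [j [a e]] := image_inP (s x); exists j, a; rewrite -[LHS]sK e.
- move=> U oU.
  have -> : U = s @^-1` (val @^-1` U) by apply/seteqP; split=> x /=; rewrite sK.
  by apply: (proj1 (continuousP _) (@mdhom_continuous _ _ _ _ s)); rewrite image_openE => j; exact: oU.
- by move=> x /(mdhom_states s)[j [a [sa e]]]; exists j, a; split=> //; rewrite -[LHS]sK e.
- move=> g /(mdhom_expath s) G.
  have -> : g = val \o (s \o g) by apply/funext => t; rewrite /= sK.
  apply: gen_comp G => _ [j [q [eq ->]]].
  by apply: gen_base; exists j, q.
Qed.

End Image.

Section Indiscrete.
Context {R : realType} {dH : bool}.

(** The right adjoint of the underlying space functor: maps into it are exactly the continuous maps,
    so that a universal property among multipointed d-spaces produces continuous functions. *)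
Definition all_paths_mdspace (T : topologicalType) (hT : in_Top (R := R) dH T) :
  mdspace R dH.
Proof.
apply: (@MDSpace R dH T setT [set g | continuous g] hT) => // [g phi cg rphi t|].
  by apply: continuous_comp; [exact: reparam_continuous|exact: cg].
by move=> g1 g2; exact: concat_continuous.
Defined.

Definition all_paths_hom (X : mdspace R dH) (T : topologicalType)
  (hT : in_Top (R := R) dH T) (f : X -> T) (cf : continuous f) :
  mdhom X (all_paths_mdspace hT).
Proof.
apply: (@MDHom R dH X (all_paths_mdspace hT) f cf) => // g eg t.
by apply: continuous_comp; [exact: expath_continuous eg _|exact: cf].
Defined.

End Indiscrete.

Section PushoutGenerated.
Context {R : realType} {dH : bool}.
Local Notation mdspace := (mdspace R dH).
Context {A B C P : mdspace} {f : mdhom A B} {g : mdhom A C} {h : mdhom B P} {k : mdhom C P}.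

Definition cospan_leg (b : bool) : mdhom (if b then B else C) P :=
  match b with true => h | false => k end.

(** The factored legs still agree on [A] because [i] is injective; the induced map is a section of
    [i] by uniqueness. *)
Lemma pushout_generated : is_pushout f g h k -> generated_by cospan_leg.
Proof.
move=> [e univ]; apply: generatedP => W i k' ii ik.
have ih : i \oM k' true = h := ik true.
have ik' : i \oM k' false = k := ik false.
have [|s [[sh sk] _]] := univ W (k' true) (k' false).
  apply: mdhom_ext => a; apply: ii.
  rewrite -[LHS]/((i \oM k' true) (f a)) -[RHS]/((i \oM k' false) (g a)) ih ik'.
  by rewrite -[LHS]/((h \oM f) a) e.
exists s; have [w [_ u]] := univ P h k e.
rewrite -(u (i \oM s)); last first.
  split; apply: mdhom_ext => a.
    by rewrite -[LHS]/(i ((s \oM h) a)) sh -[LHS]/((i \oM k' true) a) ih.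
  by rewrite -[LHS]/(i ((s \oM k) a)) sk -[LHS]/((i \oM k' false) a) ik'.
by apply: u; split; apply: mdhom_ext.
Qed.

Lemma pushout_jointly_epi (W : mdspace) (u v : mdhom P W) : is_pushout f g h k ->
  u \oM h = v \oM h -> u \oM k = v \oM k -> u = v.
Proof.
move=> [e univ] uh uk; have [|w [_ wu]] := univ W (u \oM h) (u \oM k).
  by apply: mdhom_ext => a /=; rewrite -[h _]/((h \oM f) a) e.
by rewrite -(wu u) // -(wu v).
Qed.

Lemma q_cofibration_pushout : is_pushout f g h k -> q_cofibration g -> q_cofibration h.
Proof.
move=> [e univ] qg X Y p tp u v pu.
have [|l [lg pl]] := qg X Y p tp (u \oM f) (v \oM k).
  apply: mdhom_ext => a /=; rewrite -[p _]/((p \oM u) (f a)) pu /=.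
  by rewrite -[h _]/((h \oM f) a) e.
have [|w [[wh wk] _]] := univ X u l; first by rewrite lg.
exists w; split=> //; apply: (@pushout_jointly_epi _ _ _ (conj e univ)).
  by apply: mdhom_ext => a /=; rewrite -[w _]/((w \oM h) a) wh -[LHS]/((p \oM u) a) pu.
by apply: mdhom_ext => a /=; rewrite -[w _]/((w \oM k) a) wk -[LHS]/((p \oM l) a) pl.
Qed.

End PushoutGenerated.

(** * Disks and globes *)

Section RealContinuity.
Context {R : realType} {T : topologicalType}.
Implicit Types f g : T -> R.

Lemma contD f g : continuous f -> continuous g -> continuous (fun x => f x + g x).
Proof. by move=> cf cg x; apply: cvgD; [exact: cf|exact: cg]. Qed.

Lemma contN f : continuous f -> continuous (fun x => - f x).
Proof. by move=> cf x; apply: cvgN; exact: cf. Qed.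

Lemma contM f g : continuous f -> continuous g -> continuous (fun x => f x * g x).
Proof. by move=> cf cg x; apply: cvgM; [exact: cf|exact: cg]. Qed.

Lemma contV f : (forall x, f x != 0) -> continuous f -> continuous (fun x => (f x)^-1).
Proof. by move=> f0 cf x; apply: cvgV; [exact: f0|exact: cf]. Qed.

Lemma cont_sqrt f : continuous f -> continuous (fun x => Num.sqrt (f x)).
Proof.
by move=> cf x; apply: (@continuous_comp _ _ _ f); [exact: cf|exact: sqrt_continuous].
Qed.

Lemma cont_max f g : continuous f -> continuous g ->
  continuous (fun x => Num.max (f x) (g x)).
Proof. by move=> cf cg x; apply: continuous_max; [exact: cf|exact: cg]. Qed.

Lemma cont_min f g : continuous f -> continuous g ->
  continuous (fun x => Num.min (f x) (g x)).
Proof. by move=> cf cg x; apply: continuous_min; [exact: cf|exact: cg]. Qed.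

Lemma cont_sum (J : Type) (r : seq J) (f : J -> T -> R) :
  (forall i, continuous (f i)) -> continuous (fun x => \sum_(i <- r) f i x).
Proof.
move=> cf; elim: r => [|j r IH].
  by under eq_fun do rewrite big_nil; exact: cst_continuous.
by under eq_fun do rewrite big_cons; apply: contD.
Qed.

Lemma cont_cst (a : R) : continuous (fun _ : T => a).
Proof. exact: cst_continuous. Qed.

Lemma cont_rV n (f : T -> 'rV[R]_n) :
  (forall i, continuous (fun x => f x 0 i)) -> continuous f.
Proof.
move=> cf x A [P Pn PA].
have : \forall y \near x, forall i, P 0 i (f y 0 i).
  by apply: (@filter_forall _ _ (fun i s => P 0 i (f s 0 i)) (nbhs x) (nbhs_filter x)) => i; exact: cf (Pn 0 i).
by apply: filterS => y Py; apply: PA => j i; rewrite ord1; exact: Py.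
Qed.

End RealContinuity.

Lemma continuous_fcomp {S T U : topologicalType} (f : S -> T) (g : T -> U) :
  continuous f -> continuous g -> continuous (fun x => g (f x)).
Proof. by move=> cf cg x; apply: (@continuous_comp _ _ _ f g); [exact: cf|exact: cg]. Qed.

Lemma cont_coord {R : realType} n (i : 'I_n) : continuous (fun x : 'rV[R]_n => x 0 i).
Proof. exact: coord_continuous. Qed.

Section Disks.
Context {R : realType}.
Local Notation I := (@itv01 R).

Definition sqnorm n (x : 'rV[R]_n) : R := \sum_i x 0 i ^+ 2.

Lemma sqnorm_ge0 n (x : 'rV[R]_n) : 0 <= sqnorm x.
Proof. by apply: sumr_ge0 => i _; exact: sqr_ge0. Qed.

Lemma sqnorm_continuous n : continuous (@sqnorm n).
Proof.
apply: cont_sum => i; under eq_fun do rewrite expr2.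
by apply: contM; exact: cont_coord.
Qed.

Lemma disk_sqnorm n (x : diskT R n) : sqnorm (val x) <= 1.
Proof. by have := set_mem (valP x). Qed.

Lemma sphere_sqnorm n (x : sphereT R n) : sqnorm (val x) = 1.
Proof. by have := set_mem (valP x). Qed.

Lemma disk_coord_continuous n i : continuous (fun x : diskT R n => val x 0 i).
Proof. exact: (continuous_fcomp (@continuous_setval _ _) (@cont_coord _ _ i)). Qed.

Lemma sphere_coord_continuous n i : continuous (fun x : sphereT R n => val x 0 i).
Proof. exact: (continuous_fcomp (@continuous_setval _ _) (@cont_coord _ _ i)). Qed.

Lemma itv_val_continuous : continuous (val : I -> R).
Proof. exact: (@continuous_setval R). Qed.

Lemma disk_ext n (x y : diskT R n) : (forall i, val x 0 i = val y 0 i) -> x = y.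
Proof. by move=> h; apply/val_inj/rowP. Qed.

(** The denominator is bounded below by 1, so this retraction onto the disk is continuous
    everywhere, the origin included. *)
Definition radial_proj n (x : 'rV[R]_n) : 'rV[R]_n :=
  \row_i (x 0 i / Num.sqrt (Num.max 1 (sqnorm x))).

Lemma radial_proj_subproof n (x : 'rV[R]_n) : radial_proj x \in diskT R n.
Proof.
apply/mem_set; rewrite /disk /=.
have m1 : 1 <= Num.max 1 (sqnorm x) by rewrite le_max lexx.
under eq_bigr do rewrite mxE expr_div_n sqr_sqrtr ?(le_trans ler01) //.
rewrite -mulr_suml ler_pdivrMr ?mul1r ?(lt_le_trans ltr01) //.
by rewrite le_max lexx orbT.
Qed.

Definition to_disk n (x : 'rV[R]_n) : diskT R n :=
  exist (fun y => y \in diskT R n) _ (radial_proj_subproof x).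

Lemma to_diskK n (x : diskT R n) : to_disk (val x) = x.
Proof.
apply: disk_ext => i; rewrite /= mxE (max_idPl _) ?disk_sqnorm //.
by rewrite sqrtr1 divr1.
Qed.

Lemma to_disk_continuous n : continuous (@to_disk n).
Proof.
apply: continuous_to_set; apply: cont_rV => i; under eq_fun do rewrite /= mxE.
apply: contM; first exact: cont_coord.
apply: contV => [x|].
  by rewrite gt_eqF // sqrtr_gt0 lt_max ltr01.
by apply: cont_sqrt; apply: cont_max; [exact: cont_cst|exact: sqnorm_continuous].
Qed.

Lemma disk_coord_le1 n (x : diskT R n) i : -1 <= val x 0 i <= 1.
Proof.
have : val x 0 i ^+ 2 <= 1.
  apply: le_trans (disk_sqnorm x); rewrite /sqnorm (bigD1 i) //= lerDl.
  by apply: sumr_ge0 => j _; exact: sqr_ge0.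
by move=> h; rewrite -ler_norml -(expr_le1 (n := 2)) // real_normK ?num_real.
Qed.

Lemma disk_compact n : compact [set: diskT R n].
Proof.
have -> : [set: diskT R n] =
    @to_disk n @` [set v : 'rV[R]_n | forall i, `[-1, 1]%classic (v ord0 i)].
  apply/seteqP; split=> // x _; exists (val x); last exact: to_diskK.
  by move=> i /=; rewrite in_itv /= disk_coord_le1.
apply: continuous_compact; first exact/continuous_subspaceT/to_disk_continuous.
apply: (@rV_compact R n (fun=> `[-1, 1]%classic)) => _; exact: segment_compact.
Qed.

Lemma itv_compact : compact [set: I].
Proof.
have -> : [set: I] = clamp @` `[0, 1].
  by apply/seteqP; split=> // t _; exists (val t); rewrite ?valcK //= in_itv /= val_itv01.
apply: continuous_compact; last exact: segment_compact.
exact/continuous_subspaceT/clamp_continuous.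
Qed.

(* The product is a retract of a simplex. *)
Lemma disk_itv_delta_generated n : delta_generated (R := R) (diskT R n * I)%type.
Proof.
move=> U dU; pose N : R := n.+1%:R.
have N0 : 0 < N by rewrite ltr0n.
pose sx := @simplex R n.+1.
pose s (x : sx) : diskT R n * I :=
  (to_disk (\row_i (2 * N * val x 0 (lift ord0 (lift ord0 i)) - 1)), clamp (N * val x 0 ord0)).
have cval (i : 'I_n.+2) : continuous (fun x : sx => val x 0 i).
  exact: (continuous_fcomp (@continuous_setval _ _) (@cont_coord _ _ i)).
have cs : continuous s.
  apply: continuous_pairf.
    apply: (continuous_fcomp (f := fun x : sx => \row_i _)); last exact: to_disk_continuous.
    apply: cont_rV => i; under eq_fun do rewrite mxE.
    by apply: contD; [apply: contM; [exact: cont_cst|exact: cval]|exact: cont_cst].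
  apply: continuous_fcomp (@clamp_continuous R).
  by apply: contM; [exact: cont_cst|exact: cval].
(* Barycentric coordinates: [n] of them for the disk and one for time, each scaled into [0, 1/N]
   with [N = n + 1], so that their sum is at most 1; [rest] is the remaining one. *)
pose y_ (p : diskT R n * I) (i : 'I_n) := (val p.1 0 i + 1) / (2 * N).
pose rest p := 1 - val p.2 / N - \sum_i y_ p i.
pose sg (p : diskT R n * I) : 'rV[R]_n.+2 := \row_i
  (if unlift ord0 i is Some j then if unlift ord0 j is Some l then y_ p l else rest p
   else val p.2 / N).
have N2 : 0 < 2 * N by rewrite mulr_gt0.
have sgP p : sg p \in sx.
  have y0 l : 0 <= y_ p l.
    by apply: divr_ge0 (ltW N2); have /andP[? _] := disk_coord_le1 p.1 l; lra.
  have y1 l : y_ p l <= N^-1.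
    rewrite /y_ ler_pdivrMr // mulrCA mulVf ?gt_eqF // mulr1.
    by have /andP[_ ?] := disk_coord_le1 p.1 l; lra.
  have t0 : 0 <= val p.2 / N by apply: divr_ge0 (ltW N0); have /andP[] := val_itv01 p.2.
  have t1 : val p.2 / N <= N^-1.
    by rewrite ler_pdivrMr // mulVf ?gt_eqF //; have /andP[] := val_itv01 p.2.
  apply/mem_set; split=> [i|].
    rewrite mxE; case: unliftP => [j _|_] //; case: unliftP => [l _|_] //.
    have S : \sum_i y_ p i <= n%:R / N.
      rewrite mulr_natl -[leRHS](_ : \sum_(i < n) N^-1 = _); last by rewrite sumr_const card_ord.
      by apply: ler_sum => l _.
    have E : 1 = N^-1 + n%:R / N :> R.
      by rewrite -[X in X + _]mul1r -mulrDl nat1r divff // gt_eqF.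
    by rewrite /rest subr_ge0 lerBrDl [leRHS]E; exact: lerD.
  rewrite big_ord_recl big_ord_recl !mxE unlift_none liftK unlift_none.
  under eq_bigr do rewrite mxE !liftK.
  by rewrite /rest subrK addrC subrK.
pose sg' p : sx := exist (fun y => y \in sx) (sg p) (sgP p).
have csg : continuous sg'.
  apply: continuous_to_set; apply: cont_rV => i.
  have cy l : continuous (fun p => y_ p l).
    apply: contM; last exact: cont_cst.
    apply: contD; last exact: cont_cst.
    by apply: (continuous_fcomp (f := fst)) (@disk_coord_continuous _ l) => p; exact: cvg_fst.
  have ct : continuous (fun p : diskT R n * I => val p.2 / N).
    apply: contM; last exact: cont_cst.
    by apply: (continuous_fcomp (f := snd)) itv_val_continuous => p; exact: cvg_snd.
  under eq_fun do rewrite /= mxE.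
  case: unliftP => [j _|_]; last exact: ct.
  case: unliftP => [l _|_]; first exact: cy.
  have c1 : continuous (fun p : diskT R n * I => 1 - val p.2 / N).
    by apply: contD; [exact: cont_cst|exact: contN].
  have c2 : continuous (fun p : diskT R n * I => - \sum_i y_ p i).
    by apply: contN; exact: cont_sum.
  exact: (contD c1 c2).
have ssg p : s (sg' p) = p.
  case: p => y t; congr pair.
    rewrite -[RHS]to_diskK; congr to_disk; apply/rowP => i.
    rewrite !mxE !liftK /y_ /= mulrCA divff ?gt_eqF // mulr1 addrK //.
  by rewrite mxE unlift_none /= mulrCA divff ?gt_eqF // mulr1 valcK.
have -> : U = sg' @^-1` (s @^-1` U) by apply/seteqP; split=> p /=; rewrite ssg.
by move/continuousP: csg; apply; exact: dU.
Qed.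

Lemma globe_pt_disk_continuous n :
  continuous (fun p : diskT R n * I => globe_pt p.1 p.2).
Proof. by apply/continuousP => U oU; exact: disk_itv_delta_generated. Qed.

Lemma globe_pt_surj (Z : topologicalType) (z0 : Z) (x : globe R Z) :
  exists z t, x = globe_pt z t.
Proof.
case: x => [[]|[z u]].
- by exists z0, i1; rewrite globe_pt1.
- by exists z0, i0; rewrite globe_pt0.
- by exists z, (clamp (val u)); rewrite globe_inr.
Qed.

Lemma globe_disk_compact n : compact [set: globe R (diskT R n)].
Proof.
have -> : [set: globe R (diskT R n)] =
    (fun p : diskT R n * I => globe_pt p.1 p.2) @` [set: diskT R n * I].
  apply/seteqP; split=> // x _.
  by have [z [t ->]] := globe_pt_surj (to_disk 0) x; exists (z, t).
apply: continuous_compact.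
  exact/continuous_subspaceT/globe_pt_disk_continuous.
by rewrite -setXTT; apply: compact_setX; [exact: disk_compact|exact: itv_compact].
Qed.

Lemma globe_disk_hausdorff n : hausdorff_space (globe R (diskT R n)).
Proof. exact/globe_hausdorff/rV_hausdorff. Qed.

End Disks.

(** * The disk as a family of vertical chords over the disk of one dimension less *)

Section DiskCoordinates.
Context {R : realType} {n : nat}.

Definition cons_row (s : R) (y : 'rV[R]_n) : 'rV[R]_n.+1 :=
  \row_i (if unlift ord0 i is Some j then y 0 j else s).

Lemma cons_row0 s y : cons_row s y 0 ord0 = s.
Proof. by rewrite mxE unlift_none. Qed.

Lemma cons_row_lift s y i : cons_row s y 0 (lift ord0 i) = y 0 i.
Proof. by rewrite mxE liftK. Qed.

Definition tail_row (x : 'rV[R]_n.+1) : 'rV[R]_n := \row_i x 0 (lift ord0 i).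

Lemma cons_tail (x : 'rV[R]_n.+1) : cons_row (x 0 ord0) (tail_row x) = x.
Proof.
by apply/rowP => i; rewrite mxE; case: unliftP => [j ->|->] //; rewrite mxE.
Qed.

Lemma tail_cons s y : tail_row (cons_row s y) = y.
Proof. by apply/rowP => i; rewrite mxE cons_row_lift. Qed.

Lemma sqnorm_cons s y : sqnorm (cons_row s y) = s ^+ 2 + sqnorm y.
Proof.
rewrite /sqnorm big_ord_recl cons_row0; congr (_ + _).
by apply: eq_bigr => i _; rewrite cons_row_lift.
Qed.

Lemma sqnorm_tail (x : 'rV[R]_n.+1) : sqnorm x = x 0 ord0 ^+ 2 + sqnorm (tail_row x).
Proof. by rewrite -{1}[x]cons_tail sqnorm_cons. Qed.

(* The half-length of the vertical chord of the disk above [y]. *)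
Definition chord (y : diskT R n) : R := Num.sqrt (1 - sqnorm (val y)).

Lemma chord_ge0 y : 0 <= chord y.
Proof. exact: sqrtr_ge0. Qed.

Lemma sqr_chord y : chord y ^+ 2 = 1 - sqnorm (val y).
Proof. by rewrite sqr_sqrtr // subr_ge0 disk_sqnorm. Qed.

Lemma chord_continuous : continuous chord.
Proof.
apply: cont_sqrt; apply: contD; first exact: cont_cst.
by apply: contN; exact: (continuous_fcomp (@continuous_setval _ _) (@sqnorm_continuous _ _)).
Qed.

Lemma abs_le_chord (y : diskT R n) s : s ^+ 2 + sqnorm (val y) <= 1 ->
  - chord y <= s <= chord y.
Proof.
move=> h; rewrite -ler_norml -sqrtr_sqr ler_sqrt ?subr_ge0 ?disk_sqnorm //.
by rewrite lerBrDr.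
Qed.

Lemma chord_sqnorm (y : diskT R n) s : - chord y <= s <= chord y ->
  s ^+ 2 + sqnorm (val y) <= 1.
Proof.
move=> /andP[a b]; have := sqr_chord y => e.
suff : s ^+ 2 <= chord y ^+ 2 by lra.
have := chord_ge0 y; nra.
Qed.

Lemma mk_disk_subproof (s : R) (y : diskT R n) :
  cons_row (Num.max (- chord y) (Num.min s (chord y))) (val y) \in diskT R n.+1.
Proof.
apply/mem_set; rewrite /disk /= -/(sqnorm _) sqnorm_cons; apply: chord_sqnorm.
rewrite le_max lexx /= ge_max ge_min lexx orbT andbT.
by have := chord_ge0 y; lra.
Qed.

(* The point of the disk above [y] whose height is closest to [s]. *)
Definition mk_disk (s : R) (y : diskT R n) : diskT R n.+1 :=
  exist (fun z => z \in diskT R n.+1) _ (mk_disk_subproof s y).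

Lemma tail_disk_subproof (x : diskT R n.+1) : tail_row (val x) \in diskT R n.
Proof.
apply/mem_set; rewrite /disk /= -/(sqnorm _); have := disk_sqnorm x.
by rewrite sqnorm_tail; have := sqr_ge0 (val x 0 ord0); lra.
Qed.

Definition tail_disk (x : diskT R n.+1) : diskT R n :=
  exist (fun z => z \in diskT R n) _ (tail_disk_subproof x).

Definition height (x : diskT R n.+1) : R := val x 0 ord0.

Lemma height_chord x : - chord (tail_disk x) <= height x <= chord (tail_disk x).
Proof.
by apply: abs_le_chord; rewrite /height /= -sqnorm_tail; exact: disk_sqnorm.
Qed.

Lemma mk_disk_tail s y : tail_disk (mk_disk s y) = y.
Proof. by apply: val_inj; rewrite /= tail_cons. Qed.

Lemma mk_disk_height s y : - chord y <= s <= chord y -> height (mk_disk s y) = s.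
Proof.
by move=> /andP[a b]; rewrite /height /= cons_row0 (min_idPl b) (max_idPr a).
Qed.

Lemma disk_eq (x x' : diskT R n.+1) :
  height x = height x' -> tail_disk x = tail_disk x' -> x = x'.
Proof.
move=> h /(congr1 val) /= t; apply: val_inj => /=.
by rewrite -[val x]cons_tail -[val x']cons_tail t; congr cons_row.
Qed.

Lemma mk_disk_continuous (T : topologicalType) (s : T -> R) (y : T -> diskT R n) :
  continuous s -> continuous y -> continuous (fun x => mk_disk (s x) (y x)).
Proof.
move=> cs cy; apply: continuous_to_set; apply: cont_rV => i /=.
under eq_fun do rewrite mxE; case: unliftP => [j _|_].
  exact: (continuous_fcomp cy (@disk_coord_continuous _ _ j)).
have cc := continuous_fcomp cy chord_continuous.
by apply: cont_max; [exact: contN|exact: cont_min].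
Qed.

Lemma tail_disk_continuous : continuous tail_disk.
Proof.
apply: continuous_to_set; apply: cont_rV => i; under eq_fun do rewrite /= mxE.
exact: disk_coord_continuous.
Qed.

Lemma height_continuous : continuous height.
Proof. exact: disk_coord_continuous. Qed.

Lemma sqnorm_height x : sqnorm (val x) = height x ^+ 2 + sqnorm (val (tail_disk x)).
Proof. exact: sqnorm_tail. Qed.

Definition cap_sign (b : bool) : R := if b then 1 else -1.

Lemma cap_sign_sqr b : cap_sign b ^+ 2 = 1.
Proof. by case: b; rewrite /cap_sign ?sqrrN expr1n. Qed.

Lemma cap_subproof b (y : diskT R n) :
  cons_row (cap_sign b * chord y) (val y) \in sphereT R n.+1.
Proof.
apply/mem_set; rewrite /sphere /= -/(sqnorm _) sqnorm_cons exprMn cap_sign_sqr.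
by rewrite mul1r sqr_chord subrK.
Qed.

Definition cap b (y : diskT R n) : sphereT R n.+1 :=
  exist (fun z => z \in sphereT R n.+1) _ (cap_subproof b y).

Lemma cap_continuous b : continuous (cap b).
Proof.
apply: continuous_to_set; apply: cont_rV => i /=; under eq_fun do rewrite mxE.
case: unliftP => [j _|_]; first exact: disk_coord_continuous.
by apply: contM; [exact: cont_cst|exact: chord_continuous].
Qed.

Definition sphere_tail (x : sphereT R n.+1) : diskT R n := tail_disk (sphere_disk x).

Lemma sphere_tail_continuous : continuous sphere_tail.
Proof.
exact: (continuous_fcomp (@sphere_disk_continuous R n.+1) tail_disk_continuous).
Qed.

Lemma sphere_height (x : sphereT R n.+1) :
  val x 0 ord0 = chord (sphere_tail x) \/ val x 0 ord0 = - chord (sphere_tail x).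
Proof.
have : val x 0 ord0 ^+ 2 == chord (sphere_tail x) ^+ 2.
  by rewrite sqr_chord /= eq_sym subr_eq -sqnorm_tail sphere_sqnorm.
by rewrite eqf_sqr => /orP[/eqP|/eqP]; [left|right].
Qed.

Lemma cap_tail (x : sphereT R n.+1) b :
  0 <= cap_sign b * val x 0 ord0 -> cap b (sphere_tail x) = x.
Proof.
move=> h; apply: val_inj => /=; rewrite -[RHS]cons_tail; congr cons_row.
have c0 := chord_ge0 (sphere_tail x).
by have := sphere_height x; case: b h; rewrite /cap_sign => h [] e; lra.
Qed.

Lemma sphere_cap (x : sphereT R n.+1) : exists b, cap b (sphere_tail x) = x.
Proof.
have [h|h] := leP 0 (val x 0 ord0); first by exists true; apply: cap_tail; rewrite mul1r.
by exists false; apply: cap_tail; rewrite mulN1r oppr_ge0 ltW.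
Qed.

End DiskCoordinates.

(** * Extension of functions from the globe of a sphere *)

Section GlobeExtension.
Context {R : realType}.
Local Notation I := (@itv01 R).

Lemma sphere0 (x : sphereT R 0) : False.
Proof.
by have := sphere_sqnorm x; rewrite /sqnorm big_ord0 => /eqP; rewrite eq_sym oner_eq0.
Qed.

(** The globe is covered by the images of the globes of two disks under the hemisphere charts; for
    the empty sphere it consists of the two poles. *)
Lemma globe_sphere_compact n : compact [set: globe R (sphereT R n)].
Proof.
case: n => [|n].
  apply: finite_compact.
  have -> : [set: globe R (sphereT R 0)] = globe_pole @` [set: bool].
    apply/seteqP; split=> // -[b|[z u]] _; first by exists b.
    by case: (sphere0 z).
  exact: finite_image.
have K b : compact (globe_map (R := R) (@cap R n b) @` setT).
  apply: continuous_compact; last exact: globe_disk_compact.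
  apply: continuous_subspaceT; apply: globe_map_continuous; exact: cap_continuous.
have -> : [set: globe R (sphereT R n.+1)] =
    globe_map (@cap R n true) @` setT `|` globe_map (@cap R n false) @` setT.
  apply/seteqP; split=> // -[b|[z u]] _; first by left; exists (globe_pole b).
  by have [[] zE] := sphere_cap z; [left|right]; exists (inr (sphere_tail z, u)); rewrite //= zE.
exact: compactU.
Qed.

Lemma sphere_disk_inj n : injective (@sphere_disk R n).
Proof. by move=> x y /(congr1 val) /= /val_inj. Qed.

Lemma globe_map_inj (Z Z' : topologicalType) (f : Z -> Z') :
  injective f -> injective (globe_map (R := R) f).
Proof.
move=> fi [b|[z u]] [b'|[z' u']] //=; first by case=> ->.
by case=> /fi -> ->.
Qed.

(** Tietze: an injection of a compact space into a Hausdorff space is a closed embedding, and the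
    globe of the disk is normal, being compact Hausdorff. *)
Lemma globe_sphere_extension n (g : globe R (sphereT R n) -> I) : continuous g ->
  exists2 G : globe R (diskT R n) -> I, continuous G &
    forall x, G (globe_map (@sphere_disk R n) x) = g x.
Proof.
move=> cg; pose j := globe_map (R := R) (@sphere_disk R n).
have ij : injective j by apply: globe_map_inj; exact: sphere_disk_inj.
have cj : continuous j by apply: globe_map_continuous; exact: sphere_disk_continuous.
have clj C : closed C -> closed (j @` C).
  move=> clC; apply: compact_closed; first exact: globe_disk_hausdorff.
  apply: continuous_compact; first exact: continuous_subspaceT.
  by apply: subclosed_compact (@globe_sphere_compact n) _.
(* [g] transported to the image of [j]; the value 0 elsewhere is a placeholder, since continuity is
   asked within the image only. *)
have [f fj] : exists f : globe R (diskT R n) -> R, forall x, f (j x) = val (g x).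
  exists (fun x => if pselect (exists y, j y = x) is left e
    then val (g (projT1 (cid e))) else 0) => x.
  case: pselect => [e|[]]; last by exists x.
  by congr (val (g _)); apply: ij; exact: (projT2 (cid e)).
pose A := range j.
have cf : {within A, continuous f}.
  apply/continuous_closedP => C clC; apply/closed_subspaceP.
  exists (j @` ((fun x => val (g x)) @^-1` C)).
    apply: clj; apply: preimage_closed clC => x _.
    by apply: continuous_fcomp cg itv_val_continuous _.
  apply/seteqP; split=> y [].
    by move=> [x Cx <-] jx; split=> //; move: Cx => /=; rewrite -fj.
  by move=> /= Cy [x _ xy]; split; [exists x => //=; rewrite -fj xy|exists x].
have [|||||h [hf ch _]] := @continuous_bounded_extension _ R _ A _ f 1.
- by apply: compact_normal; [exact: globe_disk_hausdorff|exact: globe_disk_compact].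
- by apply: clj; exact: closedT.
- exact: ltr01.
- exact: cf.
- by move=> _ [x _ <-]; rewrite fj ger0_norm; have /andP[] := val_itv01 (g x).
(* The Tietze extension is bounded by 1 in absolute value; clamping brings it into [0, 1] and keeps
   the prescribed values. *)
exists (fun x => clamp (h x)); first exact: (continuous_fcomp ch (@clamp_continuous R)).
by move=> x; rewrite -hf ?fj ?valcK //; apply/mem_set; exists x.
Qed.

End GlobeExtension.

(** * Transfinite towers *)

Section WellOrders.
Context {L : wellOrder}.
Implicit Types u v w : L.

Lemma wo_ind (P : L -> Prop) :
  (forall v, (forall u, (u < v)%O -> P u) -> P v) -> forall v, P v.
Proof. by move=> IH v; elim: v / (wo_wf v) => v _; exact: IH. Qed.

Lemma succ_uniq u v v' : is_succ u v -> is_succ u v' -> v = v'.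
Proof. by move=> [uv mv] [uv' mv']; apply/le_anti; rewrite mv // mv'. Qed.

Lemma lt_succ u v w : is_succ u v -> (w < v)%O -> (w <= u)%O.
Proof. by move=> [uv mv] wv; rewrite leNgt; apply/negP => /mv; rewrite leNgt wv. Qed.

Lemma succ_inj u u' v : is_succ u v -> is_succ u' v -> u = u'.
Proof.
move=> s s'; apply/le_anti.
by rewrite (lt_succ s' s.1) (lt_succ s s'.1).
Qed.

Lemma exists_succ u v : (u < v)%O -> exists w, is_succ u w /\ (w <= v)%O.
Proof.
elim/wo_ind: v => v IH uv.
have [[w [uw wv]]|h] := pselect (exists w, (u < w)%O /\ (w < v)%O).
  by have [w' [s w'w]] := IH w wv uw; exists w'; split=> //; exact: le_trans w'w (ltW wv).
exists v; split=> //; split=> // w uw; rewrite leNgt; apply/negP => wv.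
by apply: h; exists w.
Qed.

Lemma succ_or_limit u v : (u < v)%O -> (exists s, is_succ s v) \/ is_limit v.
Proof.
move=> uv; have [|h] := pselect (exists s, is_succ s v); first by left.
right; split=> [e|s hs]; last by apply: h; exists s.
by move: uv; rewrite e ltx0.
Qed.

End WellOrders.

Section TowerLifting.
Context {R : realType} {dH : bool}.
Local Notation I := (@itv01 R).
Local Notation mdspace := (mdspace R dH).
Context {L : wellOrder} (T : tower R dH L).
Implicit Types u v w : L.

Definition partial_cocone (S : set L) (P : mdspace) (k : forall u, S u -> mdhom (T u) P) :=
  forall u v (uv : (u <= v)%O) (hu : S u) (hv : S v), k v hv \oM tower_map T uv = k u hu.

(** A colimit over a set of indices, so that one argument serves a single stage, a limit stage and
    the whole tower. *)
Definition partial_colimit (S : set L) (P : mdspace) (k : forall u, S u -> mdhom (T u) P) :=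
  partial_cocone k /\
  forall (W : mdspace) (k' : forall u, S u -> mdhom (T u) W), partial_cocone k' ->
    exists! w : mdhom P W, forall u hu, w \oM k u hu = k' u hu.

Lemma tower_map_irr u v (h h' : (u <= v)%O) : tower_map T h = tower_map T h'.
Proof. by congr tower_map; exact: bool_irrelevance. Qed.

Lemma tower_mapM u v w (uv : (u <= v)%O) (vw : (v <= w)%O) (uw : (u <= w)%O) :
  tower_map T vw \oM tower_map T uv = tower_map T uw.
Proof. exact: tower_map_comp. Qed.

Lemma tower_mapC u v w (uv : (u <= v)%O) (vw : (v <= w)%O) (uw : (u <= w)%O) x :
  tower_map T vw (tower_map T uv x) = tower_map T uw x.
Proof. by rewrite -(tower_mapM uv vw uw). Qed.

Lemma tower_mapI u (h : (u <= u)%O) x : tower_map T h x = x.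
Proof. by rewrite tower_map_id. Qed.

Lemma mdcompA (W X Y Z : mdspace) (h : mdhom Y Z) (g : mdhom X Y) (f : mdhom W X) :
  h \oM (g \oM f) = h \oM g \oM f.
Proof. by apply: mdhom_ext. Qed.

Lemma mdcomp1 (X Y : mdspace) (f : mdhom X Y) : f \oM mdid X = f.
Proof. by apply: mdhom_ext. Qed.

Lemma mdcompE (X Y Z : mdspace) (g : mdhom Y Z) (f : mdhom X Y) h :
  g \oM f = h -> forall x, g (f x) = h x.
Proof. by move=> <-. Qed.

Lemma stage_colimit w :
  @partial_colimit [set u | (u <= w)%O] (T w) (fun u h => tower_map T h).
Proof.
split=> [u v uv hu hv|W k' ck]; first exact: tower_mapM.
exists (k' w (lexx w)); split=> [u hu|h hE]; first exact: ck.
rewrite -(hE w (lexx w)); apply: mdhom_ext => x /=.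
by rewrite tower_mapI.
Qed.

Lemma limit_colimit w : is_limit w ->
  @partial_colimit [set u | (u < w)%O] (T w) (fun u h => tower_map T (ltW h)).
Proof.
move=> lw; split=> [u v uv hu hv|W k' ck]; first exact: tower_mapM.
by have [h [hE hu]] := tower_map_lim lw ck; exists h.
Qed.

Lemma total_colimit (P : mdspace) (k : forall u, mdhom (T u) P) :
  is_colimit k -> @partial_colimit setT P (fun u _ => k u).
Proof.
move=> [ck univ]; split=> [u v uv _ _|W k' ck']; first exact: ck.
have [|h [hE hu]] := univ W (fun u => k' u Logic.I); first by move=> u v uv; exact: ck'.
exists h; split=> [u hu'|h' h'E].
  by rewrite hE; congr k'; exact: Prop_irrelevance.
by apply: hu => u; rewrite (h'E u Logic.I).
Qed.

Lemma partial_colimit_epi S P (k : forall u, S u -> mdhom (T u) P) (W : mdspace)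
    (f g : mdhom P W) : partial_colimit k ->
  (forall u hu, f \oM k u hu = g \oM k u hu) -> f = g.
Proof.
move=> [ck univ] fg; have [u v uv hu hv|w [_ wu]] := univ W (fun u hu => f \oM k u hu).
  by rewrite -mdcompA ck.
by rewrite -(wu f) // -(wu g) // => u hu; rewrite fg.
Qed.

Lemma partial_colimit_generated S P (k : forall u, S u -> mdhom (T u) P) :
  partial_colimit k ->
  generated_by (fun q : {u | S u} => k (proj1_sig q) (proj2_sig q)).
Proof.
move=> pc; apply: generatedP => W i k' ii ik.
have ik' u hu : i \oM k' (exist _ u hu) = k u hu := ik (exist _ u hu).
have [|s [sE _]] := pc.2 W (fun u hu => k' (exist _ u hu)).
  move=> u v uv hu hv; apply: mdhom_ext => x; apply: ii.
  rewrite (mdcompE (ik' u hu)) /= (mdcompE (ik' v hv)).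
  exact: (mdcompE (pc.1 u v uv hu hv)).
exists s; apply: (partial_colimit_epi pc) => u hu; apply: mdhom_ext => x /=.
by rewrite (mdcompE (sE u hu)) (mdcompE (ik' u hu)).
Qed.

Section Lifting.
Context {S : set L} {P : mdspace} {k : forall u, S u -> mdhom (T u) P}.
Hypothesis S_down : forall u v, (u <= v)%O -> S v -> S u.
Hypothesis pc : partial_colimit k.
Context {U V : mdspace} {p : mdhom U V}.
Hypothesis steps : forall u v (h : is_succ u v), S v -> has_lifting (tower_next T h) p.
Context {u : L} {hu : S u} {a : mdhom (T u) U} {b : mdhom P V}.
Hypothesis pa : p \oM a = b \oM k hu.

Let kM w w' (ww : (w <= w')%O) (hw : S w) (hw' : S w') :
  k hw' \oM tower_map T ww = k hw.
Proof. exact: pc.1. Qed.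

Let kS w w' (ww : (w <= w')%O) (hw' : S w') :
  k hw' \oM tower_map T ww = k (S_down ww hw').
Proof. exact: pc.1. Qed.

Let k_irr w (h h' : S w) : k h = k h'.
Proof. by congr k; exact: Prop_irrelevance. Qed.

(** Chosen once and for all from the map [a'] to be lifted, so that partial lifts that agree at one
    stage agree at the next. *)
Let lift_spec s s' (h : is_succ s s') (hs' : S s') (a' : mdhom (T s) U) :
  p \oM a' = b \oM k hs' \oM tower_next T h ->
  {l : mdhom (T s') U | l \oM tower_next T h = a' /\ p \oM l = b \oM k hs'}.
Proof. by move=> e; apply: cid; exact: (@steps s s' h hs' a' _ e). Qed.

Let lift_irr s s' (h : is_succ s s') (hs' hs'' : S s') (a' a'' : mdhom (T s) U) e e' :
  a' = a'' -> sval (@lift_spec s s' h hs' a' e) = sval (@lift_spec s s' h hs'' a'' e').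
Proof.
move=> aa; subst a''; have hh : hs' = hs'' by exact: Prop_irrelevance.
by subst hs''; rewrite (Prop_irrelevance e e').
Qed.

(* The partial lifts that make the chosen lift at each successor stage; they
   are unique, which makes them compatible at limit stages. *)
Let good w (H : mdhom (T w) U) := exists (hw : S w) (uw : (u <= w)%O),
  [/\ p \oM H = b \oM k hw, H \oM tower_map T uw = a &
   forall s s' (h : is_succ s s') (us : (u <= s)%O) (s'w : (s' <= w)%O)
     (sw : (s <= w)%O) (hs' : S s') e,
     H \oM tower_map T s'w = sval (@lift_spec s s' h hs' (H \oM tower_map T sw) e)].

Let good_restrict w w' (ww : (w' <= w)%O) (H : mdhom (T w) U) :
  (u <= w')%O -> good H -> good (H \oM tower_map T ww).
Proof.
move=> uw' [hw [uw [pH Ha Hs]]]; exists (S_down ww hw), uw'; split.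
- by rewrite mdcompA pH -mdcompA kS.
- by rewrite -mdcompA (tower_mapM _ _ uw).
move=> s s' h us s'w sw hs' e.
have e1 : (H \oM tower_map T ww) \oM tower_map T sw = H \oM tower_map T (le_trans sw ww).
  by rewrite -mdcompA (tower_mapM _ _ (le_trans sw ww)).
have e2 : p \oM (H \oM tower_map T (le_trans sw ww)) = b \oM k hs' \oM tower_next T h.
  by rewrite -e1.
rewrite (lift_irr e e2 e1) -(Hs s s' h us (le_trans s'w ww)).
by rewrite -mdcompA (tower_mapM _ _ (le_trans s'w ww)).
Qed.

Let good_uniq w (H H' : mdhom (T w) U) : good H -> good H' -> H = H'.
Proof.
elim/(@wo_ind L): w H H' => w IH H H' gH gH'.
have [hw [uw [pH Ha Hs]]] := gH; have [hw' [uw' [pH' Ha' Hs']]] := gH'.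
have agree x (xw : (x < w)%O) :
    H \oM tower_map T (ltW xw) = H' \oM tower_map T (ltW xw).
  have [ux|/ltW xu] := leP u x.
    by apply: (IH x xw); exact: good_restrict.
  rewrite -(tower_mapM xu uw (ltW xw)) !mdcompA Ha.
  by rewrite (tower_map_irr uw uw') Ha'.
move: (uw); rewrite le_eqVlt => /orP[/eqP uwE|ltuw].
  by subst w; move: Ha Ha'; rewrite !tower_map_id !mdcomp1 => -> ->.
have [[s sw]|lw] := succ_or_limit ltuw; last first.
  by apply: (partial_colimit_epi (limit_colimit lw)) => x xw; exact: agree.
have us := lt_succ sw ltuw.
have ww : (w <= w)%O := lexx w.
have es : H \oM tower_map T (is_succ_le sw) = H' \oM tower_map T (is_succ_le sw).
  by rewrite (tower_map_irr _ (ltW sw.1)); exact: agree.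
have e : p \oM (H \oM tower_map T (is_succ_le sw)) = b \oM k hw \oM tower_next T sw.
  by rewrite mdcompA pH.
have e' : p \oM (H' \oM tower_map T (is_succ_le sw)) = b \oM k hw \oM tower_next T sw.
  by rewrite -es.
have := Hs s w sw us ww (is_succ_le sw) hw e.
rewrite (lift_irr e e' es) -(Hs' s w sw us ww) tower_map_id !mdcomp1 //.
Qed.

(** A cocone needs a map at every index; strictly below [u], where no map is [good], the
    restrictions of [a] are used. *)
Let glue (S' : set L) (Q : mdspace) (q : forall w, S' w -> mdhom (T w) Q) :
  partial_colimit q -> S' u -> (forall w, S' w -> S w) ->
  (forall w, S' w -> (u <= w)%O -> exists H : mdhom (T w) U, good H) ->
  exists H : mdhom Q U, (forall w (hw : S' w), (u <= w)%O -> good (H \oM q w hw)) /\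
    (forall w (hw : S' w) (wu : (w <= u)%O), H \oM q w hw = a \oM tower_map T wu).
Proof.
move=> qc S'u S'S ex.
have F w (hw : S' w) : {G : mdhom (T w) U |
    ((u <= w)%O -> good G) /\ forall wu : (w <= u)%O, G = a \oM tower_map T wu}.
  apply: cid; have [uw|wu] := leP u w; last first.
    exists (a \oM tower_map T (ltW wu)); split=> // wu'.
    by rewrite (tower_map_irr _ wu').
  have [G gG] := ex w hw uw; exists G; split=> // wu.
  have [_ [uw' [_ Ga _]]] := gG; rewrite -Ga -mdcompA.
  by rewrite (tower_mapM wu uw' (lexx w)) tower_map_id mdcomp1.
have [|H [HE _]] := qc.2 U (fun w hw => proj1_sig (F w hw)).
  move=> x y xy hx hy; have [gx ax] := proj2_sig (F x hx); have [gy ay] := proj2_sig (F y hy).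
  have [ux|xu] : (u <= x)%O \/ (x <= u)%O by apply/orP/le_total.
    by apply: good_uniq (gx ux); apply: good_restrict => //; apply: gy; exact: le_trans xy.
  rewrite (ax xu); have [uy|yu] : (u <= y)%O \/ (y <= u)%O by apply/orP/le_total.
    have [_ [uy' [_ Ga _]]] := gy uy.
    by rewrite -(tower_mapM xu uy' xy) mdcompA Ga.
  by rewrite (ay yu) -mdcompA (tower_mapM xy yu xu).
exists H; split=> [w hw uw|w hw wu]; rewrite HE.
  exact: (proj2_sig (F w hw)).1.
exact: (proj2_sig (F w hw)).2.
Qed.

Let good_exists w : S w -> (u <= w)%O -> exists H : mdhom (T w) U, good H.
Proof.
elim/(@wo_ind L): w => w IH hw; rewrite le_eqVlt => /orP[/eqP uwE|ltuw].
  subst w; exists a, hu, (lexx u); split=> //.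
    by rewrite tower_map_id mdcomp1.
  by move=> s s' h us s'u; have := lt_le_trans (le_lt_trans us h.1) s'u; rewrite ltxx.
have [[s sw]|lw] := succ_or_limit ltuw.
  have us := lt_succ sw ltuw.
  have [H [hs [us' [pH Ha Hs]]]] := IH s sw.1 (S_down (ltW sw.1) hw) us.
  have e : p \oM H = b \oM k hw \oM tower_next T sw.
    by rewrite pH -mdcompA /tower_next (kM _ hs).
  have [lH lp] := proj2_sig (lift_spec e); pose l := sval (lift_spec e).
  exists l, hw, (ltW ltuw); split=> //.
    by rewrite -Ha -lH -mdcompA /tower_next (tower_mapM _ _ (ltW ltuw)).
  move=> t t' h ut t'w tw ht' e'.
  have /orP[/eqP t'E|lt'w] : (t' == w) || (t' < w)%O by rewrite -le_eqVlt.
    subst t'; have tE := succ_inj h sw; subst t.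
    have e2 : H = l \oM tower_map T tw.
      by rewrite -lH; congr (_ \oM _); exact: tower_map_irr.
    have hh : sw = h by exact: Prop_irrelevance.
    by subst h; rewrite -(lift_irr e e' e2) tower_map_id mdcomp1.
  have t's := lt_succ sw lt'w.
  have ts := le_trans (ltW h.1) t's.
  have e1 : H \oM tower_map T ts = l \oM tower_map T tw.
    by rewrite -lH -mdcompA /tower_next (tower_mapM _ _ tw).
  have e2 : p \oM (H \oM tower_map T ts) = b \oM k ht' \oM tower_next T h by rewrite e1.
  rewrite -(lift_irr e2 e' e1) -(Hs t t' h ut t's).
  by rewrite -lH -mdcompA /tower_next (tower_mapM _ _ t'w).
have [||H [gH aH]] := glue (limit_colimit lw) ltuw.
- by move=> x /ltW xw; exact: S_down xw hw.
- by move=> x xw ux; apply: IH => //; exact: S_down (ltW xw) hw.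
exists H, hw, (ltW ltuw); split.
- apply: (partial_colimit_epi (limit_colimit lw)) => x xw.
  have hx := S_down (ltW xw) hw; rewrite -!mdcompA (kM _ hx).
  have [ux|/ltW xu] := leP u x.
    have [hx' [_ [e _ _]]] := gH x xw ux; by rewrite e (k_irr hx' hx).
  by rewrite (aH x xw xu) mdcompA pa -mdcompA (kM _ hx).
- by rewrite (aH u ltuw (lexx u)) tower_map_id mdcomp1.
move=> s s' h us s'w sw hs' e.
have /orP[/eqP s'E|lt'w] : (s' == w) || (s' < w)%O by rewrite -le_eqVlt.
  by subst s'; case: (lw.2 s).
have us' := le_trans us (ltW h.1).
have [_ [_ [_ _ gs]]] := gH s' lt'w us'.
have e1 : (H \oM tower_map T (ltW lt'w)) \oM tower_map T (ltW h.1) = H \oM tower_map T sw.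
  by rewrite -mdcompA (tower_mapM _ _ sw).
have e2 : p \oM ((H \oM tower_map T (ltW lt'w)) \oM tower_map T (ltW h.1)) =
   b \oM k hs' \oM tower_next T h by rewrite e1.
have := gs s s' h us (lexx s') (ltW h.1) hs' e2.
rewrite (lift_irr e2 e e1) => <-; rewrite tower_map_id mdcomp1.
by rewrite (tower_map_irr s'w (ltW lt'w)).
Qed.

(** Left lifting properties pass to transfinite compositions. The lemma is applied to trivial
    fibrations for q-cofibrancy, and to the map from the interval to the point for extending
    functions. *)
Lemma transfinite_lift : exists h : mdhom P U, h \oM k hu = a /\ p \oM h = b.
Proof.
have [H [gH aH]] := glue pc hu (fun _ => id) good_exists.
exists H; split.
  by rewrite (aH u hu (lexx u)) tower_map_id mdcomp1.
apply: (partial_colimit_epi pc) => w hw; rewrite -mdcompA.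
have [uw|/ltW wu] := leP u w.
  by have [hw' [_ [-> _ _]]] := gH w hw uw; rewrite (k_irr hw' hw).
by rewrite (aH w hw wu) mdcompA pa -mdcompA (kM _ hw).
Qed.

End Lifting.

End TowerLifting.

(** * Relative cell structures *)

Section RelativeCells.
Context {R : realType} {dH : bool}.
Local Notation I := (@itv01 R).
Local Notation mdspace := (mdspace R dH).
Local Notation GlobD := (GlobD R dH).
Local Notation GlobSD := (GlobSD R dH).

Definition inner n (z : diskT R n) := sqnorm (val z) < 1.

Definition cell_int n (p : globe R (diskT R n)) : Prop :=
  if p is inr (z, _) then inner z else False.

Lemma inner_or_sphere n (z : diskT R n) : inner z \/ exists y, z = sphere_disk y.
Proof.
have := disk_sqnorm z; rewrite le_eqVlt => /orP[/eqP e|]; last by left.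
have h : val z \in sphereT R n by apply/mem_set.
by right; exists (exist (fun y => y \in sphereT R n) (val z) h); apply: val_inj.
Qed.

Lemma sphere_not_inner n (y : sphereT R n) : ~ inner (sphere_disk y).
Proof. by rewrite /inner /= sphere_sqnorm ltxx. Qed.

Lemma cell_intNE n (p : GlobD n) : ~ cell_int p -> exists q, p = GlobSD n q.
Proof.
case: p => [b _|[z u] /= h]; first by exists (globe_pole b).
by have [//|[y ->]] := inner_or_sphere z; exists (inr (y, u)).
Qed.

Lemma globSD_not_int n q : ~ cell_int (GlobSD n q).
Proof. by case: q => [b|[y u]] //= h; exact: (sphere_not_inner h). Qed.

Lemma cell_intE n : [set p | cell_int p] = @globe_interior R dH n.
Proof.
apply/seteqP; split=> p /=; first by move=> h [q _ qp]; rewrite -qp in h; exact: globSD_not_int h.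
by move=> h; apply: contrapT => /cell_intNE[q e]; apply: h; exists q.
Qed.

Lemma globSD_inj n : injective (GlobSD n).
Proof. exact/globe_map_inj/sphere_disk_inj. Qed.

Lemma globSD_pt n (z : sphereT R n) (t : I) :
  GlobSD n (globe_pt z t) = globe_pt (sphere_disk z) t.
Proof. exact: globe_map_pt. Qed.

Lemma cell_int_pt n (z : diskT R n) (t : I) :
  cell_int (globe_pt z t) <-> inner z /\ 0 < val t < 1.
Proof.
have [[-> ->]|[-> ->]|[u [<- ->]]] := globe_ptP z t.
- by split=> // -[_]; rewrite ltxx.
- by split=> // -[_]; rewrite ltxx andbF.
- by split=> [|[]//] h; split=> //; exact: opn01P.
Qed.

Lemma expath_globe_pt (Z : topologicalType) (hZ : hausdorff_space Z) (z : Z) :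
  @expath R dH (Glob R dH hZ) (globe_pt z).
Proof. by exists z, idfun; split=> //; exact: reparam_id. Qed.

Section Bump.
Variables (n : nat) (w : diskT R n -> I -> R).
Hypothesis w01 : forall z t, 0 <= w z t <= 1.
Hypothesis cw : continuous (fun p : diskT R n * I => w p.1 p.2).

Let bump_real (p : globe R (diskT R n)) : R :=
  if p is inr (z, u) then (1 - sqnorm (val z)) * (val u * (1 - val u)) * w z (clamp (val u))
  else 0.

Let bump_real_pt z (t : I) : bump_real (globe_pt z t) =
  (1 - sqnorm (val z)) * (val t * (1 - val t)) * w z t.
Proof.
have [[e ->]|[e ->]|[u [e ->]]] := globe_ptP z t; rewrite /bump_real.
- by rewrite e mul0r mulr0 mul0r.
- by rewrite e subrr mulr0 mulr0 mul0r.
- by rewrite e valcK.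
Qed.

(* Vanishing on the globe of the sphere, it extends by [0] to any space obtained
   by attaching the cell: such functions separate the points of the cell there. *)
Definition bump (p : globe R (diskT R n)) : I := clamp (bump_real p).

Lemma bump_continuous : continuous bump.
Proof.
apply/continuousP => U oU; rewrite globe_openE; apply: open_delta_open.
have -> : [set p : diskT R n * I | (bump @^-1` U) (globe_pt p.1 p.2)] =
    (fun p => clamp ((1 - sqnorm (val p.1)) * (val p.2 * (1 - val p.2)) * w p.1 p.2)) @^-1` U.
  by apply/seteqP; split=> p; rewrite /preimage /mkset /bump bump_real_pt.
have c1 : continuous (fun p : diskT R n * I => sqnorm (val p.1)).
  apply: (continuous_fcomp (f := fst) (g := fun z : diskT R n => sqnorm (val z))).
    by move=> p; exact: cvg_fst.
  exact: (continuous_fcomp (@continuous_setval _ _) (@sqnorm_continuous _ _)).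
have c2 : continuous (fun p : diskT R n * I => val p.2).
  by apply: (continuous_fcomp (f := snd)) itv_val_continuous => p; exact: cvg_snd.
have c : continuous (fun p : diskT R n * I =>
    (1 - sqnorm (val p.1)) * (val p.2 * (1 - val p.2)) * w p.1 p.2).
  apply: contM cw; apply: contM; first by apply: contD; [exact: cont_cst|exact: contN].
  by apply: contM => //; apply: contD; [exact: cont_cst|exact: contN].
by have /continuousP := continuous_fcomp c (@clamp_continuous R); apply.
Qed.

Lemma bump_sphere q : bump (GlobSD n q) = i0.
Proof.
case: q => [b|[y u]] //; rewrite /bump /=.
by rewrite sphere_sqnorm subrr !mul0r.
Qed.

Lemma bumpE z u : inner z -> val (bump (inr (z, u))) =
  (1 - sqnorm (val z)) * (val u * (1 - val u)) * w z (clamp (val u)).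
Proof.
move=> iz; rewrite /bump clampK //=; have /andP[u0 u1] := opn01P u.
have := sqnorm_ge0 (val z); have := w01 z (clamp (val u)); move: iz; rewrite /inner.
set a := sqnorm _; set b := w _ _ => iz /andP[b0 b1] a0.
have h1 : 0 <= 1 - a <= 1 by lra.
have h2 : 0 <= val u * (1 - val u) <= 1 by nra.
have h3 : 0 <= (1 - a) * (val u * (1 - val u)) <= 1 by nra.
move: h3; set d := (1 - a) * _ => /andP[d0 d1].
by rewrite mulr_ge0 //= mulr_ile1.
Qed.

End Bump.

(** The weight 1 equates the common factors of the two bump values; these do not vanish and cancel,
    so every weight takes the same value at both points. The weights [t] and [(1 + z_i) / 2] recover
    the time and the coordinates. *)
Lemma bump_separates n (p q : GlobD n) : cell_int p -> cell_int q ->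
  (forall B : GlobD n -> I, continuous B -> (forall x, B (GlobSD n x) = i0) -> B p = B q) ->
  p = q.
Proof.
case: p => [//|[z u]]; case: q => [//|[z' u']] /= iz iz' h.
have sep (w : diskT R n -> I -> R) : (forall z t, 0 <= w z t <= 1) -> continuous (fun p : diskT R n * I => w p.1 p.2) ->
    val (bump w (inr (z, u))) = val (bump w (inr (z', u'))) :> R.
  by move=> w01 cw; rewrite h //; [exact: bump_continuous|exact: bump_sphere].
pose D (v : R) (y : diskT R n) : R := (1 - sqnorm (val y)) * (v * (1 - v)).
have D0 (v : opn01) y : inner y -> D (val v) y != 0.
  move=> iy; have /andP[v0 v1] := opn01P v; rewrite /D !mulf_neq0 // gt_eqF // ?subr_gt0 //.
have c2 : continuous (fun p : diskT R n * I => val p.2).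
  by apply: (continuous_fcomp (f := snd)) itv_val_continuous => p; exact: cvg_snd.
have e1 : D (val u) z = D (val u') z'.
  have := sep (fun _ _ => 1); rewrite !bumpE ?mulr1 //; last first.
  - by move=> _ _; rewrite ler01 lexx.
  - by move=> _ _; rewrite ler01 lexx.
  by apply; [move=> _ _; rewrite ler01 lexx|exact: cont_cst].
have w_eq (w : diskT R n -> I -> R) : (forall z t, 0 <= w z t <= 1) -> continuous (fun p : diskT R n * I => w p.1 p.2) ->
    w z (clamp (val u)) = w z' (clamp (val u')) :> R.
  move=> w01 cw; have := sep w w01 cw; rewrite !bumpE // -!/(D _ _) e1.
  by move/(mulfI (D0 u' z' iz')).
have eu : val u = val u'.
  have /andP[u0 u1] := opn01P u; have /andP[u0' u1'] := opn01P u'.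
  have := w_eq (fun _ t => val t); rewrite !clampK ?(ltW u0) ?(ltW u1) ?(ltW u0') ?(ltW u1') //.
  by apply=> // _ t; exact: val_itv01.
have ez : z = z'.
  apply: disk_ext => i; have := w_eq (fun y _ => (1 + val y 0 i) / 2); move=> /(_ _ _).
  have ci : continuous (fun p : diskT R n * I => (1 + val p.1 0 i) / 2).
    apply: contM; last exact: cont_cst.
    apply: contD; first exact: cont_cst.
    by apply: (continuous_fcomp (f := fst)) (@disk_coord_continuous _ _ i) => p; exact: cvg_fst.
  move=> /(_ _ ci) H; suff : (1 + val z 0 i) / 2 = (1 + val z' 0 i) / 2 by lra.
  by apply: H => y _; have := disk_coord_le1 y i; lra.
by rewrite ez; congr (inr (_, _)); exact: val_inj.
Qed.

Lemma bump_nonzero n (p : GlobD n) : cell_int p ->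
  exists B : GlobD n -> I, [/\ continuous B, forall x, B (GlobSD n x) = i0 & B p <> i0].
Proof.
case: p => [//|[z u]] /= iz; exists (bump (fun _ _ => 1)); split.
- by apply: bump_continuous; exact: cont_cst.
- exact: bump_sphere.
move=> /(congr1 val); rewrite bumpE //; last by move=> _ _; rewrite ler01 lexx.
have /andP[v0 v1] := opn01P u; rewrite val_i0 mulr1 => /eqP.
by rewrite gt_eqF // mulr_gt0 ?mulr_gt0 ?subr_gt0.
Qed.

Section Definition_.
Context {A X : mdspace} (i : mdhom A X) {K : Type} (lt : K -> K -> Prop).
Context {dim : K -> nat} (c : forall k, mdhom (GlobD (dim k)) X).

(** The set [S] limits the cells allowed: all of them for a whole space, the earlier ones for a
    boundary fibre. *)
Definition cell_paths (S : set K) : set (I -> X) :=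
  [set g | (exists q, expath q /\ g = i \o q) \/
           (exists k z, [/\ S k, inner z & g = c k \o globe_pt z])].

(* [X] is obtained from [A] by adding states and attaching the globular cells
   [c k] in the order of [k]. *)
Record relcell : Prop := RelCell {
  rc_wf : well_founded lt;
  rc_trans : forall j k l, lt j k -> lt k l -> lt j l;
  rc_total : forall j k, [\/ lt j k, j = k | lt k j];
  rc_inj : injective i;
  rc_reflect : forall a, states (i a) -> states a;
  rc_cover : forall x,
    [\/ exists a, x = i a, states x | exists k p, cell_int p /\ x = c k p];
  rc_not_base : forall k p a, cell_int p -> c k p <> i a;
  rc_not_state : forall k p, cell_int p -> ~ states (c k p);
  rc_cell_inj : forall k p p', cell_int p -> cell_int p' -> c k p = c k p' -> p = p';
  rc_disjoint : forall j k p p', cell_int p -> cell_int p' -> c j p = c k p' -> j = k;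
  rc_open : forall U, open (i @^-1` U) -> (forall k, open (c k @^-1` U)) -> open U;
  rc_attach : forall k U, open (i @^-1` U) -> (forall j, lt j k -> open (c j @^-1` U)) ->
    open ((c k \oM GlobSD (dim k)) @^-1` U);
  rc_expath : forall g, expath g -> gen (cell_paths setT) g;
  rc_attach_path : forall k (z : sphereT R (dim k)),
    gen (cell_paths [set j | lt j k]) (c k \o globe_pt (sphere_disk z)) }.

Lemma cell_pathsS (S S' : set K) : S `<=` S' -> cell_paths S `<=` cell_paths S'.
Proof. by move=> SS g [|[k [z [/SS ? ? ?]]]]; [left|right; exists k, z]. Qed.

End Definition_.

Definition from_empty (X : mdspace) : mdhom (mdset R dH void) X.
Proof.
apply: (@MDHom R dH (mdset R dH void) X (fun x : void => match x with end)) => //.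
Defined.

Lemma from_empty_open (X : mdspace) (U : set X) : open (from_empty X @^-1` U).
Proof. exact: discrete_open. Qed.

End RelativeCells.

(** * Extension of continuous functions as a lifting property *)

Section GlobeLifting.
Context {R : realType} {dH : bool}.
Local Notation I := (@itv01 R).

Lemma itv_delta_generated : delta_generated (R := R) I.
Proof.
move=> U dU; apply: (@delta_open_path R _ U idfun dU) => t; exact: cvg_id.
Qed.

Lemma itv_hausdorff : hausdorff_space I.
Proof.
rewrite open_hausdorff => x y xy.
have vxy : val x != val y by apply: contraNneq xy => /itv01_inj ->.
have := @Rhausdorff R; rewrite open_hausdorff => /(_ _ _ vxy).
move=> [[U V] /= [xU yV]] [oU oV UV].
have c : continuous (val : I -> R) := itv_val_continuous.
exists ((val : I -> R) @^-1` U, (val : I -> R) @^-1` V) => /=.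
  by split; apply/mem_set; exact: set_mem.
split; [by move/continuousP: c; apply|by move/continuousP: c; apply|].
by rewrite -preimage_setI (eqP UV) preimage_set0.
Qed.

Lemma itv_in_Top : in_Top (R := R) dH I.
Proof. exact: hausdorff_in_Top itv_delta_generated itv_hausdorff. Qed.

Definition itv_obj := all_paths_mdspace itv_in_Top.
Definition point_obj := all_paths_mdspace (@discrete_in_Top R dH unit).

Lemma point_hom_uniq (X : mdspace R dH) (f g : mdhom X point_obj) : f = g.
Proof. by apply: mdhom_ext => x; case: (f x); case: (g x). Qed.

Definition to_point (X : mdspace R dH) : mdhom X point_obj.
Proof.
apply: (@all_paths_hom R dH X _ (@discrete_in_Top R dH unit) (fun _ => tt)).
exact: cst_continuous.
Defined.

(** The extension theorem restated for [itv_obj], where morphisms are continuous functions; in this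
    form it is inherited by pushouts and transfinite colimits. *)
Lemma globSD_lifts n : has_lifting (GlobSD R dH n) (to_point itv_obj).
Proof.
move=> u v _; have [G cG GE] := @globe_sphere_extension R n u (@mdhom_continuous _ _ _ _ u).
exists (@all_paths_hom R dH (GlobD R dH n) _ itv_in_Top G cG); split.
  by apply: mdhom_ext => x; exact: GE.
exact: point_hom_uniq.
Qed.

Lemma lifting_pushout (A B C P X Y : mdspace R dH) (f : mdhom A B) (g : mdhom A C)
    (h : mdhom B P) (k : mdhom C P) (p : mdhom X Y) :
  is_pushout f g h k -> has_lifting g p -> has_lifting h p.
Proof.
move=> po; have [e univ] := po => lg u v pu.
have [|l [lE pl]] := lg (u \oM f) (v \oM k).
  by rewrite mdcompA pu -!mdcompA e.
have [|w [[wh wk] _]] := univ X u l; first by rewrite lE.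
exists w; split=> //; apply: (pushout_jointly_epi po).
  by rewrite -mdcompA wh.
by rewrite -mdcompA wk.
Qed.

End GlobeLifting.

(** * Cells in the colimit of a tower *)

Section DecompositionCells.
Context {R : realType} {dH : bool}.
Local Notation I := (@itv01 R).
Local Notation mdspace := (mdspace R dH).
Context {L : wellOrder} {T : tower R dH L}.
Hypothesis bot_discrete : forall U : set (T \bot%O), open U.
Hypothesis bot_states : @states R dH (T \bot%O) = setT.
Hypothesis bot_expath : @expath R dH (T \bot%O) = set0.
Variable cells : forall (u v : L) (h : is_succ u v), cell_attachment T h.
Implicit Types u v w : L.

(** Well-founded induction through the generation of pushouts and of limit stages. A boundary point
    or boundary fibre of the cell attached last is carried by the attaching map to the previous
    stage, where the induction hypothesis applies. *)
Lemma generated_stage w : (forall U, (open (tower_map T (le0x w) @^-1` U) ->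
   (forall a b (h : is_succ a b) (bw : (b <= w)%O),
      open ((tower_map T bw \oM cell_char (cells h)) @^-1` U)) -> open U)) /\
  [/\ forall x : T w, states x \/ exists a b (h : is_succ a b) (bw : (b <= w)%O) p,
      cell_int p /\ x = tower_map T bw (cell_char (cells h) p),
   forall x : T w, states x -> exists y, x = tower_map T (le0x w) y &
   forall g, @expath R dH (T w) g -> gen [set g | exists a b (h : is_succ a b) (bw : (b <= w)%O) z,
      inner z /\ g = tower_map T bw \o (cell_char (cells h) \o globe_pt z)] g].
Proof.
elim/(@wo_ind L): w => w IH.
have lift_open x (xw : (x <= w)%O) (U : set (T w)) : (x < w)%O ->
    open (tower_map T (le0x w) @^-1` U) ->
    (forall a b (h : is_succ a b) (bw : (b <= w)%O),
      open ((tower_map T bw \oM cell_char (cells h)) @^-1` U)) ->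
    open (tower_map T xw @^-1` U).
  move=> xlt o1 o2; apply: (IH x xlt).1.
    by rewrite -(tower_map_comp T (le0x x) xw) in o1.
  move=> a b h bx; have := o2 a b h (le_trans bx xw).
  by rewrite -(tower_map_comp T bx xw).
have lift_cover x (xw : (x <= w)%O) y : (x < w)%O ->
    states (tower_map T xw y) \/ exists a b (h : is_succ a b) (bw : (b <= w)%O) p,
      cell_int p /\ tower_map T xw y = tower_map T bw (cell_char (cells h) p).
  move=> xlt; have [/(_ y)[sy|[a [b [h [bx [p [ip ->]]]]]]] _ _] := (IH x xlt).2.
    by left; exact: mdhom_states.
  right; exists a, b, h, (le_trans bx xw), p; split=> //.
  exact: tower_mapC.
have lift_state x (xw : (x <= w)%O) y : (x < w)%O -> states y ->
    exists y0, tower_map T xw y = tower_map T (le0x w) y0.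
  move=> xlt; have [_ H _] := (IH x xlt).2; move=> /H[y0 ->]; exists y0.
  exact: tower_mapC.
have lift_path x (xw : (x <= w)%O) g : (x < w)%O -> expath g ->
    gen [set g | exists a b (h : is_succ a b) (bw : (b <= w)%O) z,
      inner z /\ g = tower_map T bw \o (cell_char (cells h) \o globe_pt z)]
      (tower_map T xw \o g).
  move=> xlt; have [_ _ H] := (IH x xlt).2; move=> /H.
  apply: gen_comp => _ [a [b [h [bx [z [iz ->]]]]]].
  apply: gen_base; exists a, b, h, (le_trans bx xw), z; split=> //.
  by apply/funext => t; exact: tower_mapC.
have [w0|w0] := eqVneq w \bot%O.
  subst w; split; [|split].
  - move=> U + _; rewrite tower_map_id; exact.
  - by move=> x; left; rewrite bot_states.
  - by move=> x _; exists x; rewrite tower_map_id.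
  - by move=> g; rewrite bot_expath.
have lt0w : (\bot%O < w)%O by rewrite lt_def w0 le0x.
have [[u uw]|lw] := succ_or_limit lt0w; last first.
  have [gp go gs gg] := partial_colimit_generated (limit_colimit T lw).
  split; [|split].
  - by move=> U o1 o2; apply: go => -[x xw]; apply: lift_open.
  - by move=> x; have [[y yw] [a ->]] := gp x; exact: lift_cover.
  - by move=> x /gs[[y yw] [a [sa ->]]]; exact: lift_state sa.
  - move=> g /gg; apply: gen_trans => _ [[y yw] [q [eq ->]]]; exact: lift_path.
have ww := lexx w.
have po := cell_pushout (cells uw); have [gp go gs gg] := pushout_generated po.
have attachE q : cell_char (cells uw) (GlobSD R dH _ q) =
    tower_map T (is_succ_le uw) (cell_attach (cells uw) q) := mdcompE (esym po.1) q.
split; [|split].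
- move=> U o1 o2; apply: go => -[|] /=; first by apply: lift_open => //; exact: uw.1.
  have := o2 _ _ uw ww; rewrite tower_map_id.
  by congr open.
- move=> x; have [[|] [y ->]] := gp x; first by apply: lift_cover; exact: uw.1.
  have [iy|/cell_intNE[q ->]] := pselect (cell_int y); last first.
    by rewrite /= attachE; apply: lift_cover; exact: uw.1.
  by right; exists u, w, uw, ww, y; rewrite tower_mapI.
- move=> x /gs[[|] [y [sy ->]]]; first by apply: lift_state sy; exact: uw.1.
  case: sy => b _ <-.
  have := attachE (globe_pole b) => /= ->.
  by apply: lift_state; [exact: uw.1|apply: mdhom_states; exists b].
- move=> g /gg; apply: gen_trans => _ [[|] [q [eq ->]]].
    by apply: lift_path => //; exact: uw.1.
  case: eq => z [phi [rphi ->]].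
  apply: (@gen_reparam R _ _ (cell_char (cells uw) \o globe_pt z) phi) => //.
  have [iz|[y ->]] := inner_or_sphere z.
    apply: gen_base; exists u, w, uw, ww, z; split=> //.
    by apply/funext => t; rewrite /= tower_mapI.
  have -> : cell_char (cells uw) \o globe_pt (sphere_disk y) =
      tower_map T (is_succ_le uw) \o (cell_attach (cells uw) \o globe_pt y).
    by apply/funext => t; rewrite /= -attachE globSD_pt.
  apply: lift_path; first exact: uw.1.
  exact/(mdhom_expath (cell_attach (cells uw)))/expath_globe_pt.
Qed.

Section Colimit.
Context {S : set L} {P : mdspace} {k : forall u, S u -> mdhom (T u) P}.
Hypothesis S_down : forall u v, (u <= v)%O -> S v -> S u.
Hypothesis pc : partial_colimit k.

Lemma extend_to_colimit u (hu : S u) (phi : T u -> I) : continuous phi ->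
  exists2 Phi : P -> I, continuous Phi & forall x, Phi (k hu x) = phi x.
Proof.
move=> cphi.
have [||h [hE _]] := @transfinite_lift R dH L T S P k S_down pc itv_obj point_obj
  (to_point _) _ u hu (all_paths_hom itv_in_Top cphi) (to_point P).
- move=> a b h _; apply: lifting_pushout (cell_pushout (cells h)) _.
  exact: globSD_lifts.
- exact: point_hom_uniq.
exists h; first exact: (@mdhom_continuous _ _ _ _ h).
by move=> x; rewrite (mdcompE hE).
Qed.

(** The universal property of the pushout glues the bump to the zero function on stage [u]; the
    result is extended along the rest of the tower. *)
Lemma extend_bump u v (h : is_succ u v) (hv : S v) (hu : S u) (B : GlobD R dH _ -> I) :
  continuous B -> (forall x, B (GlobSD R dH _ x) = i0) ->
  exists Phi : P -> I, (forall x, Phi (k hu x) = i0) /\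
    (forall p, Phi (k hv (cell_char (cells h) p)) = B p).
Proof.
move=> cB B0; have [e univ] := cell_pushout (cells h).
have c0 : continuous (fun _ : T u => @i0 R) by exact: cst_continuous.
have [|w [[w1 w2] _]] := univ itv_obj (all_paths_hom itv_in_Top c0) (all_paths_hom itv_in_Top cB).
  by apply: mdhom_ext => x; rewrite /= B0.
have [Phi cPhi PhiE] := extend_to_colimit hv (@mdhom_continuous _ _ _ _ w).
exists Phi; split=> [x|p].
  by rewrite -(pc.1 u v (is_succ_le h) hu hv) /= PhiE (mdcompE w1).
by rewrite PhiE (mdcompE w2).
Qed.

(** The index of a cell attached within [S]: a successor step whose upper end is in [S]. *)
Record succ_pair := SuccPair {
  pair_lo : L; pair_hi : L;
  pair_succ : is_succ pair_lo pair_hi;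
  pair_in : S pair_hi }.

Definition pair_cell (q : succ_pair) : cell_attachment T (pair_succ q) :=
  cells (pair_succ q).

Definition pair_char (q : succ_pair) : mdhom (GlobD R dH (cell_dim (pair_cell q))) P :=
  k (pair_in q) \oM cell_char (pair_cell q).

Definition pair_lt (q q' : succ_pair) := (pair_lo q < pair_lo q')%O.

Lemma pair_eq (q q' : succ_pair) : pair_lo q = pair_lo q' -> q = q'.
Proof.
case: q q' => [a b h hb] [a' b' h' hb'] /= e; subst a'.
have e : b = b' := succ_uniq h h'; subst b'.
by rewrite (Prop_irrelevance h h') (Prop_irrelevance hb hb').
Qed.

Lemma colimit_relcell : relcell (from_empty P) pair_lt pair_char.
Proof.
have kM u v (uv : (u <= v)%O) (hv : S v) x : k (S_down uv hv) x = k hv (tower_map T uv x).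
  by rewrite -(pc.1 u v uv (S_down uv hv) hv).
have k_irr u (h h' : S u) : k h = k h' by congr k; exact: Prop_irrelevance.
have [gp go gs gg] := partial_colimit_generated pc.
have charE u (hu : S u) a b (h : is_succ a b) (bu : (b <= u)%O) p :
    k hu (tower_map T bu (cell_char (cells h) p)) =
    k (S_down bu hu) (cell_char (cells h) p) by rewrite kM.
pose mkq a b (h : is_succ a b) (hb : S b) : succ_pair :=
  SuccPair h hb.
(* A bump that does not vanish at [p] extends to a function that is zero on the whole stage
   [pair_lo q], so the point comes neither from there nor from below. *)
have not_early (q : succ_pair) p a (ha : S a) (y : T a) :
    cell_int p -> (a <= pair_lo q)%O -> pair_char q p <> k ha y.
  case: q p => [u v h hv] p ip /= au E.
  have [B [cB B0 Bp]] := bump_nonzero (dH := dH) ip.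
  have hu := S_down (is_succ_le h) hv.
  have [Phi [Phi0 PhiB]] := extend_bump hv hu cB B0.
  have E' : k hv (cell_char (cells h) p) = k ha y := E.
  apply: Bp; rewrite -PhiB E'.
  by rewrite (k_irr a ha (S_down au hu)) kM Phi0.
split.
- move=> q; move: {2}(pair_lo q) (erefl (pair_lo q)) => a.
  elim/(@wo_ind L): a q => a IH q qa; constructor => r rq.
  by apply: (IH (pair_lo r)) => //; rewrite -qa.
- by move=> x y z; exact: lt_trans.
- move=> x y; rewrite /pair_lt; case: (ltgtP (pair_lo x) (pair_lo y)) => [h|h|/pair_eq h].
  + by constructor 1.
  + by constructor 3.
  + by constructor 2.
- by case.
- by case.
- move=> x; have [[u hu] [y ->]] := gp x.
  have [/(_ y)[sy|[a [b [h [bu [p [ip ->]]]]]]] _ _] := (generated_stage u).2.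
    by constructor 2; exact: mdhom_states.
  constructor 3; exists (mkq a b h (S_down bu hu)), p; split=> //.
- by move=> q p [].
- move=> q p ip /gs[[u hu] [y [sy e]]].
  have [_ /(_ y sy)[y0 y0E] _] := (generated_stage u).2; subst y.
  have h0 : S \bot%O := S_down (le0x u) hu.
  apply: (not_early q p \bot%O h0 y0 ip); first exact: le0x.
  by rewrite e /= -kM (k_irr _ _ h0).
- move=> q p p' ip ip' E; apply: (bump_separates (dH := dH) ip ip') => B cB B0.
  case: q p p' ip ip' E B cB B0 => [u v h hv] p p' ip ip' E B cB B0.
  have hu := S_down (is_succ_le h) hv.
  have [Phi [_ PhiB]] := extend_bump hv hu cB B0.
  have E' : k hv (cell_char (cells h) p) = k hv (cell_char (cells h) p') := E.
  by rewrite -!PhiB E'.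
- move=> q r p p' ip ip' E.
  have key (q1 q2 : succ_pair) p1 p2 : cell_int p1 -> pair_char q1 p1 = pair_char q2 p2 ->
      ~ (pair_lo q2 < pair_lo q1)%O.
    move=> ip1 E1 l; apply: (not_early q1 p1 _ (pair_in q2) _ ip1 _ E1).
    by have [_] := pair_succ q2; exact.
  apply: pair_eq; case: (ltgtP (pair_lo q) (pair_lo r)) => // l.
    by case: (key r q p' p ip' (esym E) l).
  by case: (key q r p p' ip E l).
- move=> U _ oU; apply: go => -[u hu]; apply: (generated_stage u).1.
    exact: bot_discrete.
  move=> a b h bu; have := oU (mkq a b h (S_down bu hu)); congr open.
  by apply/seteqP; split=> p /=; rewrite charE.
- case=> [u v h hv] U _ oU.
  have hu := S_down (is_succ_le h) hv.
  have o : open (k hu @^-1` U).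
    apply: (generated_stage u).1; first exact: bot_discrete.
    move=> a b h' bu; have := oU (mkq a b h' (S_down bu hu)) (lt_le_trans h'.1 bu).
    by congr open; apply/seteqP; split=> p /=; rewrite charE.
  have := proj1 (continuousP _) (@mdhom_continuous _ _ _ _ (cell_attach (cells h))) _ o.
  congr open; apply/seteqP; split=> p /=;
    rewrite (mdcompE (esym (cell_pushout (cells h)).1)) /= -(pc.1 u v (is_succ_le h) hu hv) //.
- move=> g /gg; apply: gen_trans => _ [[u hu] [q [eq ->]]].
  have [_ _ /(_ q eq)] := (generated_stage u).2.
  apply: gen_comp => _ [a [b [h [bu [z [iz ->]]]]]].
  apply: gen_base; right; exists (mkq a b h (S_down bu hu)), z; split=> //.
  by apply/funext => t; exact: charE.
- case=> [u v h hv] z.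
  have hu := S_down (is_succ_le h) hv.
  have -> : pair_char (mkq u v h hv) \o globe_pt (sphere_disk z) =
      k hu \o (cell_attach (cells h) \o globe_pt z).
    apply/funext => t /=; rewrite -globSD_pt (mdcompE (esym (cell_pushout (cells h)).1)) /=.
    by rewrite -(pc.1 u v (is_succ_le h) hu hv).
  have eq := mdhom_expath (cell_attach (cells h)) (expath_globe_pt (rV_hausdorff (A := _)) z).
  have [_ _ /(_ _ eq)] := (generated_stage u).2.
  apply: gen_comp => _ [a [b [h' [bu [y [iy ->]]]]]].
  apply: gen_base; right; exists (mkq a b h' (S_down bu hu)), y; split=> //.
    exact: lt_le_trans h'.1 bu.
  by apply/funext => t; exact: charE.
Qed.

End Colimit.

End DecompositionCells.

(** * From cell structures to towers *)

Section TopOrder.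
Context {K : Type} {lt : K -> K -> Prop}.
Context (wf : well_founded lt) (tr : forall j k l, lt j k -> lt k l -> lt j l).
Context (tot : forall j k, [\/ lt j k, j = k | lt k j]).

(* The ordinal [K + 1]; the hypotheses are arguments so that the order
   structure below can be inferred from the type. *)
Definition ktop : Type := let _ := (wf, tr, tot) in option K.

HB.instance Definition _ := gen_eqMixin ktop.
HB.instance Definition _ := gen_choiceMixin ktop.

Definition kcell (k : K) : ktop := Some k.
Definition kend : ktop := None.

Definition ktop_lt (x y : ktop) : bool :=
  match x, y with
  | Some j, Some k => `[< lt j k >]
  | Some _, None => true
  | None, _ => false
  end.

Lemma lt_irrefl k : ~ lt k k.
Proof. by move=> h; elim: k / (wf k) h => k _ IH h; exact: (IH k h h). Qed.

Lemma ktop_lt_irr : irreflexive ktop_lt.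
Proof. by case=> [k|] //=; apply/asboolP; exact: lt_irrefl. Qed.

Lemma ktop_lt_trans : transitive ktop_lt.
Proof.
case=> [k|] [j|] [l|] //= /asboolP h /asboolP h'; apply/asboolP; exact: tr h'.
Qed.

Lemma ktop_disp : Order.disp_t.
Proof. exact: (Order.Disp tt tt). Qed.

HB.instance Definition _ :=
  Order.Lt_isPOrder.Build ktop_disp ktop ktop_lt_irr ktop_lt_trans.

Lemma ktop_ltE (x y : ktop) : (x < y)%O = ktop_lt x y.
Proof. by []. Qed.

Lemma ktop_total : total (<=%O : rel ktop).
Proof.
move=> x y; rewrite !le_eqVlt !ktop_ltE; case: x y => [j|] [k|] /=; rewrite ?eqxx ?orbT //.
have [h|->|h] := tot j k; rewrite ?eqxx //.
  by rewrite (asboolT h) orbT.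
by rewrite (asboolT h) !orbT.
Qed.

HB.instance Definition _ := Order.POrder_isTotal.Build ktop_disp ktop ktop_total.

Lemma ktop_wf : well_founded (fun x y : ktop => (x < y)%O).
Proof.
have acc k : Acc (fun x y : ktop => (x < y)%O) (kcell k).
  apply: (@well_founded_ind K lt wf (fun k => Acc (fun x y : ktop => (x < y)%O) (kcell k))) => {}k IH.
  apply: Acc_intro => y; rewrite ktop_ltE; case: y => [j h|//].
  exact: IH (asboolW h).
case=> [k|]; first exact: acc.
by apply: Acc_intro => y; rewrite ktop_ltE; case: y => [j _|//]; exact: acc.
Qed.

Lemma ktop_bottom : exists b : ktop, forall x, (b <= x)%O.
Proof.
have [[k]|h] := pselect (inhabited K); last first.
  by exists kend => -[k|//]; case: h.
suff [m mP] : exists m, forall j, ~ lt j m.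
  exists (kcell m) => -[j|]; rewrite le_eqVlt ktop_ltE /=; last by rewrite orbT.
  have [h|->|/mP//] := tot m j; last by rewrite eqxx.
  by rewrite (asboolT h) orbT.
elim: k / (wf k) => k _ IH.
have [[j /IH//]|h] := pselect (exists j, lt j k).
by exists k => j jk; apply: h; exists j.
Qed.

HB.instance Definition _ :=
  Order.hasBottom.Build ktop_disp ktop (projT2 (cid ktop_bottom)).

Definition ktop_wo : wellOrder := @WellOrder ktop_disp ktop ktop_wf.

End TopOrder.

Section DiscreteHom.
Context {R : realType} {dH : bool} {S : choiceType} {X : mdspace R dH}.

Definition discrete_hom (f : S -> X) (hf : forall s, states (f s)) :
  mdhom (mdset R dH S) X.
Proof.
by apply: (@MDHom R dH (mdset R dH S) X f) => //; apply/continuousP => U _; exact: discrete_open.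
Defined.

End DiscreteHom.

Section Stages.
Context {R : realType} {dH : bool}.
Local Notation I := (@itv01 R).
Local Notation mdspace := (mdspace R dH).
Local Notation GlobD := (GlobD R dH).
Local Notation GlobS := (GlobS R dH).
Local Notation GlobSD := (GlobSD R dH).
Context {A X : mdspace} {i : mdhom A X} {K : Type} {lt : K -> K -> Prop}.
Context {dim : K -> nat} {c : forall k, mdhom (GlobD (dim k)) X}.
Hypothesis rc : relcell i lt c.

Let L : wellOrder := ktop_wo (rc_wf rc) (rc_trans rc) (rc_total rc).
Let cell (k : K) : L := @kcell K lt (rc_wf rc) (rc_trans rc) (rc_total rc) k.

Lemma cell_ltP j k : reflect (lt j k) (cell j < cell k)%O.
Proof. exact: asboolP. Qed.

Lemma cell_lt_inj j k : cell j = cell k -> j = k.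
Proof. by case. Qed.

(** Stage [v] consists of [A], of all states of [X] at once and of the cells before [v]; passing to
    a successor thus attaches exactly one cell. *)
Inductive stage_ix (v : L) : Type :=
| ix_base
| ix_state
| ix_cell (j : K) of (cell j < v)%O.
Arguments ix_base {v}.
Arguments ix_state {v}.

Definition stage_obj v (x : stage_ix v) : mdspace :=
  match x with
  | ix_base => A
  | ix_state => mdset R dH (set_type (@states R dH X))
  | ix_cell j _ => GlobD (dim j)
  end.

Definition mk_state (x : X) (sx : states x) : set_type (@states R dH X) :=
  exist (fun y => y \in @states R dH X) x (mem_set sx).

Definition state_incl : mdhom (mdset R dH (set_type (@states R dH X))) X :=
  discrete_hom (fun s : set_type (@states R dH X) => set_mem (valP s)).

Definition stage_fam v (x : stage_ix v) : mdhom (stage_obj x) X :=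
  match x return mdhom (stage_obj x) X with
  | ix_base => i
  | ix_state => state_incl
  | ix_cell j _ => c j
  end.

Definition stage (v : L) : mdspace := md_image (@stage_fam v).

Definition stage_incl v : mdhom (stage v) X := image_incl (@stage_fam v).

Lemma stage_incl_inj v : injective (stage_incl v).
Proof. exact: image_incl_inj. Qed.

Definition stage_mem v (x : X) := exists y : stage v, stage_incl v y = x.

Definition base_leg v : mdhom A (stage v) := image_leg (@stage_fam v) ix_base.
Definition state_leg v : mdhom (mdset R dH (set_type (@states R dH X))) (stage v) :=
  image_leg (@stage_fam v) ix_state.
Definition cell_leg v j (h : (cell j < v)%O) : mdhom (GlobD (dim j)) (stage v) :=
  image_leg (@stage_fam v) (ix_cell h).

Lemma base_legE v a : stage_incl v (base_leg v a) = i a.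
Proof. by []. Qed.

Lemma cell_legE v j (h : (cell j < v)%O) p : stage_incl v (cell_leg h p) = c j p.
Proof. by []. Qed.

Lemma stage_casesL v (P : stage v -> Prop) : (forall a, P (base_leg v a)) ->
  (forall s, P (state_leg v s)) -> (forall j (h : (cell j < v)%O) p, P (cell_leg h p)) ->
  forall x, P x.
Proof.
by move=> Pb Ps Pc x; have [[||j h] [a ->]] := image_inP x; [exact: Pb|exact: Ps|exact: Pc].
Qed.

Lemma stage_states v (x : stage v) : states (stage_incl v x) -> states x.
Proof.
move=> sx; exists ix_state, (mk_state sx).
by split=> //; apply: (@stage_incl_inj v).
Qed.

Lemma stage_open v (U : set (stage v)) : open (base_leg v @^-1` U) ->
  (forall j (h : (cell j < v)%O), open (cell_leg h @^-1` U)) -> open U.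
Proof.
move=> ob oc; rewrite image_openE => -[||j h]; [exact: ob|exact: discrete_open|exact: oc].
Qed.

Lemma stage_expath v g : gen (cell_paths i c [set j | (cell j < v)%O]) (stage_incl v \o g) ->
  @expath R dH (stage v) g.
Proof.
move=> /(gen_lift (@stage_incl_inj v)); apply: gen_sub => p [[q [eq e]]|[j [z [jv _ e]]]].
  exists ix_base, q; split=> //.
  by apply/funext => t; apply: (@stage_incl_inj v); exact: (congr1 (@^~ t) e).
exists (ix_cell jv), (globe_pt z); split; first exact: expath_globe_pt.
by apply/funext => t; apply: (@stage_incl_inj v); exact: (congr1 (@^~ t) e).
Qed.

Section StageDescent.
Context {v : L} {W : mdspace} {w : stage v -> W}.
Hypothesis wb : exists h : mdhom A W, forall a, w (base_leg v a) = h a.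
Hypothesis ws : forall x, states x -> states (w x).
Hypothesis wc : forall j (h : (cell j < v)%O), exists f : mdhom (GlobD (dim j)) W,
  forall p, w (cell_leg h p) = f p.

Definition stage_desc : mdhom (stage v) W.
Proof.
apply: (@image_desc _ _ _ _ _ (@stage_fam v) W w) => -[||j h]; [exact: wb| |exact: wc].
have hs (s : set_type (@states R dH X)) : states (w (state_leg v s)).
  by apply: ws; exists ix_state, s.
by exists (discrete_hom hs).
Defined.

Lemma stage_descE x : stage_desc x = w x.
Proof. by []. Qed.

End StageDescent.

Lemma stage_memS u v x : (u <= v)%O -> stage_mem u x -> stage_mem v x.
Proof.
move=> uv [y <-]; elim/(@stage_casesL u): y => [a|s|j h p].
- by exists (base_leg v a).
- by exists (state_leg v s).
- by exists (cell_leg (lt_le_trans h uv) p).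
Qed.

Definition stage_fun u v (uv : (u <= v)%O) (x : stage u) : stage v :=
  projT1 (cid (stage_memS uv (ex_intro _ x erefl : stage_mem u (stage_incl u x)))).

Lemma stage_funE u v (uv : (u <= v)%O) x : stage_incl v (stage_fun uv x) = stage_incl u x.
Proof. by rewrite /stage_fun; case: cid. Qed.

Definition stage_map u v (uv : (u <= v)%O) : mdhom (stage u) (stage v).
Proof.
apply: (@stage_desc u (stage v) (stage_fun uv)).
- exists (base_leg v) => a; apply: (@stage_incl_inj v); rewrite stage_funE.
  by rewrite base_legE.
- move=> x sx; apply: stage_states; rewrite stage_funE.
  exact: (mdhom_states (stage_incl u) sx).
- move=> j h; exists (cell_leg (lt_le_trans h uv)) => p.
  by apply: (@stage_incl_inj v); rewrite stage_funE !cell_legE.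
Defined.

Lemma stage_mapE u v (uv : (u <= v)%O) x :
  stage_incl v (stage_map uv x) = stage_incl u x.
Proof. exact: stage_funE. Qed.

Lemma stage_map_incl u v (uv : (u <= v)%O) : stage_incl v \oM stage_map uv = stage_incl u.
Proof. by apply: mdhom_ext => x; exact: stage_mapE. Qed.

(** Poles are states. Any other boundary point of a cell lies on a boundary fibre, which by
    [rc_attach_path] passes only through [A] and earlier cells; well-founded induction ends in an
    open cell. *)
Lemma stage_point v x : stage_mem v x -> [\/ exists a, x = i a, states x |
  exists j p, [/\ (cell j < v)%O, cell_int p & x = c j p]].
Proof.
elim/(@wo_ind L): v x => v IH x [y <-]; elim/(@stage_casesL v): y => [a|s|j h p].
- by constructor 1; exists a.
- by constructor 2; exact: (set_mem (valP s)).
rewrite cell_legE; have [ip|/cell_intNE[q ->]] := pselect (cell_int p).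
  by constructor 3; exists j, p.
have mem : stage_mem (cell j) (c j (GlobSD _ q)).
  case: q => [b|[y u]].
    have sb : states (c j (globe_pole b)) by apply: mdhom_states; exists b.
    by exists (state_leg _ (mk_state sb)).
  have [g [s [[[r [er ->]]|[k [z [kj _ ->]]]]]]] :=
      gen_point (clamp (val u)) (rc_attach_path rc y).
    rewrite /= -globSD_pt -globe_inr => ->.
    by exists (base_leg _ (r s)).
  rewrite /= -globSD_pt -globe_inr => ->.
  have kj' : (cell k < cell j)%O by apply/cell_ltP.
  by exists (cell_leg kj' (globe_pt z s)).
have [[a e]|sx|[k [r [kj ir e]]]] := IH _ h _ mem.
- by constructor 1; exists a.
- by constructor 2.
- by constructor 3; exists k, r; split=> //; exact: lt_trans h.
Qed.

Lemma attach_mem k (q : GlobS (dim k)) : stage_mem (cell k) (c k (GlobSD _ q)).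
Proof.
case: q => [b|[y u]].
  have sb : states (c k (globe_pole b)) by apply: mdhom_states; exists b.
  by exists (state_leg _ (mk_state sb)).
have [g [s [[[r [er ->]]|[j [z [jk _ ->]]]]]]] :=
    gen_point (clamp (val u)) (rc_attach_path rc y).
  rewrite /= -globSD_pt -globe_inr => ->.
  by exists (base_leg _ (r s)).
rewrite /= -globSD_pt -globe_inr => ->.
have jk' : (cell j < cell k)%O by apply/cell_ltP.
by exists (cell_leg jk' (globe_pt z s)).
Qed.

Definition attach_fun k (q : GlobS (dim k)) : stage (cell k) := projT1 (cid (attach_mem q)).

Lemma attach_funE k (q : GlobS (dim k)) :
  stage_incl (cell k) (attach_fun q) = c k (GlobSD _ q).
Proof. by rewrite /attach_fun; case: cid. Qed.

(** An open set of the stage need not be the trace of an open set of [X]. Its image in [X] still has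
    open traces on [A] and on the earlier cells, and [rc_attach] is stated in terms of these traces,
    which gives continuity. *)
Definition attach k : mdhom (GlobS (dim k)) (stage (cell k)).
Proof.
apply: (@MDHom R dH (GlobS (dim k)) (stage (cell k)) (@attach_fun k)).
- apply/continuousP => U oU.
  have oU' j := (oU : image_open _) j.
  have -> : @attach_fun k @^-1` U =
      (c k \oM GlobSD _) @^-1` (stage_incl (cell k) @` U).
    apply/seteqP; split=> q /=; first by move=> Uq; exists (attach_fun q) => //; exact: attach_funE.
    by move=> [y Uy]; rewrite -attach_funE => /(@stage_incl_inj _) <-.
  have pre (T : mdspace) (f : mdhom T (stage (cell k))) (g : mdhom T X) :
      stage_incl (cell k) \oM f = g -> g @^-1` (stage_incl (cell k) @` U) = f @^-1` U.
    move=> fg; apply/seteqP; split=> x /=; rewrite -(mdcompE fg).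
      by move=> [y Uy /(@stage_incl_inj _) <-].
    by move=> Ux; exists (f x).
  apply: (rc_attach rc).
    by rewrite (pre _ (base_leg (cell k))); [exact: (oU' ix_base)|apply: mdhom_ext].
  move=> j jk; have jk' : (cell j < cell k)%O by apply/cell_ltP.
  by rewrite (pre _ (cell_leg jk')); [exact: (oU' (ix_cell jk'))|apply: mdhom_ext].
- move=> q sq; apply: stage_states; rewrite attach_funE; apply: mdhom_states.
  exact: mdhom_states.
- move=> _ [z [phi [rphi ->]]].
  apply: (@expath_reparam _ _ (stage (cell k)) (@attach_fun k \o globe_pt z)) => //.
  apply: stage_expath; have -> : stage_incl (cell k) \o (@attach_fun k \o globe_pt z) =
      c k \o globe_pt (sphere_disk z).
    apply/funext => t.
    by rewrite -[LHS]/(stage_incl _ (attach_fun (globe_pt z t))) attach_funE globSD_pt.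
  apply: gen_sub (rc_attach_path rc z); apply: cell_pathsS => j jk.
  by apply/cell_ltP.
Defined.

Lemma attachE k q : stage_incl (cell k) (attach k q) = c k (GlobSD _ q).
Proof. exact: attach_funE. Qed.

Lemma stage_pushout k (v : L) (h : is_succ (cell k) v) :
  is_pushout (attach k) (GlobSD _) (stage_map (ltW h.1)) (cell_leg h.1).
Proof.
split.
  by apply: mdhom_ext => q; apply: (@stage_incl_inj v); rewrite stage_mapE attachE.
move=> W a b ab.
(* Two candidate values, through the stage of [k] and through the new cell. They can compete only on
   the boundary of the cell, where the square commutes, since the interior of the cell does not meet
   that stage. *)
have fact (x : stage v) : exists y : W, (forall x', stage_incl (cell k) x' = stage_incl v x -> y = a x') /\
    (forall p, c k p = stage_incl v x -> y = b p).
  have [[x' x'E]|nm] := pselect (stage_mem (cell k) (stage_incl v x)).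
    exists (a x'); split=> [x''|p pE]; first by rewrite -x'E => /(@stage_incl_inj _) ->.
    have [ip|/cell_intNE[q qE]] := pselect (cell_int p).
      have [] := @stage_point (cell k) (c k p); first by exists x'; rewrite x'E pE.
      - by move=> [a' e]; case: (rc_not_base rc ip e).
      - by move/(rc_not_state rc ip).
      - move=> [j [p' [/cell_ltP jk ip' e]]].
        have kj := rc_disjoint rc ip ip' e; subst j.
        by case: (lt_irrefl (rc_wf rc) jk).
    rewrite qE -[RHS]/((b \oM GlobSD _) q) -ab /=; congr (a _).
    by apply: (@stage_incl_inj (cell k)); rewrite x'E attachE -qE pE.
  have [p pE] : exists p, c k p = stage_incl v x.
    elim/(@stage_casesL v): x nm => [a'|s|j jv p] nm.
    - by case: nm; exists (base_leg _ a').
    - by case: nm; exists (state_leg _ s).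
    have := lt_succ h jv; rewrite le_eqVlt => /orP[/eqP/cell_lt_inj e|jk].
      by subst j; exists p.
    by case: nm; exists (cell_leg jk p).
  exists (b p); split=> [x' x'E|p' p'E]; first by case: nm; exists x'.
  suff <- : p = p' by [].
  have int r : c k r = stage_incl v x -> cell_int r.
    move=> rE; apply: contrapT => /cell_intNE[q qE]; apply: nm.
    by rewrite -rE qE; exact: attach_mem.
  by apply: (rc_cell_inj rc (int _ pE) (int _ p'E)); rewrite pE.
have [w wP] := choice fact.
have wa x : w (stage_map (ltW h.1) x) = a x by apply: (wP _).1; rewrite stage_mapE.
have wb p : w (cell_leg h.1 p) = b p by apply: (wP _).2.
have hb : exists h : mdhom A W, forall a', w (base_leg v a') = h a'.
  exists (a \oM base_leg (cell k)) => a'; apply: (wP _).1.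
  by rewrite base_legE.
have hs x : states x -> states (w x).
  move=> sx; have sx' := mdhom_states (stage_incl v) sx.
  have [x' x'E] : stage_mem (cell k) (stage_incl v x).
    by exists (state_leg _ (mk_state sx')).
  have -> : w x = a x' by apply: (wP _).1.
  by apply: mdhom_states; apply: stage_states; rewrite x'E.
have hc j (jv : (cell j < v)%O) : exists f : mdhom (GlobD (dim j)) W,
    forall p, w (cell_leg jv p) = f p.
  have := lt_succ h jv; rewrite le_eqVlt => /orP[/eqP/cell_lt_inj e|jk].
    by subst j; exists b => p; apply: (wP _).2.
  by exists (a \oM cell_leg jk) => p; apply: (wP _).1.
exists (stage_desc hb hs hc); split.
  by split; apply: mdhom_ext => x; [exact: wa|exact: wb].
move=> w' [w'a w'b]; apply: mdhom_ext => x; rewrite stage_descE.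
have [[x' x'E]|nm] := pselect (stage_mem (cell k) (stage_incl v x)).
  have -> : x = stage_map (ltW h.1) x' by apply: (@stage_incl_inj v); rewrite stage_mapE.
  by rewrite wa (mdcompE w'a).
elim/(@stage_casesL v): x nm => [a'|s|j jv p] nm.
- by case: nm; exists (base_leg _ a').
- by case: nm; exists (state_leg _ s).
have := lt_succ h jv; rewrite le_eqVlt => /orP[/eqP/cell_lt_inj e|jk].
  subst j; have -> : cell_leg jv p = cell_leg h.1 p by apply: (@stage_incl_inj v).
  by rewrite wb (mdcompE w'b).
by case: nm; exists (cell_leg jk p).
Qed.

Lemma stage_map_id u (h : (u <= u)%O) : stage_map h = mdid (stage u).
Proof. by apply: mdhom_ext => x; apply: (@stage_incl_inj u); rewrite stage_mapE. Qed.

Lemma stage_map_comp u v w (uv : (u <= v)%O) (vw : (v <= w)%O) (uw : (u <= w)%O) :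
  stage_map vw \oM stage_map uv = stage_map uw.
Proof.
by apply: mdhom_ext => x; apply: (@stage_incl_inj w); rewrite !stage_mapE.
Qed.

Lemma stage_limit (v : L) : is_limit v ->
  forall (W : mdspace) (k : forall u : L, (u < v)%O -> mdhom (stage u) W),
  (forall (u u' : L) (uu' : (u <= u')%O) (h : (u < v)%O) (h' : (u' < v)%O),
    k u' h' \oM stage_map uu' = k u h) ->
  exists! w : mdhom (stage v) W,
    forall (u : L) (h : (u < v)%O), w \oM stage_map (ltW h) = k u h.
Proof.
move=> [v0 nsucc] W k ck.
have botv : (\bot%O < v)%O by rewrite lt_def le0x andbT; apply/eqP.
(* Below a limit, each cell is already present at the successor of its index, which is still below
   [v]. *)
have early j : (cell j < v)%O -> exists2 u : L, (u < v)%O & (cell j < u)%O.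
  move=> /exists_succ[u [ju uv]]; exists u; last exact: ju.1.
  rewrite lt_neqAle uv andbT; apply/eqP => e; subst u.
  exact: nsucc ju.
have memv (x : stage v) : exists u (h : (u < v)%O), stage_mem u (stage_incl v x).
  elim/(@stage_casesL v): x => [a|s|j h p].
  - by exists \bot%O, botv, (base_leg _ a).
  - by exists \bot%O, botv, (state_leg _ s).
  - by have [u uv ju] := early j h; exists u, uv, (cell_leg ju p).
have kk u u' (h : (u < v)%O) (h' : (u' < v)%O) y y' :
    stage_incl u y = stage_incl u' y' -> k u h y = k u' h' y'.
  have [uu'|/ltW u'u] := leP u u' => e.
    rewrite -(ck u u' uu' h h') /=; congr (k _ _ _).
    by apply: (@stage_incl_inj u'); rewrite stage_mapE.
  rewrite -(ck u' u u'u h' h) /=; congr (k _ _ _).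
  by apply: (@stage_incl_inj u); rewrite stage_mapE.
have fact (x : stage v) : exists y : W, forall u (h : (u < v)%O) x',
    stage_incl u x' = stage_incl v x -> y = k u h x'.
  have [u [h [x' x'E]]] := memv x; exists (k u h x') => u' h' y yE.
  by apply: kk; rewrite x'E.
have [w wP] := choice fact.
have hb : exists h : mdhom A W, forall a', w (base_leg v a') = h a'.
  by exists (k _ botv \oM base_leg \bot%O) => a'; apply: (wP _ _ botv).
have hs x : states x -> states (w x).
  move=> sx; have sx' := mdhom_states (stage_incl v) sx.
  rewrite (wP _ _ botv (state_leg _ (mk_state sx'))) //.
  by do 2!apply: mdhom_states.
have hc j (jv : (cell j < v)%O) : exists f : mdhom (GlobD (dim j)) W,
    forall p, w (cell_leg jv p) = f p.
  have [u uv ju] := early j jv.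
  by exists (k u uv \oM cell_leg ju) => p; apply: (wP _ u uv).
exists (stage_desc hb hs hc); split.
  by move=> u h; apply: mdhom_ext => x; apply: (wP _ u h); rewrite stage_mapE.
move=> w' w'E; apply: mdhom_ext => x; rewrite stage_descE.
have [u [h [x' x'E]]] := memv x.
have -> : x = stage_map (ltW h) x' by apply: (@stage_incl_inj v); rewrite stage_mapE.
rewrite (mdcompE (w'E u h)); apply: (wP _ u h).
by rewrite stage_mapE.
Qed.

Definition stage_tower : tower R dH L :=
  Tower stage_map_id stage_map_comp stage_limit.

Let ktop_end : L := @kend K lt (rc_wf rc) (rc_trans rc) (rc_total rc).

Lemma lt_end k : (cell k < ktop_end)%O.
Proof. by []. Qed.

Lemma le_end (u : L) : (u <= ktop_end)%O.
Proof.
case: u => [k|]; last exact: lexx.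
exact: ltW (lt_end k).
Qed.

Lemma end_mem x : stage_mem ktop_end x.
Proof.
have [[a ->]|sx|[k [p [_ ->]]]] := rc_cover rc x.
- by exists (base_leg _ a).
- by exists (state_leg _ (mk_state sx)).
- by exists (cell_leg (lt_end k) p).
Qed.

(** The order has a last element and the stage there is all of [X]: the inverse of its inclusion is
    continuous by [rc_open] and preserves execution paths by [rc_expath]. *)
Lemma stage_colim : @is_colimit R dH L stage_tower X stage_incl.
Proof.
split=> [u v uv|W k ck]; first exact: stage_map_incl.
have [s sE] := choice end_mem.
have sK y : s (stage_incl ktop_end y) = y by apply: (@stage_incl_inj ktop_end).
have cs : continuous (s : X -> stage ktop_end).
  apply/continuousP => U oU; have oU' j := (oU : image_open _) j.
  apply: (rc_open rc).
    rewrite (_ : _ @^-1` _ = base_leg ktop_end @^-1` U); first exact: (oU' ix_base).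
    by apply/seteqP; split=> a /=; rewrite -(base_legE ktop_end) sK.
  move=> j; rewrite (_ : _ @^-1` _ = cell_leg (lt_end j) @^-1` U).
    exact: (oU' (ix_cell (lt_end j))).
  by apply/seteqP; split=> p /=; rewrite -(cell_legE (lt_end j)) sK.
have ss x : states x -> states (s x).
  by move=> sx; apply: stage_states; rewrite sE.
have se g : expath g -> @expath R dH (stage ktop_end) (s \o g).
  move=> eg; apply: stage_expath.
  have -> : stage_incl ktop_end \o (s \o g) = g by apply/funext => t; exact: sE.
  by apply: gen_sub (rc_expath rc eg); apply: cell_pathsS => j _; exact: lt_end.
pose sh := @MDHom R dH X (stage ktop_end) s cs ss se.
exists (k ktop_end \oM sh); split.
  move=> u; apply: mdhom_ext => x /=; rewrite -(mdcompE (ck u ktop_end (le_end u))).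
  congr (k _ _); apply: (@stage_incl_inj ktop_end).
  by rewrite sE [RHS]stage_mapE.
move=> w wE; rewrite -wE; apply: mdhom_ext => x.
by rewrite -[LHS]/(w (stage_incl ktop_end (s x))) sE.
Qed.

Lemma q_cofibration_relcell : q_cofibration i.
Proof.
move=> U V p tp a b pab.
(* The stage [\bot] is [A] together with the remaining states of [X]. On [A] the lift is prescribed;
   a further state is lifted along the generating cofibration from the empty set to a point. *)
have fact (x : stage (\bot%O : L)) : exists y : U, [/\ p y = b (stage_incl _ x),
    (forall a', i a' = stage_incl _ x -> y = a a') & states x -> states y].
  have [[a' a'E]|na] := pselect (exists a', i a' = stage_incl _ x).
    exists (a a'); split.
    - by rewrite -a'E (mdcompE pab).
    - by move=> a''; rewrite -a'E => /(rc_inj rc) ->.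
    - move=> /(mdhom_states (stage_incl _)); rewrite -a'E => /(rc_reflect rc).
      exact: mdhom_states.
  have sx : states (stage_incl _ x).
    have [|[a' e]|//|[j [r [jb _ _]]]] := @stage_point \bot%O (stage_incl _ x).
    - by exists x.
    - by case: na; exists a'.
    - by move: jb; rewrite ltx0.
  have sbx := mdhom_states b sx.
  pose vu : mdhom (mdset R dH unit) V := discrete_hom (fun _ : unit => sbx).
  have [|l [_ lE]] := tp _ _ _ (gc_empty R dH) (from_empty U) vu.
    by apply: mdhom_ext => -[].
  exists (l tt); split=> [|a' e|_].
  - by rewrite (mdcompE lE).
  - by case: na; exists a'.
  - exact: mdhom_states.
have [w wP] := choice fact.
have hb : exists h : mdhom A U, forall a', w (base_leg (\bot%O : L) a') = h a'.
  by exists a => a'; have [_ + _] := wP (base_leg _ a'); apply.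
have hs x : states x -> states (w x) by have [] := wP x.
have hc j (jv : (cell j < (\bot%O : L))%O) : exists f : mdhom (GlobD (dim j)) U,
    forall p, w (cell_leg jv p) = f p.
  by have := jv; rewrite {1}ltx0.
have pc := @total_colimit R dH L stage_tower X stage_incl stage_colim.
have [||H [HE pH]] := @transfinite_lift R dH L stage_tower setT X _ (fun _ _ _ _ => Logic.I)
    pc U V p _ \bot%O Logic.I (stage_desc hb hs hc) b.
- move=> u v h _; case: u h => [k|] h.
    have <- : stage_map (ltW h.1) = tower_next stage_tower h.
      by rewrite /tower_next /=; congr stage_map; exact: bool_irrelevance.
    exact: lifting_pushout (stage_pushout h) (tp _ _ _ (gc_globe R dH (dim k))).
  by have := lt_le_trans h.1 (le_end v); rewrite ltxx.
- by apply: mdhom_ext => x; have [] := wP x.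
exists H; split=> //; apply: mdhom_ext => a'.
rewrite -[RHS](_ : w (base_leg _ a') = _); last by have [_ + _] := wP (base_leg _ a'); apply.
by rewrite -[RHS]/(stage_desc hb hs hc _) -HE.
Qed.

End Stages.

Section CellularOfCells.
Context {R : realType} {dH : bool}.
Local Notation mdspace := (mdspace R dH).
Context {X : mdspace} {K : Type} {lt : K -> K -> Prop}.
Context {dim : K -> nat} {c : forall k, mdhom (GlobD R dH (dim k)) X}.
Hypothesis rc : relcell (from_empty X) lt c.

Let L : wellOrder := ktop_wo (rc_wf rc) (rc_trans rc) (rc_total rc).

Let stage_attachment (u v : L) (h : is_succ u v) : cell_attachment (stage_tower rc) h.
Proof.
case: u h => [k|] h; last first.
  by have := lt_le_trans h.1 (le_end v); rewrite ltxx.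
apply: (@CellAttachment R dH L (stage_tower rc) _ v h (dim k) (attach rc k) (cell_leg h.1)).
have -> : tower_next (stage_tower rc) h = stage_map (ltW h.1).
  by rewrite /tower_next /=; congr stage_map; exact: bool_irrelevance.
exact: stage_pushout.
Defined.

Lemma cellular_relcell : cellular X.
Proof.
have nocell j : ~ (kcell (rc_wf rc) (rc_trans rc) (rc_total rc) j < (\bot%O : L))%O.
  by rewrite ltx0.
constructor.
apply: (@CellularDecomposition R dH X L (stage_tower rc) (@stage_incl _ _ _ _ _ _ _ _ _ rc)).
- exact: stage_colim.
- move=> U; apply: (@stage_open _ _ _ _ _ _ _ _ _ rc); first exact: discrete_open.
  by move=> j h; case: (nocell j h).
- apply/seteqP; split=> // x _; apply: stage_states.
  elim/(@stage_casesL _ _ _ _ _ _ _ _ _ rc): x => [[]|s|j h]; last by case: (nocell j h).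
  exact: (set_mem (valP s)).
- apply/seteqP; split=> // g eg.
  have [p [s [[[||j h] [q [eq _]]] _]]] := gen_point i0 eg; try exact: eq.
  by case: (nocell j h).
- split.
  + move=> x _; elim/(@stage_casesL _ _ _ _ _ _ _ _ _ rc): x => [[]|s|j h]; last by case: (nocell j h).
    exact: (set_mem (valP s)).
  + by move=> x y _ _ /stage_incl_inj.
  + by move=> x sx; exists (state_leg _ (mk_state sx)).
- exact: stage_attachment.
Qed.

End CellularOfCells.

(** * Composition and refinement of cell structures *)

Section Composition.
Context {R : realType} {dH : bool}.
Local Notation mdspace := (mdspace R dH).
Local Notation GlobD := (GlobD R dH).
Context {A B C : mdspace} {i : mdhom A B} {j : mdhom B C}.
Context {K1 K2 : Type} {lt1 : K1 -> K1 -> Prop} {lt2 : K2 -> K2 -> Prop}.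
Context {dim1 : K1 -> nat} {dim2 : K2 -> nat}.
Context {c1 : forall k, mdhom (GlobD (dim1 k)) B} {c2 : forall k, mdhom (GlobD (dim2 k)) C}.
Hypotheses (rc1 : relcell i lt1 c1) (rc2 : relcell j lt2 c2).

Definition sum_lt (x y : K1 + K2) : Prop :=
  match x, y with
  | inl k, inl l => lt1 k l
  | inl _, inr _ => True
  | inr _, inl _ => False
  | inr k, inr l => lt2 k l
  end.

Definition sum_dim (x : K1 + K2) : nat :=
  match x with inl k => dim1 k | inr k => dim2 k end.

Definition sum_cell (x : K1 + K2) : mdhom (GlobD (sum_dim x)) C :=
  match x with inl k => j \oM c1 k | inr k => c2 k end.

Lemma sum_lt_wf : well_founded sum_lt.
Proof.
have acc1 k : Acc sum_lt (inl k).
  apply: (@well_founded_ind K1 lt1 (rc_wf rc1) (fun k => Acc sum_lt (inl k))) => {}k IH.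
  by apply: Acc_intro => -[l lk|l lk]; [exact: IH|case: lk].
case=> k; first exact: acc1.
apply: (@well_founded_ind K2 lt2 (rc_wf rc2) (fun k => Acc sum_lt (inr k))) => {}k IH.
by apply: Acc_intro => -[l lk|l lk]; [exact: acc1|exact: IH].
Qed.

Lemma relcell_comp : relcell (j \oM i) sum_lt sum_cell.
Proof.
have openB (U : set C) : open ((j \oM i) @^-1` U) ->
    (forall k, open (sum_cell (inl k) @^-1` U)) -> open (j @^-1` U).
  by move=> o1 o2; apply: (rc_open rc1).
have pathB (S : set (K1 + K2)) q : (forall k, S (inl k)) -> expath q ->
    gen (cell_paths (j \oM i) sum_cell S) (j \o q).
  move=> Sl /(rc_expath rc1); apply: gen_comp => _ [[r [er ->]]|[k [z [_ iz ->]]]].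
    by apply: gen_base; left; exists r.
  by apply: gen_base; right; exists (inl k), z; split=> //; exact: Sl.
split.
- exact: sum_lt_wf.
- by move=> [x|x] [y|y] [z|z] //=; [exact: (rc_trans rc1)|exact: (rc_trans rc2)].
- move=> [x|x] [y|y] /=.
  + by have [h|->|h] := rc_total rc1 x y; [constructor 1|constructor 2|constructor 3].
  + by constructor 1.
  + by constructor 3.
  + by have [h|->|h] := rc_total rc2 x y; [constructor 1|constructor 2|constructor 3].
- by move=> x y /(rc_inj rc2)/(rc_inj rc1).
- by move=> a /(rc_reflect rc2)/(rc_reflect rc1).
- move=> x; have [[b ->]|sx|[k [p [ip ->]]]] := rc_cover rc2 x.
  + have [[a ->]|sb|[k [p [ip ->]]]] := rc_cover rc1 b.
    * by constructor 1; exists a.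
    * by constructor 2; exact: mdhom_states.
    * by constructor 3; exists (inl k), p.
  + by constructor 2.
  + by constructor 3; exists (inr k), p.
- move=> [k|k] p a /= ip; first by move/(rc_inj rc2)/(rc_not_base rc1 ip).
  exact: (rc_not_base rc2).
- move=> [k|k] p /= ip; first by move/(rc_reflect rc2)/(rc_not_state rc1 ip).
  exact: (rc_not_state rc2).
- move=> [k|k] p p' /= ip ip'; last exact: (rc_cell_inj rc2).
  by move/(rc_inj rc2); exact: (rc_cell_inj rc1).
- move=> [k|k] [l|l] p p' /= ip ip'.
  + by move/(rc_inj rc2)/(rc_disjoint rc1 ip ip') => ->.
  + by move/esym/(rc_not_base rc2 ip').
  + by move/(rc_not_base rc2 ip).
  + by move/(rc_disjoint rc2 ip ip') => ->.
- move=> U oU oc; apply: (rc_open rc2) => [|k]; last exact: (oc (inr k)).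
  by apply: openB => // k; exact: oc.
- move=> [k|k] U oU oc /=.
    by apply: (rc_attach rc1 (U := j @^-1` U)) => // l lk; exact: (oc (inl l)).
  apply: (rc_attach rc2) => [|l lk]; last exact: (oc (inr l)).
  by apply: openB => // l; exact: oc.
- move=> g /(rc_expath rc2); apply: gen_trans => _ [[q [eq ->]]|[k [z [_ iz ->]]]].
    exact: pathB.
  by apply: gen_base; right; exists (inr k), z.
- move=> [k|k] z /=.
    apply: (gen_comp (j := j) _ (rc_attach_path rc1 z)) => _ [[r [er ->]]|[l [y [lk iy ->]]]].
      by apply: gen_base; left; exists r.
    by apply: gen_base; right; exists (inl l), y.
  apply: gen_trans (rc_attach_path rc2 z) => _ [[q [eq ->]]|[l [y [lk iy ->]]]].
    exact: pathB.
  by apply: gen_base; right; exists (inr l), y.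
Qed.

End Composition.

Section Refinement.
Context {R : realType} {dH : bool}.
Local Notation mdspace := (mdspace R dH).
Local Notation GlobD := (GlobD R dH).
Context {A X X' : mdspace} {i : mdhom A X} {K : Type} {lt : K -> K -> Prop}.
Context {dim : K -> nat} {c : forall k, mdhom (GlobD (dim k)) X}.
Hypothesis rc : relcell i lt c.
Context {e : mdhom X X'} {g : X' -> X}.
Hypotheses (cg : continuous g) (eK : cancel e g) (gK : cancel g e).
Context {F : forall k, set (GlobD (dim k))}.
Hypothesis F_int : forall k p, F p -> @cell_int R (dim k) p.
Hypothesis F_states : forall x, states (e x) ->
  states x \/ exists k (p : GlobD (dim k)), F p /\ x = c k p.
Context {b : forall k, mdhom (GlobF (F (k := k))) X'}.
Hypothesis bE : forall k p, b k p = e (c k p).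
Hypothesis F_paths : forall h, expath h ->
  gen [set h | (exists q, expath q /\ h = e \o i \o q) \/
               (exists k q, expath q /\ h = b k \o q)] h.
Context {K' : K -> Type} {lt' : forall k, K' k -> K' k -> Prop}.
Context {dim' : forall k, K' k -> nat}.
Context {c' : forall k (l : K' k), mdhom (GlobD (dim' l)) (GlobF (F (k := k)))}.
Hypothesis rc' : forall k, relcell (GlobSF (F (k := k))) (lt' (k := k)) (c' (k := k)).

Definition lexi_lt (x y : {k : K & K' k}) : Prop :=
  lt (tag x) (tag y) \/
  exists h : tag x = tag y, lt' (eq_rect (tag x) K' (tagged x) (tag y) h) (tagged y).

Definition lexi_dim (x : {k : K & K' k}) : nat := dim' (tagged x).

Definition lexi_cell (x : {k : K & K' k}) : mdhom (GlobD (lexi_dim x)) X' :=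
  b (tag x) \oM c' (tagged x).

Lemma lexi_same k (l l' : K' k) :
  lexi_lt (existT _ k l) (existT _ k l') -> lt' l l'.
Proof.
case=> [/= h|[h]]; first by case: (lt_irrefl (rc_wf rc) h).
by rewrite /= in h *; rewrite (Prop_irrelevance h erefl).
Qed.

Lemma lexi_wf : well_founded lexi_lt.
Proof.
case=> k; apply: (@well_founded_ind K lt (rc_wf rc) (fun k => forall l : K' k, Acc lexi_lt (existT _ k l))) => {}k IH l.
apply: (@well_founded_ind (K' k) (lt' (k := k)) (rc_wf (rc' k))
  (fun l => Acc lexi_lt (existT _ k l))) => {}l IH'.
apply: Acc_intro => -[m n] mn; case: (mn) => [h|[h _]]; first exact: IH.
rewrite /= in h; subst m; exact: (IH' n (lexi_same mn)).
Qed.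

Let sub_int k (l : K' k) p : cell_int p -> cell_int (c' l p).
Proof.
move=> ip; apply: contrapT => /(@cell_intNE _ dH)[q qE].
exact: (rc_not_base (rc' k) ip qE).
Qed.

Let e_inj : injective e.
Proof. exact: can_inj eK. Qed.

Let cE k (l : K' k) p : lexi_cell (existT _ k l) p = e (c k (c' l p)).
Proof. exact: bE. Qed.

(** Induction on [k]: the hypothesis handles the small cells of [k], while [rc_attach] and the
    induction hypothesis for earlier cells handle the boundary of [k]. *)
Let open_cell (U : set X') (S : set {k : K & K' k}) : open ((e \oM i) @^-1` U) ->
  (forall x, S x -> open (lexi_cell x @^-1` U)) ->
  forall k, (forall x, tag x = k \/ lt (tag x) k -> S x) -> open (c k @^-1` (e @^-1` U)).
Proof.
move=> o1 o2 k; apply: (@well_founded_ind K lt (rc_wf rc) (fun k =>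
  (forall x, tag x = k \/ lt (tag x) k -> S x) -> open (c k @^-1` (e @^-1` U)))) => {}k IH kS.
rewrite (_ : _ @^-1` _ = b k @^-1` U); last first.
  by apply/seteqP; split=> p /=; rewrite bE.
apply: (rc_open (rc' k)).
  have := @rc_attach _ _ _ _ _ _ _ _ _ rc k (e @^-1` U) o1.
  rewrite (_ : _ @^-1` (_ @^-1` U) = GlobSF (F (k := k)) @^-1` (b k @^-1` U)).
    apply=> l lk; apply: IH => // x [xl|xl]; apply: kS; right; first by rewrite xl.
    exact: (rc_trans rc xl lk).
  by apply/seteqP; split=> p /=; rewrite bE.
by move=> l; apply: (o2 (existT _ k l)); apply: kS; left.
Qed.

(** The two statements are proved in one induction: a boundary fibre of [k] runs through whole
    fibres of earlier cells, and a path of [GlobF] runs through fibres of small cells and boundary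
    fibres of [k]. *)
Let cell_gen k : (forall q, expath q ->
    gen (cell_paths (e \oM i) lexi_cell [set x | tag x = k \/ lt (tag x) k]) (b k \o q)) /\
  (forall z : sphereT R (dim k), gen (cell_paths (e \oM i) lexi_cell [set x | lt (tag x) k])
    (b k \o globe_pt (sphere_disk z))).
Proof.
apply: (@well_founded_ind K lt (rc_wf rc) (fun k => (forall q, expath q ->
    gen (cell_paths (e \oM i) lexi_cell [set x | tag x = k \/ lt (tag x) k]) (b k \o q)) /\
  (forall z : sphereT R (dim k), gen (cell_paths (e \oM i) lexi_cell [set x | lt (tag x) k])
    (b k \o globe_pt (sphere_disk z))))) => {}k IH.
have H2 (z : sphereT R (dim k)) :
    gen (cell_paths (e \oM i) lexi_cell [set x | lt (tag x) k])
    (b k \o globe_pt (sphere_disk z)).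
  have -> : b k \o globe_pt (sphere_disk z) = e \o (c k \o globe_pt (sphere_disk z)).
    by apply/funext => t /=; rewrite bE.
  apply: (gen_comp _ (rc_attach_path rc z)) => _ [[q [eq ->]]|[l [y [lk iy ->]]]].
    by apply: gen_base; left; exists q.
  have -> : e \o (c l \o globe_pt y) = b l \o globe_pt y.
    by apply/funext => t /=; rewrite bE.
  have ey : @expath R dH (GlobF (F (k := l))) (globe_pt y).
    exact: (mdhom_expath (GlobDF (F (k := l))) (expath_globe_pt (rV_hausdorff (A := _)) y)).
  apply: gen_sub ((IH l lk).1 _ ey); apply: cell_pathsS => x [/= ->//|/= xl].
  exact: (rc_trans rc xl lk).
split=> // q /(rc_expath (rc' k)); apply: gen_comp => _ [[r [er ->]]|[l [z [_ iz ->]]]].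
  case: er => z [phi [rphi ->]].
  have -> : b k \o (GlobSF (F (k := k)) \o (globe_pt z \o phi)) =
      (b k \o globe_pt (sphere_disk z)) \o phi.
    by apply/funext => t /=; congr (b k _); exact: globSD_pt.
  apply: gen_reparam => //; apply: gen_sub (H2 z); apply: cell_pathsS => x xk.
  by right.
by apply: gen_base; right; exists (existT _ k l), z; split=> //; left.
Qed.

(** The new states are interior to the big cells, hence away from the base. Disjointness and
    injectivity of the small cells are obtained between big cells from [rc], and inside a single one
    from [rc']. *)
Lemma relcell_refine : relcell (e \oM i) lexi_lt lexi_cell.
Proof.
split.
- exact: lexi_wf.
- move=> [x lx] [y ly] [z lz] [/= xy|[/= xy lxy]] [/= yz|[/= yz lyz]].
  + by left; exact: (rc_trans rc xy yz).
  + by left; subst z.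
  + by left; subst y.
  + subst y; subst z; right; exists erefl => /=.
    exact: (rc_trans (rc' x) lxy lyz).
- move=> [x lx] [y ly]; have [h|h|h] := rc_total rc x y.
  + by constructor 1; left.
  + subst y; have [h|->|h] := rc_total (rc' x) lx ly.
    * by constructor 1; right; exists erefl.
    * by constructor 2.
    * by constructor 3; right; exists erefl.
  + by constructor 3; left.
- by move=> x y /e_inj/(rc_inj rc).
- move=> a /F_states[/(rc_reflect rc)//|[k [p [Fp e']]]].
  by case: (rc_not_base rc (F_int Fp) (esym e')).
- move=> x'; rewrite -(gK x'); have [[a ->]|sx|[k [p [ip ->]]]] := rc_cover rc (g x').
  + by constructor 1; exists a.
  + by constructor 2; exact: mdhom_states.
  + have [[q qE]|sp|[l [q [iq qE]]]] := rc_cover (rc' k) (p : GlobF (F (k := k))).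
    * by case: (@globSD_not_int R dH _ q); rewrite -[GlobSD _ _ _ q]/(GlobSF (F (k := k)) q) -qE.
    * by constructor 2; rewrite -bE; exact: mdhom_states.
    * by constructor 3; exists (existT _ k l), q; split=> //; rewrite cE qE.
- move=> [k l] p a ip; rewrite cE => /e_inj; exact: (rc_not_base rc (sub_int ip)).
- move=> [k l] p ip; rewrite cE => /F_states[|[k2 [q [Fq E]]]].
    exact: (rc_not_state rc (sub_int ip)).
  have kk := rc_disjoint rc (sub_int ip) (F_int Fq) E; subst k2.
  have := rc_cell_inj rc (sub_int ip) (F_int Fq) E => qE.
  by apply: (rc_not_state (rc' k) ip); right; rewrite qE.
- move=> [k l] p p' ip ip'; rewrite !cE => /e_inj.
  by move/(rc_cell_inj rc (sub_int ip) (sub_int ip')); exact: (rc_cell_inj (rc' k)).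
- move=> [k l] [k2 l2] p p' ip ip'; rewrite !cE => /e_inj E.
  have kk : k = k2 := rc_disjoint rc (sub_int ip) (sub_int ip') E; subst k2.
  have E' := rc_cell_inj rc (sub_int ip) (sub_int ip') E.
  by have ll : l = l2 := rc_disjoint (rc' k) ip ip' E'; rewrite ll.
- move=> U o1 o2; rewrite (_ : U = g @^-1` (e @^-1` U)); last first.
    by apply/seteqP; split=> x /=; rewrite gK.
  move/continuousP: cg; apply; apply: (rc_open rc) => // k.
  by apply: (open_cell (S := setT) o1) => // x _; exact: o2.
- move=> [k l] U o1 o2.
  apply: (@rc_attach _ _ _ _ _ _ _ _ _ (rc' k) l (b k @^-1` U)) => [|m ml]; last first.
    by apply: (o2 (existT _ k m)); right; exists erefl.
  rewrite (_ : _ @^-1` (_ @^-1` U) = (c k \oM GlobSD _ _ _) @^-1` (e @^-1` U)); last first.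
    by apply/seteqP; split=> p /=; rewrite bE.
  apply: (rc_attach rc) => // m mk.
  apply: (open_cell (S := [set x | lt (tag x) k]) o1) => [x xk|x [/= ->//|xm]].
    by apply: o2; left.
  exact: (rc_trans rc xm mk).
- move=> h /F_paths; apply: gen_trans => _ [[q [eq ->]]|[k [q [eq ->]]]].
    by apply: gen_base; left; exists q.
  by apply: gen_sub ((cell_gen k).1 q eq); exact: cell_pathsS.
- move=> [k l] z; apply: (gen_comp (j := b k) _ (rc_attach_path (rc' k) z)).
  move=> _ [[q [eq ->]]|[m [y [ml iy ->]]]]; last first.
    by apply: gen_base; right; exists (existT _ k m), y; split=> //; right; exists erefl.
  case: eq => y [phi [rphi ->]].
  have -> : b k \o (GlobSF (F (k := k)) \o (globe_pt y \o phi)) =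
      (b k \o globe_pt (sphere_disk y)) \o phi.
    by apply/funext => t /=; congr (b k _); exact: globSD_pt.
  apply: gen_reparam => //; apply: gen_sub ((cell_gen k).2 y); apply: cell_pathsS => x xk.
  by left.
Qed.

End Refinement.

(** * Cell structures on globes with added states *)

Section GlobeGeometry.
Context {R : realType}.
Local Notation I := (@itv01 R).

Lemma cone_open (Z : topologicalType) (V : set Z) : open V ->
  open [set p : globe R Z | if p is inr (z, _) then V z else False].
Proof.
move=> oV; rewrite globe_openE; apply: open_delta_open.
rewrite (_ : [set _ | _] = (fst @^-1` V) `&` ((fun p : Z * I => val p.2) @^-1` @opn01 R)); last first.
  apply/seteqP; split=> -[w t] /=.
    have [[_ ->]|[_ ->]|[v [vt ->]]] := globe_ptP w t => //= Vw.
    by split=> //; rewrite -vt /opn01 /= in_itv /= opn01P.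
  move=> [Vw]; rewrite /opn01 /= in_itv /= => /andP[t0 t1].
  have [[e ->]|[e ->]|[v [vt ->]]] := globe_ptP w t => //=.
    by rewrite e ltxx in t0.
  by rewrite e ltxx in t1.
apply: openI; first by apply: open_comp => // p _; exact: cvg_fst.
apply: open_comp; last exact: interval_open.
move=> p _; apply: (@continuous_comp _ _ _ snd (val : I -> R)); first exact: cvg_snd.
exact: itv_val_continuous.
Qed.

Lemma cone_closed (Z : topologicalType) (V : set Z) : closed V ->
  closed [set p : globe R Z | if p is inr (z, _) then V z else True].
Proof.
move=> cV; rewrite -openC; have := cone_open (closed_openC cV); congr open.
by apply/seteqP; split=> -[b|[z u]] //= h; apply: h.
Qed.

Lemma globe_time_continuous (Z : topologicalType) : continuous (@globe_time R Z).
Proof.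
apply/continuousP => V oV; rewrite globe_openE; apply: open_delta_open.
rewrite (_ : [set _ | _] = (fun p : Z * I => val p.2) @^-1` V); last first.
  by apply/seteqP; split=> p /=; rewrite globe_time_pt.
have c : continuous (fun p : Z * I => val p.2 : R).
  by apply: (continuous_fcomp (f := snd)) itv_val_continuous => p; exact: cvg_snd.
by move/continuousP: c; apply.
Qed.

Lemma inner_chord n (y : diskT R n) : inner y <-> 0 < chord y.
Proof.
by rewrite /inner sqrtr_gt0 subr_gt0.
Qed.

Lemma inner_height n (x : diskT R n.+1) :
  inner x <-> - chord (tail_disk x) < height x < chord (tail_disk x).
Proof.
rewrite /inner sqnorm_height -ltr_norml -sqrtr_sqr.
have h0 : 0 <= 1 - sqnorm (val (tail_disk x)) by rewrite subr_ge0 disk_sqnorm.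
split=> h.
  rewrite ltr_sqrt; first by rewrite ltrBrDr.
  by rewrite ltrBrDr (le_lt_trans _ h) // lerD2r sqr_ge0.
have pos : 0 < 1 - sqnorm (val (tail_disk x)).
  by rewrite -sqrtr_gt0; apply: le_lt_trans h; exact: sqrtr_ge0.
by move: h; rewrite ltr_sqrt // ltrBrDr.
Qed.

Lemma chord_sphere n (y : sphereT R n) : chord (sphere_disk y) = 0.
Proof. by rewrite /chord /= sphere_sqnorm subrr sqrtr0. Qed.

Section Slab.
Variables (n : nat) (a b : R).
Hypotheses (a1 : -1 <= a) (ab : a < b) (b1 : b <= 1).

(* The affine map of each vertical chord onto its part of heights between
   [a] and [b] times the half-length of the chord. *)
Definition slab (x : diskT R n.+1) : diskT R n.+1 :=
  mk_disk ((a + b) / 2 * chord (tail_disk x) + (b - a) / 2 * height x) (tail_disk x).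

Definition slab_inv (x : diskT R n.+1) : diskT R n.+1 :=
  mk_disk ((2 * height x - (a + b) * chord (tail_disk x)) / (b - a)) (tail_disk x).

Lemma slab_tail x : tail_disk (slab x) = tail_disk x.
Proof. exact: mk_disk_tail. Qed.

Lemma slab_inv_tail x : tail_disk (slab_inv x) = tail_disk x.
Proof. exact: mk_disk_tail. Qed.

Lemma slab_height x :
  height (slab x) = (a + b) / 2 * chord (tail_disk x) + (b - a) / 2 * height x.
Proof.
move: (a1) (ab) (b1) => A1 AB B1.
apply: mk_disk_height; have /andP[h1 h2] := height_chord x.
have r0 := chord_ge0 (tail_disk x); set r := chord _ in h1 h2 r0 *; set h := height x in h1 h2 *; clearbody r h.
have p1 : 0 <= (b - a) * (h + r) by apply: mulr_ge0; lra.
have p2 : 0 <= (b - a) * (r - h) by apply: mulr_ge0; lra.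
have p3 : 0 <= (a + 1) * r by apply: mulr_ge0; lra.
have p4 : 0 <= (1 - b) * r by apply: mulr_ge0; lra.
by apply/andP; split; lra.
Qed.

Lemma slab_bounds x : a * chord (tail_disk x) <= height (slab x) <= b * chord (tail_disk x).
Proof.
move: (a1) (ab) (b1) => A1 AB B1.
rewrite slab_height; have /andP[h1 h2] := height_chord x.
set r := chord _ in h1 h2 *; set h := height x in h1 h2 *; clearbody r h.
have p1 : 0 <= (b - a) * (h + r) by apply: mulr_ge0; lra.
have p2 : 0 <= (b - a) * (r - h) by apply: mulr_ge0; lra.
by apply/andP; split; lra.
Qed.

Lemma slab_inv_height x : a * chord (tail_disk x) <= height x <= b * chord (tail_disk x) ->
  height (slab_inv x) = (2 * height x - (a + b) * chord (tail_disk x)) / (b - a).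
Proof.
move: (a1) (ab) (b1) => A1 AB B1.
move=> /andP[h1 h2]; apply: mk_disk_height; have ba : 0 < b - a by rewrite subr_gt0.
by rewrite ler_pdivlMr // ler_pdivrMr //; apply/andP; split; lra.
Qed.

Lemma slabK x : slab_inv (slab x) = x.
Proof.
move: (a1) (ab) (b1) => A1 AB B1.
have B := slab_bounds x; apply: disk_eq; last by rewrite slab_inv_tail slab_tail.
rewrite slab_inv_height ?slab_tail // slab_height.
have ba : b - a != 0 by rewrite gt_eqF // subr_gt0.
by apply: (mulIf ba); rewrite divfK //; lra.
Qed.

Lemma slab_invK x : a * chord (tail_disk x) <= height x <= b * chord (tail_disk x) ->
  slab (slab_inv x) = x.
Proof.
move: (a1) (ab) (b1) => A1 AB B1.
move=> B; apply: disk_eq; last by rewrite slab_tail slab_inv_tail.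
rewrite slab_height slab_inv_height // slab_inv_tail.
have ba : b - a != 0 by rewrite gt_eqF // subr_gt0.
rewrite [_ * (_ / (b - a))]mulrC mulrA divfK //; lra.
Qed.

Lemma slab_inner x : inner x ->
  a * chord (tail_disk x) < height (slab x) < b * chord (tail_disk x).
Proof.
move: (a1) (ab) (b1) => A1 AB B1.
move=> /inner_height/andP[h1 h2]; rewrite slab_height.
set r := chord _ in h1 h2 *; set h := height x in h1 h2 *; clearbody r h.
have p1 : 0 < (b - a) * (h + r) by apply: mulr_gt0; lra.
have p2 : 0 < (b - a) * (r - h) by apply: mulr_gt0; lra.
by apply/andP; split; lra.
Qed.

Lemma inner_slab x : inner x -> inner (slab x).
Proof.
move: (a1) (ab) (b1) => A1 AB B1.
move=> ix; apply/inner_height; rewrite slab_tail; have /andP[h1 h2] := slab_inner ix.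
have r0 := chord_ge0 (tail_disk x); set r := chord _ in h1 h2 r0 *; clearbody r.
have p3 : 0 <= (a + 1) * r by apply: mulr_ge0; lra.
have p4 : 0 <= (1 - b) * r by apply: mulr_ge0; lra.
by apply/andP; split; lra.
Qed.

Lemma slab_inv_inner x : a * chord (tail_disk x) < height x < b * chord (tail_disk x) ->
  inner (slab_inv x).
Proof.
move: (a1) (ab) (b1) => A1 AB B1.
move=> /andP[h1 h2]; apply/inner_height; rewrite slab_inv_tail slab_inv_height ?(ltW h1) ?(ltW h2) //.
have ba : 0 < b - a by rewrite subr_gt0.
by rewrite ltr_pdivlMr // ltr_pdivrMr //; apply/andP; split; lra.
Qed.

Lemma slab_continuous : continuous slab.
Proof.
apply: mk_disk_continuous; last exact: tail_disk_continuous.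
apply: contD; apply: contM; try exact: cont_cst; last exact: height_continuous.
exact: (continuous_fcomp tail_disk_continuous chord_continuous).
Qed.

Lemma slab_inv_continuous : continuous slab_inv.
Proof.
apply: mk_disk_continuous; last exact: tail_disk_continuous.
apply: contM; last exact: cont_cst.
apply: contD; first by apply: contM; [exact: cont_cst|exact: height_continuous].
apply: contN; apply: contM; first exact: cont_cst.
exact: (continuous_fcomp tail_disk_continuous chord_continuous).
Qed.

End Slab.

Section Slice.
Variables (n : nat) (c : R).
Hypothesis c1 : -1 <= c <= 1.

(** The height is a fixed multiple of the chord: for [-1 < c < 1] the slice meets the boundary
    sphere only along the equator, and every interior point of the ball lies on exactly one such
    slice. *)
Definition slice (y : diskT R n) : diskT R n.+1 := mk_disk (c * chord y) y.

Lemma slice_tail y : tail_disk (slice y) = y.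
Proof. exact: mk_disk_tail. Qed.

Lemma slice_height y : height (slice y) = c * chord y.
Proof.
apply: mk_disk_height; have := chord_ge0 y; move: (c1) => /andP[? ?].
set r := chord y => r0; clearbody r.
have p3 : 0 <= (c + 1) * r by apply: mulr_ge0; lra.
have p4 : 0 <= (1 - c) * r by apply: mulr_ge0; lra.
by apply/andP; split; lra.
Qed.

Lemma slice_continuous : continuous slice.
Proof.
apply: (mk_disk_continuous (y := id)); last by move=> x; exact: cvg_id.
by apply: contM; [exact: cont_cst|exact: chord_continuous].
Qed.

Lemma slice_inner y : -1 < c < 1 -> inner y -> inner (slice y).
Proof.
move=> /andP[h1 h2] /inner_chord r0; apply/inner_height; rewrite slice_tail slice_height.
have p3 : 0 < (c + 1) * chord y by apply: mulr_gt0; lra.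
have p4 : 0 < (1 - c) * chord y by apply: mulr_gt0; lra.
by apply/andP; split; lra.
Qed.

End Slice.

(** The two caps agree over the boundary sphere, so either sign gives the same point. *)
Definition equator n (y : sphereT R n) : sphereT R n.+1 := cap true (sphere_disk y).

Lemma equator_continuous n : continuous (@equator n).
Proof.
have := @continuous_fcomp _ _ _ (@sphere_disk R n) (cap true)
  (@sphere_disk_continuous R n) (@cap_continuous R n true).
by [].
Qed.

Lemma cap_equator n b (y : sphereT R n) : cap b (sphere_disk y) = equator y.
Proof.
by apply: val_inj; rewrite /equator /= chord_sphere !mulr0.
Qed.

Lemma sphere_disk_cap_tail n b (y : diskT R n) : tail_disk (sphere_disk (cap b y)) = y.
Proof. by apply: val_inj; rewrite /= tail_cons. Qed.

Lemma sphere_disk_cap_height n b (y : diskT R n) :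
  height (sphere_disk (cap b y)) = cap_sign b * chord y.
Proof. by rewrite /height /= cons_row0. Qed.

Lemma slice_sphere n c (y : sphereT R n) : -1 <= c <= 1 ->
  slice c (sphere_disk y) = sphere_disk (equator y).
Proof.
move=> c1; apply: disk_eq; last by rewrite slice_tail sphere_disk_cap_tail.
by rewrite slice_height // sphere_disk_cap_height chord_sphere !mulr0.
Qed.

End GlobeGeometry.

Section GlobeFMap.
Context {R : realType} {dH : bool}.
Local Notation I := (@itv01 R).
Local Notation GlobD := (GlobD R dH).
Local Notation GlobSD := (GlobSD R dH).

Lemma globe_pt_neq (Z Z' : topologicalType) (z : Z) (z' : Z') (s t : I) :
  globe_pt z s <> globe_pt z t -> globe_pt z' s <> globe_pt z' t.
Proof. by move=> h /globe_pt_inj[/itv01_inj e _]; apply: h; rewrite e. Qed.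

(** The poles are met at the times 0 and 1 only; distinct ends and monotonicity force the path to
    run from 0 to 1, hence to be onto. *)
Lemma pole_path_reparam (Z : topologicalType) (z : Z) (psi : I -> I) :
  monotone_path psi ->
  @globe_state R Z (globe_pt z (psi i0)) -> @globe_state R Z (globe_pt z (psi i1)) ->
  globe_pt (R := R) z (psi i0) <> globe_pt z (psi i1) -> reparam psi.
Proof.
move=> mpsi s0 s1 ne.
have pole t : @globe_state R Z (globe_pt z t) -> t = i0 \/ t = i1.
  move=> [b _ e]; have := globe_time_pt z t; rewrite -e.
  case: b {e} => e; [right|left]; apply: itv01_inj; first by rewrite val_i1.
  by rewrite val_i0.
have [p0|p0] := pole _ s0; have [p1|p1] := pole _ s1.
- by case: ne; rewrite p0 p1.
- exact: monotone_path_reparam.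
- case: ne; congr globe_pt; apply: itv01_inj; apply/le_anti.
  by rewrite mpsi.1 ?i0_le // p0 p1 i0_le.
- by case: ne; rewrite p0 p1.
Qed.

Lemma globF_path n (F : set (GlobD n)) (z : diskT R n) (psi : I -> I) :
  monotone_path psi -> globF_state F (globe_pt z (psi i0)) ->
  globF_state F (globe_pt z (psi i1)) -> globe_pt z (psi i0) <> globe_pt z (psi i1) ->
  @expath R dH (GlobF F) (globe_pt z \o psi).
Proof. by move=> [m c] s0 s1 ne; split=> //; exists z, psi. Qed.

Lemma globF_path_const n (z : diskT R n) (psi : I -> I) : monotone_path psi ->
  (forall t, globe_pt (R := R) z (psi t) = globe_pt z (psi i0)) \/
  globe_pt (R := R) z (psi i0) <> globe_pt z (psi i1).
Proof.
move=> mpsi; have [/globe_pt_inj[/itv01_inj e _]|] :=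
  pselect (globe_pt (R := R) z (psi i0) = globe_pt z (psi i1)); last by right.
left=> t; congr globe_pt; apply: itv01_inj; apply/le_anti/andP; split.
  by rewrite e; apply: mpsi.1; exact: le_i1.
by apply: mpsi.1; exact: i0_le.
Qed.

(** Added states are interior, so over a boundary point only the poles are states. *)
Lemma sphere_path n (F : set (GlobD n)) (y : sphereT R n) (psi : I -> I) :
  (forall p, F p -> cell_int p) -> monotone_path psi ->
  globF_state F (globe_pt (sphere_disk y) (psi i0)) ->
  globF_state F (globe_pt (sphere_disk y) (psi i1)) ->
  globe_pt (sphere_disk y) (psi i0) <> globe_pt (sphere_disk y) (psi i1) ->
  reparam psi.
Proof.
move=> Fi mpsi s0 s1.
have st t : globF_state F (globe_pt (sphere_disk y) t) ->
    @globe_state R _ (globe_pt (sphere_disk y) t).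
  by case=> // /Fi/cell_int_pt[/sphere_not_inner].
exact: pole_path_reparam (st _ s0) (st _ s1).
Qed.

Definition globF_map m n (f : diskT R m -> diskT R n) (cf : continuous f)
  (F' : set (GlobD m)) (F : set (GlobD n)) (hF : forall p, F' p -> F (globe_map f p)) :
  mdhom (GlobF F') (GlobF F).
Proof.
apply: (@MDHom R dH (GlobF F') (GlobF F) (globe_map f)) => //.
  exact: globe_map_continuous.
  by move=> p [[b _ <-]|/hF Fp]; [left; exists b|right].
have hs p : globF_state F' p -> globF_state F (globe_map f p).
  by case=> [[b _ <-]|/hF Fp]; [left; exists b|right].
move=> g [s0 s1 ne [z [psi [m1 c1 gE]]]]; subst g.
have -> : globe_map f \o (globe_pt z \o psi) = globe_pt (f z) \o psi.
  by apply/funext => t; exact: globe_map_pt.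
apply: globF_path => //; rewrite -?globe_map_pt; [exact: hs|exact: hs|].
rewrite !globe_map_pt => /globe_pt_inj[/itv01_inj e _]; apply: ne.
by rewrite /= e.
Defined.

Definition GlobD_map m n (f : diskT R m -> diskT R n) (cf : continuous f) :
  mdhom (GlobD m) (GlobD n) :=
  Glob_map R dH (rV_hausdorff (A := _)) (rV_hausdorff (A := _)) cf.

Lemma globe_map_comp (Z1 Z2 Z3 : topologicalType) (f : Z1 -> Z2) (g : Z2 -> Z3) (p : globe R Z1) :
  globe_map g (globe_map f p) = globe_map (g \o f) p.
Proof. by case: p => [b|[z u]]. Qed.

Lemma globe_map_ext (Z1 Z2 : topologicalType) (f g : Z1 -> Z2) (p : globe R Z1) :
  f =1 g -> globe_map f p = globe_map g p.
Proof. by move=> fg; case: p => [b|[z u]] //=; rewrite fg. Qed.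

Lemma relcell_one n (X : mdspace R dH) (e : mdhom (GlobD n) X) (g : X -> GlobD n) :
  continuous g -> cancel e g -> cancel g e ->
  (forall p, states (e p) -> states p) ->
  (forall h, expath h -> exists q, expath q /\ h = e \o q) ->
  @relcell R dH _ X (e \oM GlobSD n) unit (fun _ _ => False) (fun _ => n) (fun _ => e).
Proof.
move=> cg eK gK es ep; have ei : injective e := can_inj eK.
split.
- by move=> k; apply: Acc_intro.
- by [].
- by move=> [] []; constructor 2.
- by move=> p q /ei/globSD_inj.
- by move=> [b|[y u]] /es[b' _ //]; exists b.
- move=> x; rewrite -(gK x); have [ip|/cell_intNE[q ->]] := pselect (cell_int (g x)).
    by constructor 3; exists tt, (g x).
  by constructor 1; exists q.
- by move=> _ p a ip /ei E; apply: (@globSD_not_int R dH n a); rewrite -E.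
- by move=> _ [b|[z u]] //= _ /es[b _].
- by move=> _ p p' _ _ /ei.
- by move=> [] [].
- move=> U _ /(_ tt) oU; rewrite (_ : U = g @^-1` (e @^-1` U)).
    by move/continuousP: cg; apply.
  by apply/seteqP; split=> x /=; rewrite gK.
- by move=> _ U oU _.
- move=> h /ep[q [eq ->]]; case: eq => z [phi [rphi ->]].
  apply: (@gen_reparam R _ _ (e \o globe_pt z) phi) => //; apply: gen_base.
  have [iz|[y ->]] := inner_or_sphere z; first by right; exists tt, z.
  left; exists (globe_pt y); split; first exact: expath_globe_pt.
  by apply/funext => t; rewrite /= -globSD_pt.
- move=> _ z; apply: gen_base; left; exists (globe_pt z).
  split; first exact: expath_globe_pt.
  by apply/funext => t; rewrite /= -globSD_pt.
Qed.

End GlobeFMap.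

Section CellData.
Context {R : realType} {dH : bool}.
Local Notation mdspace := (mdspace R dH).
Local Notation GlobD := (GlobD R dH).
Local Notation GlobSD := (GlobSD R dH).

Record relcell_data (A X : mdspace) (i : mdhom A X) := RelcellData {
  rd_index : Type;
  rd_lt : rd_index -> rd_index -> Prop;
  rd_dim : rd_index -> nat;
  rd_cell : forall k, mdhom (GlobD (rd_dim k)) X;
  rd_rc : relcell i rd_lt rd_cell }.

(** Mere existence of the data; a choice is made when all cells are refined at once. *)
Definition has_relcell (A X : mdspace) (i : mdhom A X) :=
  exists d : relcell_data i, True.

Lemma has_relcell_refine (A X X' : mdspace) (i : mdhom A X) (K : Type)
    (lt : K -> K -> Prop) (dim : K -> nat) (c : forall k, mdhom (GlobD (dim k)) X)
    (e : mdhom X X') (g : X' -> X) (F : forall k, set (GlobD (dim k)))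
    (b : forall k, mdhom (GlobF (F k)) X') :
  relcell i lt c -> continuous g -> cancel e g -> cancel g e ->
  (forall k p, F k p -> cell_int p) ->
  (forall x, states (e x) -> states x \/ exists k p, F k p /\ x = c k p) ->
  (forall k p, b k p = e (c k p)) ->
  (forall h, expath h -> gen [set h | (exists q, expath q /\ h = e \o i \o q) \/
     (exists k q, expath q /\ h = b k \o q)] h) ->
  (forall k, has_relcell (GlobSF (F k))) -> has_relcell (e \oM i).
Proof.
move=> rc cg eK gK Fi Fs bE Fp H.
pose d k := projT1 (cid (H k)).
by exists (RelcellData (relcell_refine rc cg eK gK Fi Fs bE Fp (fun k => rd_rc (d k)))).
Qed.

Lemma globF_relcell0 n (F : set (GlobD n)) : (forall p, ~ F p) -> has_relcell (GlobSF F).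
Proof.
move=> F0; have cg : continuous (idfun : GlobF F -> GlobD n) by move=> x; exact: cvg_id.
have es p : states (GlobDF F p) -> @states R dH (GlobD n) p by move=> [|/F0].
have ep h : @expath R dH (GlobF F) h -> exists q, expath q /\ h = GlobDF F \o q.
  move=> [s0 s1 ne [z [psi [m1 c1 hE]]]]; subst h; exists (globe_pt z \o psi).
  split=> //; exists z, psi; split=> //.
  by apply: pole_path_reparam (conj m1 c1) _ _ ne; [case: s0 => // /F0|case: s1 => // /F0].
by exists (RelcellData (@relcell_one R dH n (GlobF F) (GlobDF F) idfun cg (fun _ => erefl) (fun _ => erefl) es ep)).
Qed.

(** * Cutting a ball along a slice *)

Section HeightCut.
Variables (n : nat) (c : R).
Hypothesis c1 : -1 < c < 1.

(** [None] is the slice, of one dimension less, and is attached before the rest; [Some false] and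
    [Some true] are the parts below and above it, whose mutual order is a convention. *)
Definition cut_lt (x y : option bool) : Prop :=
  match x, y with
  | None, Some _ | Some false, Some true => True
  | _, _ => False
  end.

Definition cut_dim (k : option bool) : nat := if k is Some _ then n.+1 else n.

Definition cut_fun (k : option bool) : diskT R (cut_dim k) -> diskT R n.+1 :=
  match k return diskT R (cut_dim k) -> diskT R n.+1 with
  | None => slice c
  | Some true => slab c 1
  | Some false => slab (-1) c
  end.

Definition cut_inv (k : option bool) : diskT R n.+1 -> diskT R (cut_dim k) :=
  match k return diskT R n.+1 -> diskT R (cut_dim k) with
  | None => tail_disk
  | Some true => slab_inv c 1
  | Some false => slab_inv (-1) c
  end.

Definition cut_region (k : option bool) (x : diskT R n.+1) : Prop :=
  match k with
  | None => height x = c * chord (tail_disk x)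
  | Some true => c * chord (tail_disk x) < height x
  | Some false => height x < c * chord (tail_disk x)
  end.

Let cle : -1 <= c <= 1. Proof. by move: (c1) => /andP[/ltW -> /ltW ->]. Qed.
Let c_lt1 : c < 1. Proof. by case/andP: c1. Qed.
Let c_gtN1 : -1 < c. Proof. by case/andP: c1. Qed.
Let c_leN1 : -1 <= c. Proof. exact: ltW. Qed.
Let c_le1 : c <= 1. Proof. exact: ltW. Qed.

Lemma cut_fun_continuous k : continuous (@cut_fun k).
Proof. by case: k => [[]|]; [exact: slab_continuous|exact: slab_continuous|exact: slice_continuous]. Qed.

Lemma cut_inv_continuous k : continuous (@cut_inv k).
Proof.
by case: k => [[]|]; [exact: slab_inv_continuous|exact: slab_inv_continuous|exact: tail_disk_continuous].
Qed.

Lemma cut_funK k : cancel (@cut_fun k) (@cut_inv k).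
Proof. by case: k => [[]|] x /=; [exact: slabK|exact: slabK|exact: slice_tail]. Qed.

Lemma cut_fun_inner k x : inner x -> inner (cut_fun (k := k) x).
Proof.
by case: k x => [[]|] x ix; [exact: inner_slab|exact: inner_slab|exact: slice_inner].
Qed.

Lemma cut_fun_region k x : inner x -> cut_region k (cut_fun (k := k) x).
Proof.
case: k x => [[]|] x ix /=.
- by rewrite slab_tail; have /andP[] := slab_inner c_leN1 c_lt1 (lexx 1) ix.
- by rewrite slab_tail; have /andP[] := slab_inner (lexx (-1)) c_gtN1 c_le1 ix.
- by rewrite slice_tail slice_height.
Qed.

Lemma cut_inv_region k x : inner x -> cut_region k x ->
  inner (cut_inv k x) /\ cut_fun (cut_inv k x) = x.
Proof.
move=> /[dup] ix /inner_height/andP[h1 h2].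
case: k => [[]|] /= rx.
- have B : c * chord (tail_disk x) < height x < 1 * chord (tail_disk x) by rewrite rx mul1r.
  split; first exact: slab_inv_inner.
  by apply: slab_invK => //; rewrite !ltW ?mul1r.
- have B : -1 * chord (tail_disk x) < height x < c * chord (tail_disk x) by rewrite rx mulN1r h1.
  split; first exact: slab_inv_inner.
  by apply: slab_invK => //; rewrite !ltW ?mulN1r.
- split; first by apply/inner_chord; move: h1 h2; lra.
  by apply: disk_eq; rewrite ?slice_tail // slice_height.
Qed.

Lemma cut_region_cover x : exists k, cut_region k x.
Proof.
by case: (ltgtP (height x) (c * chord (tail_disk x))) => h;
  [exists (Some false)|exists (Some true)|exists None].
Qed.

Lemma cut_region_uniq j k x : cut_region j x -> cut_region k x -> j = k.
Proof.
case: j => [[]|]; case: k => [[]|] //= h h'.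
- by have := lt_trans h h'; rewrite ltxx.
- by move: h; rewrite h' ltxx.
- by have := lt_trans h h'; rewrite ltxx.
- by move: h; rewrite h' ltxx.
- by move: h'; rewrite h ltxx.
- by move: h'; rewrite h ltxx.
Qed.

(* The boundary of a half ball consists of a cap of the sphere and of the slice. *)
Lemma cut_fun_cap s (x : sphereT R n.+1) : 0 <= cap_sign s * val x 0 ord0 ->
  cut_fun (k := Some s) (sphere_disk x) = sphere_disk (cap s (sphere_tail x)).
Proof.
move=> hx; have e := cap_tail hx; rewrite e.
have hE : height (sphere_disk x) = cap_sign s * chord (tail_disk (sphere_disk x)).
  by rewrite -{1}e sphere_disk_cap_height.
case: s {hx e} hE => /= hE; apply: disk_eq; rewrite ?slab_tail // slab_height // hE.
  by rewrite /cap_sign mul1r; lra.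
by rewrite /cap_sign mulN1r; lra.
Qed.

Lemma cut_fun_slice s (x : sphereT R n.+1) : cap_sign s * val x 0 ord0 <= 0 ->
  cut_fun (k := Some s) (sphere_disk x) = slice c (sphere_tail x).
Proof.
move=> hx.
have hE : height (sphere_disk x) = - cap_sign s * chord (tail_disk (sphere_disk x)).
  have r0 := chord_ge0 (tail_disk (sphere_disk x)).
  rewrite /height /=; have := sphere_height x; rewrite -/(sphere_tail x) in r0 *.
  by move: hx; rewrite /cap_sign; case: (s) => hx [] e; rewrite e in hx *; lra.
case: s {hx} hE => /= hE; apply: disk_eq;
  rewrite ?slab_tail ?slice_tail ?slice_height ?slab_height // hE /cap_sign /sphere_tail;
  by rewrite ?mulN1r ?opprK ?mul1r; lra.
Qed.

Definition cut_cell k : mdhom (GlobD (cut_dim k)) (GlobD n.+1) :=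
  GlobD_map (@cut_fun_continuous k).

Lemma cut_cell_int k p : cell_int p -> cell_int (cut_cell k p).
Proof. by case: p => [//|[z u]]; exact: cut_fun_inner. Qed.

Lemma cut_inner z : inner z -> exists k z', inner z' /\ z = cut_fun (k := k) z'.
Proof.
move=> iz; have [k rk] := cut_region_cover z; have [iz' e] := cut_inv_region iz rk.
by exists k, (cut_inv k z).
Qed.

Lemma cut_wf : well_founded cut_lt.
Proof.
have a0 : Acc cut_lt None by apply: Acc_intro => -[[]|] h; case: h.
have a1 : Acc cut_lt (Some false).
  by apply: Acc_intro => -[[]|] h; [case: h|case: h|exact: a0].
case=> [[]|]; [|exact: a1|exact: a0].
by apply: Acc_intro => -[[]|] h; [case: h|exact: a1|exact: a0].
Qed.

(** Openness is tested on complements: the globe, and likewise the boundary of each half, is the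
    union of two closed parts, on each of which the complement is a preimage of a closed set under a
    continuous map. *)
Lemma relcell_cut : relcell (GlobSD n.+1) cut_lt cut_cell.
Proof.
have closedE (T : topologicalType) (U : set T) : open U <-> closed (~` U).
  by rewrite closedC.
have cslice : continuous (globe_map (R := R) (slice (n := n) c)).
  by apply: globe_map_continuous; exact: slice_continuous.
have ctail : continuous (globe_map (R := R) (@sphere_tail R n)).
  by apply: globe_map_continuous; exact: sphere_tail_continuous.
have ccap s : continuous (globe_map (R := R) (fun x : sphereT R n.+1 => cap s (sphere_tail x))).
  apply: globe_map_continuous.
  exact: (continuous_fcomp (@sphere_tail_continuous R n) (@cap_continuous R n s)).
split.
- exact: cut_wf.
- by move=> [[]|] [[]|] [[]|].
- by move=> [[]|] [[]|]; [constructor 2|constructor 3|constructor 3|constructor 1|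
    constructor 2|constructor 3|constructor 1|constructor 1|constructor 2].
- exact: globSD_inj.
- by move=> [b|[y u]] [b' _ //]; exists b.
- move=> x; have [ix|/cell_intNE[q ->]] := pselect (cell_int x); last by constructor 1; exists q.
  case: x ix => [//|[z u]] /= iz; have [k [z' [iz' ->]]] := cut_inner iz.
  by constructor 3; exists k, (inr (z', u)).
- move=> k p a /cut_cell_int ip e; rewrite e in ip; exact: globSD_not_int ip.
- by move=> k [b|[z u]] //= _ [b _].
- move=> k [b|[z u]] [b'|[z' u']] //= iz iz' [e1 <-].
  by rewrite -(cut_funK z) e1 cut_funK.
- move=> j k [b|[z u]] [b'|[z' u']] //= iz iz' [e1 _].
  by apply: (cut_region_uniq (cut_fun_region iz)); rewrite e1; exact: cut_fun_region.
- move=> U _ oU; apply/closedE.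
  pose side s := [set p : globe R (diskT R n.+1) | if p is inr (z, _)
    then 0 <= cap_sign s * (height z - c * chord (tail_disk z)) else True].
  have cside s : closed (side s).
    apply: (@cone_closed R _ [set z | 0 <= cap_sign s * (height z - c * chord (tail_disk z))]).
    apply: (preimage_closed (f := fun z => cap_sign s * (height z - c * chord (tail_disk z)))
      (D := [set x | 0 <= x])); last exact: closed_ge.
    move=> z _; apply: contM; first exact: cont_cst.
    apply: contD; first exact: height_continuous.
    apply: contN; apply: contM; first exact: cont_cst.
    exact: (continuous_fcomp tail_disk_continuous chord_continuous).
  pose W s := globe_map (cut_inv (Some s)) @^-1` (cut_cell (Some s) @^-1` (~` U)).
  have cW s : closed (W s).
    apply: preimage_closed => [x _|]; first by apply: globe_map_continuous; exact: cut_inv_continuous.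
    rewrite preimage_setC; apply/closedE; exact: oU.
  have inv_side s p : side s p -> cut_cell (Some s) (globe_map (cut_inv (Some s)) p) = p.
    case: p => [b|[z u]] //= h; congr (inr (_, _)).
    have /andP[b1 b2] := height_chord z.
    case: s h => /=; rewrite /cap_sign => h; apply: slab_invK => //; move: b1 b2 h.
      by rewrite !mul1r => b1 b2 h; apply/andP; split; lra.
    by rewrite !mulN1r => b1 b2 h; apply/andP; split; lra.
  rewrite (_ : ~` U = (W true `&` side true) `|` (W false `&` side false)).
    by apply: closedU; apply: closedI.
  apply/seteqP; split=> p.
    have [sp|sp] : side true p \/ side false p.
      case: p => [b|[z u]]; [by left|rewrite /side /= /cap_sign].
      by have [h|h] := leP 0 (height z - c * chord (tail_disk z)); [left|right]; lra.
    + by move=> Up; left; split=> //; rewrite /W /preimage /mkset inv_side.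
    + by move=> Up; right; split=> //; rewrite /W /preimage /mkset inv_side.
  by move=> [[Wp sp]|[Wp sp]]; rewrite -(inv_side _ _ sp).
- move=> [s|] U oU oc; last first.
    rewrite (_ : _ @^-1` U = globe_map (@equator R n) @^-1` (GlobSD n.+1 @^-1` U)).
      have := globe_map_continuous (R := R) (@equator_continuous R n).
      by move/continuousP; apply.
    apply/seteqP; split=> p; rewrite /preimage /mkset /=.
      by rewrite !globe_map_comp (globe_map_ext _ (fun y => slice_sphere y cle)).
    by rewrite !globe_map_comp (globe_map_ext _ (fun y => slice_sphere y cle)).
  have oslice : open (globe_map (R := R) (slice c) @^-1` U).
    by case: (s) oc => oc; exact: (oc None).
  pose part s' := [set p : globe R (sphereT R n.+1) | if p is inr (z, _)
    then 0 <= cap_sign s' * val z 0 ord0 else True].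
  have cpart s' : closed (part s').
    apply: (@cone_closed R _ [set z : sphereT R n.+1 | 0 <= cap_sign s' * val z 0 ord0]).
    apply: (preimage_closed (f := fun z : sphereT R n.+1 => cap_sign s' * val z 0 ord0)
      (D := [set x | 0 <= x])); last exact: closed_ge.
    by move=> z _; apply: contM; [exact: cont_cst|exact: sphere_coord_continuous].
  apply/closedE.
  rewrite (_ : ~` _ =
    ((globe_map (fun x : sphereT R n.+1 => cap s (sphere_tail x)) @^-1` (GlobSD n.+1 @^-1` (~` U)))
       `&` part s) `|`
    ((globe_map (@sphere_tail R n) @^-1` (globe_map (slice c) @^-1` (~` U))) `&` part (~~ s))).
    apply: closedU; apply: closedI => //.
      apply: preimage_closed => [x _|]; first exact: ccap.
      by rewrite preimage_setC; apply/closedE.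
    apply: preimage_closed => [x _|]; first exact: ctail.
    by rewrite preimage_setC; apply/closedE.
  have capE p : part s p -> cut_cell (Some s) (GlobSD n.+1 p) =
      GlobSD n.+1 (globe_map (fun x : sphereT R n.+1 => cap s (sphere_tail x)) p).
    by case: p => [b|[x u]] // hx; congr (inr (_, _)); exact: cut_fun_cap.
  have sliceE p : part (~~ s) p -> cut_cell (Some s) (GlobSD n.+1 p) =
      globe_map (slice c) (globe_map (@sphere_tail R n) p).
    case: p => [b|[x u]] // hx; congr (inr (_, _)); apply: cut_fun_slice.
    by move: hx; case: (s); rewrite /cap_sign /= ?mulN1r ?mul1r; lra.
  apply/seteqP; split=> p.
    have [sp|sp] : part s p \/ part (~~ s) p.
      case: p => [b|[z u]]; [by left|rewrite /part /= /cap_sign].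
      by case: (s) => /=; have [h|h] := leP 0 (val z 0 ord0); [left|right|right|left]; lra.
    + move=> Up; left; split=> //; rewrite /preimage /mkset -capE //.
    + move=> Up; right; split=> //; rewrite /preimage /mkset -sliceE //.
  by move=> [[Wp sp]|[Wp sp]] Up; apply: Wp; rewrite -?capE -?sliceE.
- move=> _ [z [phi [rphi ->]]]; apply: gen_reparam => //; apply: gen_base.
  have [iz|[y ->]] := inner_or_sphere z.
    have [k [z' [iz' ->]]] := cut_inner iz.
    by right; exists k, z'; split=> //; apply/funext => t; rewrite /= globe_map_pt.
  left; exists (globe_pt y); split; first exact: expath_globe_pt.
  by apply/funext => t; rewrite /= globe_map_pt.
- have base S (y : sphereT R n.+1) :
      gen (cell_paths (GlobSD n.+1) cut_cell S) (globe_pt (sphere_disk y)).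
    apply: gen_base; left; exists (globe_pt y); split; first exact: expath_globe_pt.
    by apply/funext => t; rewrite /= globe_map_pt.
  have ptE k z : cut_cell k \o globe_pt z = globe_pt (cut_fun z).
    by apply/funext => t; exact: globe_map_pt.
  move=> [s|] z; rewrite ptE; last by rewrite [cut_fun _](slice_sphere z cle); exact: base.
  (* On the cap the fibre lies over the original sphere; on the slice it is a fibre of the cell
     [None], or lies over the equator and so again over the original sphere. *)
  have [h|/ltW h] := leP 0 (cap_sign s * val z 0 ord0).
    by rewrite cut_fun_cap //; exact: base.
  rewrite cut_fun_slice //; have [iz|[y ->]] := inner_or_sphere (sphere_tail z).
    by apply: gen_base; right; exists None, (sphere_tail z); split=> //; rewrite ptE.
  by rewrite slice_sphere //; exact: base.
Qed.

End HeightCut.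

End CellData.

(** * Cutting the globe of a point at one time *)

Section TimeCut.
Context {R : realType} {dH : bool}.
Local Notation I := (@itv01 R).
Local Notation GlobD := (GlobD R dH).
Local Notation GlobS := (GlobS R dH).

Lemma disk0_eq (z z' : diskT R 0) : z = z'.
Proof. by apply: disk_ext => -[]. Qed.

Let z0 : diskT R 0 := to_disk 0.

Lemma globe_time01 (Z : topologicalType) (p : globe R Z) : 0 <= globe_time p <= 1.
Proof.
case: p => [[]|[z u]] /=; rewrite ?lexx ?ler01 //.
by have /andP[/ltW -> /ltW ->] := opn01P u.
Qed.

Lemma globe0_pt (p : globe R (diskT R 0)) : p = globe_pt z0 (clamp (globe_time p)).
Proof.
have [z [t ->]] := globe_pt_surj z0 p.
by rewrite globe_time_pt valcK (disk0_eq z z0).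
Qed.

Lemma globe0_time_inj (p q : globe R (diskT R 0)) : globe_time p = globe_time q -> p = q.
Proof. by move=> e; rewrite (globe0_pt p) (globe0_pt q) e. Qed.

Lemma cell_int0 (p : globe R (diskT R 0)) : cell_int p <-> 0 < globe_time p < 1.
Proof.
case: p => [[]|[z u]] /=; split=> //; rewrite ?ltxx ?andbF //.
  by rewrite opn01P.
by move=> _; rewrite /inner /sqnorm big_ord0 ltr01.
Qed.

Lemma globS0_open (U : set (GlobS 0)) : open U.
Proof.
rewrite globe_openE => n s cs; rewrite (_ : _ @^-1` _ = setT); first exact: openT.
by apply/seteqP; split=> // x _; case: (sphere0 (s x).1).
Qed.

Lemma globS0_pole (q : GlobS 0) : exists b, q = globe_pole b.
Proof. by case: q => [b|[y u]]; [exists b|case: (sphere0 y)]. Qed.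

Variable tau : R.
Hypothesis tau01 : 0 < tau < 1.

(** [false] is the segment [0, tau] and [true] the segment [tau, 1]: as the disk of dimension 0 is a
    point, its globe is an interval. *)
Definition seg_start (k : bool) : R := if k then tau else 0.
Definition seg_len (k : bool) : R := if k then 1 - tau else tau.

Definition seg_fun k (p : globe R (diskT R 0)) : globe R (diskT R 0) :=
  globe_pt z0 (affine_path (seg_start k) (seg_len k) (clamp (globe_time p))).

Definition seg_inv k (p : globe R (diskT R 0)) : globe R (diskT R 0) :=
  globe_pt z0 (clamp ((globe_time p - seg_start k) / seg_len k)).

Definition cut_pt : GlobD 0 := globe_pt z0 (clamp tau).

Let seg_len_gt0 k : 0 < seg_len k.
Proof. by move: (tau01) => /andP[t0 t1]; case: k; rewrite /seg_len ?subr_gt0. Qed.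

Let seg_range k (x : R) : 0 <= x <= 1 -> 0 <= seg_start k + seg_len k * x <= 1.
Proof.
move: (tau01) => /andP[t0 t1] /andP[x0 x1]; case: k; rewrite /seg_start /seg_len.
  have p1 : 0 <= (1 - tau) * x by apply: mulr_ge0; lra.
  have p2 : 0 <= (1 - tau) * (1 - x) by apply: mulr_ge0; lra.
  by apply/andP; split; lra.
have p1 : 0 <= tau * x by apply: mulr_ge0; lra.
have p2 : 0 <= tau * (1 - x) by apply: mulr_ge0; lra.
by apply/andP; split; lra.
Qed.

Lemma seg_fun_time k p : globe_time (seg_fun k p) = seg_start k + seg_len k * globe_time p.
Proof.
by rewrite globe_time_pt clampK clampK ?globe_time01 // seg_range // globe_time01.
Qed.

Lemma seg_fun_pt k z (t : I) :
  seg_fun k (globe_pt z t) = globe_pt z0 (affine_path (seg_start k) (seg_len k) t).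
Proof. by rewrite /seg_fun globe_time_pt valcK. Qed.

Lemma seg_fun_continuous k : continuous (seg_fun k).
Proof.
apply: (continuous_fcomp (f := fun p => affine_path (seg_start k) (seg_len k)
    (clamp (globe_time p)))); last exact: globe_pt_continuous.
apply: (continuous_fcomp (f := fun p : globe R (diskT R 0) => clamp (globe_time p))).
  exact: (continuous_fcomp (@globe_time_continuous _ _) (@clamp_continuous R)).
exact: (affine_path_monotone _ (ltW (seg_len_gt0 k))).2.
Qed.

Lemma seg_inv_continuous k : continuous (seg_inv k).
Proof.
apply: (continuous_fcomp (f := fun p : globe R (diskT R 0) =>
  clamp ((globe_time p - seg_start k) / seg_len k))); last exact: globe_pt_continuous.
apply: continuous_fcomp (@clamp_continuous R).
apply: contM; last exact: cont_cst.
by apply: contD; [exact: globe_time_continuous|exact: cont_cst].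
Qed.

Lemma seg_funK k : cancel (seg_fun k) (seg_inv k).
Proof.
move=> p; rewrite /seg_inv seg_fun_time [_ + _ - _]addrC addKr.
by rewrite [_ * _ / _]mulrC mulKf ?gt_eqF // -globe0_pt.
Qed.

Lemma seg_invK k p : seg_start k <= globe_time p <= seg_start k + seg_len k ->
  seg_fun k (seg_inv k p) = p.
Proof.
move=> /andP[h1 h2]; apply: globe0_time_inj; rewrite seg_fun_time globe_time_pt.
rewrite clampK; first by rewrite mulrC divfK ?gt_eqF // addrC subrK.
by rewrite divr_ge0 ?(ltW (seg_len_gt0 k)) ?subr_ge0 //= ler_pdivrMr // mul1r lerBlDl.
Qed.

Lemma seg_fun_inj k : injective (seg_fun k).
Proof. exact: can_inj (seg_funK k). Qed.

Lemma seg_int k p : cell_int p ->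
  seg_start k < globe_time (seg_fun k p) < seg_start k + seg_len k.
Proof.
move=> /cell_int0/andP[h1 h2]; rewrite seg_fun_time ltrDl ltrD2l.
by rewrite mulr_gt0 //= gtr_pMr.
Qed.

Lemma seg_fun_int k p : cell_int p -> cell_int (seg_fun k p).
Proof.
move=> /(seg_int k) /andP[h1 h2]; apply/cell_int0.
move: (tau01) h1 h2 => /andP[t0 t1]; case: (k); rewrite /seg_start /seg_len => h1 h2.
  by apply/andP; split; lra.
by apply/andP; split; lra.
Qed.

Section Segments.
Variable F : set (GlobD 0).
Hypothesis F_cut : F cut_pt.
Hypothesis F_int : forall p, F p -> cell_int p.

Definition seg_F k : set (GlobD 0) := [set p | cell_int p /\ F (seg_fun k p)].

Lemma seg_state k p : globF_state (seg_F k) p -> globF_state F (seg_fun k p).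
Proof.
case=> [[b _ <-]|[_ Fp]]; last by right.
have e (x : R) (q : globe R (diskT R 0)) : globe_time q = x -> 
    globe_time (seg_fun k (globe_pole b)) = x -> seg_fun k (globe_pole b) = q.
  by move=> qx sx; apply: globe0_time_inj; rewrite qx.
have ct : globe_time cut_pt = tau.
  by rewrite globe_time_pt clampK //; move: (tau01) => /andP[/ltW -> /ltW ->].
case: k b e => -[] e.
- left; exists true => //; rewrite (e 1 (globe_pole true)) // seg_fun_time /=.
  by rewrite mulr1 addrC subrK.
- by right; rewrite (e tau cut_pt) // seg_fun_time /= mulr0 addr0.
- by right; rewrite (e tau cut_pt) // seg_fun_time /= mulr1 add0r.
- by left; exists false => //; rewrite (e 0 (globe_pole false)) // seg_fun_time /= mulr0 addr0.
Qed.

Lemma seg_stateE k (z : diskT R 0) (t : I) :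
  globF_state F (seg_fun k (globe_pt z t)) -> globF_state (seg_F k) (globe_pt z t).
Proof.
move=> h; have [it|/(@cell_intNE R dH 0)[q qE]] := pselect (cell_int (globe_pt (R := R) z t)); last first.
  by left; have [b qb] := globS0_pole q; exists b => //; rewrite qE qb.
right; split=> //; case: h => // -[b _ e].
by have := seg_fun_int k it; rewrite -e.
Qed.

Definition seg_hom k : mdhom (GlobF (seg_F k)) (GlobF F).
Proof.
apply: (@MDHom R dH (GlobF (seg_F k)) (GlobF F) (seg_fun k)).
- exact: seg_fun_continuous.
- exact: seg_state.
- move=> g [s0 s1 ne [z [psi [m1 c1 gE]]]]; subst g.
  have -> : seg_fun k \o (globe_pt z \o psi) =
      globe_pt z0 \o (affine_path (seg_start k) (seg_len k) \o psi).
    by apply/funext => t; exact: seg_fun_pt.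
  apply: globF_path.
  + apply: monotone_path_comp => //; apply: affine_path_monotone.
    exact: ltW (seg_len_gt0 k).
  + by have := seg_state s0; rewrite /= seg_fun_pt.
  + by have := seg_state s1; rewrite /= seg_fun_pt.
  + by move=> e; apply: ne; apply: (@seg_fun_inj k); rewrite /= !seg_fun_pt.
Defined.

(** The full fibre is generated by the two segments, and [gen_cut] breaks any directed path at
    [tau]; its constant alternative contradicts the distinctness of the ends. *)
Lemma seg_paths h : @expath R dH (GlobF F) h ->
  gen [set h | exists k q, expath q /\ h = seg_hom k \o q] h.
Proof.
move=> [s0 s1 ne [z [psi [m1 c1 hE]]]]; subst h; rewrite (disk0_eq z z0) in s0 s1 ne *.
pose P : set (I -> GlobD 0) := [set h | exists k, h = seg_fun k \o globe_pt z0].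
have G : gen P (globe_pt z0).
  have tv : val (@clamp R tau) = tau.
    by rewrite clampK //; move: (tau01) => /andP[/ltW -> /ltW ->].
  apply: (@gen_glue _ _ _ _ (clamp tau)); rewrite tv //.
    by apply: gen_base; exists false; apply/funext => t; rewrite /= seg_fun_pt.
  by apply: gen_base; exists true; apply/funext => t; rewrite /= seg_fun_pt.
have [||//|//|//|cst] := @gen_cut R _ (globF_state F) P
  [set h | exists k q, expath q /\ h = seg_hom k \o q] _ _ _ psi G (conj m1 c1).
- move=> _ [k ->]; split; apply: seg_state; left.
    by exists false => //=; rewrite globe_pt0.
  by exists true => //=; rewrite globe_pt1.
- move=> _ phi [k ->] mphi /= S0 S1.
  have [cst|ne'] := globF_path_const z0 mphi; first by right=> t; rewrite cst.
  left; apply: gen_base; exists k, (globe_pt z0 \o phi); split=> //.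
  by apply: globF_path => //; exact: (seg_stateE (k := k)).
by case: ne; rewrite /= cst.
Qed.

End Segments.

Let F1 : set (GlobD 0) := [set cut_pt].

Let cut_time : globe_time cut_pt = tau.
Proof. by rewrite globe_time_pt clampK //; move: (tau01) => /andP[/ltW -> /ltW ->]. Qed.

Definition seg_cell k : mdhom (GlobD 0) (GlobF F1) :=
  seg_hom (F := F1) erefl k \oM GlobDF (seg_F F1 k).

Let F1_empty k p : ~ seg_F F1 k p.
Proof.
move=> [/(seg_int k) + e]; rewrite e cut_time => /andP[].
by case: k {e}; rewrite /seg_start /seg_len ?add0r ltxx.
Qed.

(** A time cut, unlike a slice, turns the cut point into a state, so the target is [GlobF] with this
    single added state. Both cells have an empty sphere as boundary and are attached along states
    only. *)
Lemma relcell_time_cut : relcell (GlobSF F1) (fun x y => ~~ x && y) seg_cell.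
Proof.
have closedE (T : topologicalType) (U : set T) : open U <-> closed (~` U).
  by rewrite closedC.
have [t0 t1] : 0 < tau /\ tau < 1 by apply/andP.
have inv_int k p : seg_start k < globe_time p < seg_start k + seg_len k ->
    exists q, cell_int q /\ p = seg_fun k q.
  move=> /andP[h1 h2]; exists (seg_inv k p); split; last first.
    by rewrite seg_invK // (ltW h1) ltW.
  apply/cell_int0; rewrite globe_time_pt clampK.
    by rewrite divr_gt0 ?subr_gt0 //= ltr_pdivrMr // mul1r ltrBlDl.
  rewrite divr_ge0 ?subr_ge0 ?(ltW h1) ?(ltW (seg_len_gt0 k)) //=.
  by rewrite ler_pdivrMr // mul1r lerBlDl ltW.
split.
- have af : Acc (fun x y => is_true (~~ x && y)) false by apply: Acc_intro => -[] h; discriminate h.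
  by case; [apply: Acc_intro => -[] h; [discriminate h|exact: af]|exact: af].
- by case=> [] [] [].
- by case=> [] []; [constructor 2|constructor 3|constructor 1|constructor 2].
- by move=> x y /(@globSD_inj R dH 0).
- by move=> a _; have [b ->] := globS0_pole a; exists b.
- move=> p; have [ip|/(@cell_intNE R dH 0)[q ->]] := pselect (cell_int p); last first.
    by constructor 1; exists q.
  have /cell_int0/andP[h0 h1] := ip; case: (ltgtP (globe_time p) tau) => ht.
  + constructor 3; have [|q [iq e]] := inv_int false p; last by exists false, q.
    by rewrite /seg_start /seg_len add0r h0.
  + constructor 3; have [|q [iq e]] := inv_int true p; last by exists true, q.
    by rewrite /seg_start /seg_len addrC subrK ht.
  + by constructor 2; right; apply: globe0_time_inj; rewrite ht cut_time.
- move=> k p a ip e; have := seg_fun_int k ip.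
  by rewrite [seg_fun k p]e; exact: (@globSD_not_int R dH 0 a).
- move=> k p ip [[b _ e]|e].
    by have := seg_fun_int k ip; rewrite -[seg_fun k p]e.
  by apply: (@F1_empty k p); split.
- by move=> k p p' _ _ /seg_fun_inj.
- move=> j k p p' ip ip' e; have := seg_int j ip; have := seg_int k ip'.
  rewrite -[seg_fun k p']e /seg_start /seg_len.
  case: j {e}; case: k => // /andP[h1 h2] /andP[h3 h4]; exfalso.
    by rewrite add0r in h2; have := lt_trans h2 h3; rewrite ltxx.
  by rewrite add0r in h4; have := lt_trans h4 h1; rewrite ltxx.
- move=> U _ oU; apply/closedE.
  pose side (k : bool) := [set p : globe R (diskT R 0) |
    seg_start k <= globe_time p <= seg_start k + seg_len k].
  have cside k : closed (side k).
    have -> : side k = (@globe_time R _ @^-1` [set x | seg_start k <= x]) `&`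
        (@globe_time R _ @^-1` [set x | x <= seg_start k + seg_len k]).
      by apply/seteqP; split=> p /=; [move=> /andP[]|move=> [? ?]; apply/andP].
    apply: closedI; apply: preimage_closed.
    - by move=> x _; exact: globe_time_continuous.
    - exact: closed_ge.
    - by move=> x _; exact: globe_time_continuous.
    - exact: closed_le.
  have cW k : closed (seg_inv k @^-1` (seg_cell k @^-1` (~` U))).
    apply: preimage_closed => [x _|]; first exact: seg_inv_continuous.
    by rewrite preimage_setC; apply/closedE; exact: oU.
  rewrite (_ : ~` U = (seg_inv true @^-1` (seg_cell true @^-1` (~` U)) `&` side true) `|`
    (seg_inv false @^-1` (seg_cell false @^-1` (~` U)) `&` side false)).
    by apply: closedU; apply: closedI; [exact: cW|exact: cside|exact: cW|exact: cside].
  have inv_side k p : side k p -> seg_cell k (seg_inv k p) = p := @seg_invK k p.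
  apply/seteqP; split=> p.
    have [sp|sp] : side true p \/ side false p.
      rewrite /side /= addrC subrK add0r; have /andP[-> ->] := globe_time01 p.
      by have [h|/ltW h] := leP tau (globe_time p); [left|right].
    + by move=> Up; left; split=> //; rewrite /preimage /mkset inv_side.
    + by move=> Up; right; split=> //; rewrite /preimage /mkset inv_side.
  by move=> [[Wp sp]|[Wp sp]]; rewrite -(inv_side _ _ sp).
- by move=> k U _ _; exact: globS0_open.
- move=> h /(seg_paths (F := F1) erefl); apply: gen_trans => _ [k [q [eq ->]]].
  case: eq => s0 s1 ne [z [psi [m1 c1 qE]]]; subst q.
  have rpsi : reparam psi.
    apply: (pole_path_reparam (conj m1 c1) _ _ ne).
      by case: s0 => // /F1_empty.
    by case: s1 => // /F1_empty.
  apply: (@gen_reparam R _ _ (seg_cell k \o globe_pt z) psi) => //.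
  apply: gen_base; right; exists k, z; split=> //.
  by rewrite /inner /sqnorm big_ord0 ltr01.
- by move=> k z; case: (sphere0 z).
Qed.

(** The identity of the underlying space is a refinement in which each of the two segments receives
    the points of [F] in its interior. *)
Lemma has_relcell_time_cut (F : set (GlobD 0)) : F cut_pt ->
  (forall p, F p -> cell_int p) ->
  (forall k, has_relcell (GlobSF (seg_F F k))) -> has_relcell (GlobSF F).
Proof.
move=> Fc Fi H.
have F1F : F1 `<=` F by move=> p ->.
have ce : continuous (idfun : GlobF F1 -> GlobF F) by move=> x; exact: cvg_id.
have st p : globF_state F1 p -> globF_state F p by case=> [s|/F1F Fp]; [left|right].
have e3 g : @expath R dH (GlobF F1) g -> @expath R dH (GlobF F) (idfun \o g).
  by move=> [s0 s1 ne gE]; split=> //; exact: st.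
pose e := @MDHom R dH (GlobF F1) (GlobF F) idfun ce st e3.
have cg : continuous (idfun : GlobF F -> GlobF F1) by move=> x; exact: cvg_id.
have := @has_relcell_refine R dH _ _ _ _ _ _ _ _ e idfun (seg_F F) (fun k => seg_hom Fc k)
  relcell_time_cut cg (fun _ => erefl) (fun _ => erefl).
have -> : e \oM GlobSF F1 = GlobSF F by apply: mdhom_ext.
apply=> //.
- by move=> k p [].
- move=> p [s|Fp]; first by left; left.
  have [[a e1]|sp|[k [q [iq e1]]]] := rc_cover relcell_time_cut p.
  + by have := Fi _ Fp; rewrite e1 => /(@globSD_not_int R dH 0 a).
  + by left.
  + by right; exists k, q; split=> //; split=> //; rewrite -[seg_fun k q]e1.
- move=> h /(seg_paths Fc); apply: gen_sub => _ [k [q [eq ->]]].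
  by right; exists k, q.
Qed.

End TimeCut.

(** * Globes with finitely many added states, and globes of spheres *)

Section GlobFCells.
Context {R : realType} {dH : bool}.
Local Notation mdspace := (mdspace R dH).
Local Notation GlobD := (GlobD R dH).
Local Notation GlobS := (GlobS R dH).
Local Notation GlobSD := (GlobSD R dH).

Definition cut_F n c (F : set (GlobD n.+1)) k : set (GlobD (cut_dim n k)) :=
  [set p | cell_int p /\ F (globe_map (cut_fun c (k := k)) p)].

(** A slice does not break fibres: an interior fibre belongs to a single part, so a path over it is
    one path of that part. Over the sphere only the poles are states. *)
Lemma has_relcell_height_cut n c (F : set (GlobD n.+1)) : -1 < c < 1 ->
  (forall p, F p -> cell_int p) ->
  (forall k, has_relcell (GlobSF (cut_F c F (k := k)))) -> has_relcell (GlobSF F).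
Proof.
move=> c1 Fi H.
pose b k : mdhom (GlobF (cut_F c F (k := k))) (GlobF F) :=
  globF_map (@cut_fun_continuous R n c k) (fun p => @proj2 _ _).
have cg : continuous (idfun : GlobF F -> GlobD n.+1) by move=> x; exact: cvg_id.
have := @has_relcell_refine R dH _ _ _ _ _ _ _ _ (GlobDF F) idfun (@cut_F n c F) b
  (relcell_cut n c1) cg (fun _ => erefl) (fun _ => erefl).
apply=> //.
- by move=> k p [].
- move=> p [s|Fp]; first by left.
  have [[a e1]|sp|[k [q [iq e1]]]] := rc_cover (relcell_cut (dH := dH) n c1) p.
  + by have := Fi _ Fp; rewrite e1 => /globSD_not_int.
  + by left.
  + by right; exists k, q; split=> //; split=> //; rewrite -[globe_map _ _]e1.
- move=> h [s0 s1 ne [z [psi [m p hE]]]]; subst h.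
  have [iz|[y zy]] := inner_or_sphere z; last first.
    subst z; apply: gen_base; left; exists (globe_pt y \o psi).
    split; first by exists y, psi; split=> //; exact: (sphere_path Fi (conj m p) s0 s1 ne).
    by apply/funext => t; rewrite /= globe_map_pt.
  have [k [z' [iz' e]]] := cut_inner c1 iz; subst z.
  apply: gen_base; right; exists k, (globe_pt z' \o psi); split; last first.
    by apply/funext => t; rewrite /= globe_map_pt.
  have st t : globF_state F (globe_pt (cut_fun c z') t) ->
      globF_state (cut_F c F (k := k)) (globe_pt z' t).
    case=> [s|Ft].
      left; case: s => b' _ e'; have [[_ ->]|[_ ->]|[u [_ e'']]] := globe_ptP z' t.
      - by exists false.
      - by exists true.
      - by have := globe_map_pt (cut_fun c (k := k)) z' t; rewrite e'' -e'.
    right; split; last by rewrite globe_map_pt.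
    by have /cell_int_pt[_ ht] := Fi _ Ft; apply/cell_int_pt.
  apply: globF_path; [by []|exact: st|exact: st|exact: globe_pt_neq ne].
Qed.

(** An upper bound instead of the exact number of points, because bounds are inherited by subsets
    and by preimages under injections. *)
Definition sized n (F : set (GlobD n)) (N : nat) :=
  exists2 s : seq (GlobD n), (size s <= N)%N & forall p, F p -> p \in s.

Lemma sized_pullback m n (F : set (GlobD n)) (F' : set (GlobD m)) (f : GlobD m -> GlobD n)
    (g : GlobD n -> GlobD m) N : cancel f g -> (forall p, F' p -> F (f p)) ->
  sized F N -> sized F' N.
Proof.
move=> fK F'F [s sN Fs]; exists (map g s); first by rewrite size_map.
by move=> p /F'F/Fs fp; apply/mapP; exists (f p).
Qed.

Lemma sized_pred n (F : set (GlobD n)) p N : F p -> sized F N.+1 ->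
  sized [set q | F q /\ q <> p] N.
Proof.
move=> Fp [s sN Fs]; exists [seq q <- s | q != p].
  rewrite -ltnS; apply: leq_trans sN.
  rewrite -(count_predC (pred1 p) s) size_filter -[X in (X < _)%N]add0n ltn_add2r.
  by rewrite -has_count has_pred1 Fs.
by move=> q [/Fs qs /eqP qp]; rewrite mem_filter qp.
Qed.

Lemma globF_has_relcell n (F : set (GlobD n)) : finite_set F ->
  (forall p, F p -> cell_int p) -> has_relcell (GlobSF F).
Proof.
suff H : forall n N (F : set (GlobD n)), (forall p, F p -> cell_int p) -> sized F N ->
    has_relcell (GlobSF F).
  move=> /finite_seqP[s Fs] Fi; apply: (H n (size s)) => //.
  by exists s => // p; rewrite Fs.
move=> {n F}; elim=> [|n IHn]; elim=> [|N IHN] F Fi sF.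
- case: sF => [[|//] _ Fs]; apply: globF_relcell0 => p /Fs; by rewrite in_nil.
- have [[p Fp]|nF] := pselect (exists p, F p); last first.
    by apply: globF_relcell0 => p Fp; apply: nF; exists p.
  have t01 : 0 < globe_time p < 1 by apply/cell_int0; exact: Fi.
  have e : cut_pt (dH := dH) (globe_time p) = p by rewrite /cut_pt -globe0_pt.
  apply: (has_relcell_time_cut t01) => //; first by rewrite e.
  move=> k; apply: IHN => [q []//|].
  (* The cut point [p] is interior to neither segment, which lowers the bound. *)
  apply: (sized_pullback (f := seg_fun (globe_time p) k) (seg_funK t01 k) _ (sized_pred Fp sF)).
  move=> q [iq Fq]; split=> // qp; have := seg_int t01 k iq; rewrite qp => /andP[].
  by case: (k); rewrite /seg_start /seg_len ?add0r ltxx.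
- case: sF => [[|//] _ Fs]; apply: globF_relcell0 => p /Fs; by rewrite in_nil.
have [[p Fp]|nF] := pselect (exists p, F p); last first.
  by apply: globF_relcell0 => p Fp; apply: nF; exists p.
have := Fi _ Fp; case: p Fp => [//|[x u]] /= Fp ix.
have /inner_height/andP[h1 h2] := ix.
have r0 : 0 < chord (tail_disk x) by lra.
(* The ratio for which the slice passes through [x]; the chord is positive because [x] is
   interior. *)
pose c := height x / chord (tail_disk x).
have c1 : -1 < c < 1 by rewrite /c ltr_pdivlMr // ltr_pdivrMr // mulN1r mul1r h1.
have hc : height x = c * chord (tail_disk x) by rewrite /c divfK ?gt_eqF.
have cutK k : cancel (globe_map (R := R) (@cut_fun R n c k)) (globe_map (cut_inv c k)).
  by case=> [b|[z v]] //=; rewrite (cut_funK c1).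
(* The slice may contain all points of [F], but its dimension is smaller; the halves keep the
   dimension, but [x] is interior to neither. *)
apply: (has_relcell_height_cut c1) => //; case=> [s|]; last first.
  case: (sF) => s _ Fs; apply: (IHn (size s)) => [q []//|].
  apply: (@sized_pullback n n.+1 F (@cut_F n c F None) _ _ (size s) (cutK None)).
    by move=> q [].
  by exists s.
apply: IHN => [q []//|].
apply: (@sized_pullback n.+1 n.+1 _ (@cut_F n c F (Some s)) _ _ _ (cutK (Some s)) _
  (sized_pred Fp sF)) => q [iq Fq]; split=> // e.
case: q iq {Fq} e => [//|[z v]] /= iz [e _].
have := cut_fun_region c1 (k := Some s) iz; rewrite [cut_fun _ _]e.
by case: (s) => /=; rewrite hc ltxx.
Qed.

Definition equator_map n : mdhom (GlobS n) (GlobS n.+1) :=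
  Glob_map R dH (rV_hausdorff (A := _)) (rV_hausdorff (A := _)) (@equator_continuous R n).

Definition cap_map n b : mdhom (GlobD n) (GlobS n.+1) :=
  Glob_map R dH (rV_hausdorff (A := _)) (rV_hausdorff (A := _)) (@cap_continuous R n b).

Lemma equator_inj n : injective (@equator R n).
Proof.
move=> y y' e; apply: (@sphere_disk_inj R n).
by rewrite -(sphere_disk_cap_tail true (sphere_disk y)) -/(equator y) e sphere_disk_cap_tail.
Qed.

Lemma globe_inr_inj (Z : topologicalType) (z z' : Z) (u u' : @opn01 R) :
  inr (z, u) = inr (z', u') :> globe R Z -> z = z' /\ u = u'.
Proof. by case. Qed.

(** A sphere is its equator with two hemispheres attached; iterated from the empty sphere, this
    makes globes of spheres cellular. *)
Lemma relcell_equator n : relcell (equator_map n) (fun x y => ~~ x && y) (@cap_map n).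
Proof.
have closedE (T : topologicalType) (U : set T) : open U <-> closed (~` U).
  by rewrite closedC.
have cap_inj b b' (y y' : diskT R n) : cap b y = cap b' y' -> y = y'.
  by move=> e; rewrite -(sphere_disk_cap_tail b y) e sphere_disk_cap_tail.
have sd_cap_eq b (y : sphereT R n) : cap b (sphere_disk y) = equator y := cap_equator b y.
have ptE b (z : diskT R n) : cap_map n b \o globe_pt z = globe_pt (cap b z).
  by apply/funext => t; exact: globe_map_pt.
have eqE (y : sphereT R n) : equator_map n \o globe_pt y = globe_pt (equator y).
  by apply/funext => t; exact: globe_map_pt.
split.
- have af : Acc (fun x y => is_true (~~ x && y)) false by apply: Acc_intro => -[] h; discriminate h.
  by case; [apply: Acc_intro => -[] h; [discriminate h|exact: af]|exact: af].
- by case=> [] [] [].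
- by case=> [] []; [constructor 2|constructor 3|constructor 1|constructor 2].
- exact/globe_map_inj/equator_inj.
- by move=> [b|[y u]] [b' _ //]; exists b.
- case=> [b|[z u]]; first by constructor 1; exists (globe_pole b).
  have [b bE] := sphere_cap z; have [iz|[y yE]] := inner_or_sphere (sphere_tail z).
    by constructor 3; exists b, (inr (sphere_tail z, u)); split=> //=; rewrite bE.
  by constructor 1; exists (inr (y, u)); rewrite /= -bE yE sd_cap_eq.
- move=> b [//|[z u]] [//|[y v]] iz /globe_inr_inj[e _].
  by rewrite /cell_int (cap_inj b true _ _ e) in iz; exact: sphere_not_inner iz.
- by move=> b [//|[z u]] /= _ [b' _].
- by move=> b [//|[z u]] [//|[z' u']] iz iz' /globe_inr_inj[/cap_inj -> ->].
- move=> b b' [//|[z u]] [//|[z' u']] /inner_chord r0 _ /globe_inr_inj[e _].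
  have zz := cap_inj _ _ _ _ e; subst z'.
  have := congr1 (fun x => height (sphere_disk x)) e.
  rewrite !sphere_disk_cap_height => /(mulIf (negbT (gt_eqF r0))).
  by case: b {e}; case: b' => //; rewrite /cap_sign => ?; exfalso; lra.
- move=> U _ oU; apply/closedE.
  pose part b := [set p : globe R (sphereT R n.+1) | if p is inr (z, _)
    then 0 <= cap_sign b * val z 0 ord0 else True].
  have cpart b : closed (part b).
    apply: (@cone_closed R _ [set z : sphereT R n.+1 | 0 <= cap_sign b * val z 0 ord0]).
    apply: (preimage_closed (f := fun z : sphereT R n.+1 => cap_sign b * val z 0 ord0)
      (D := [set x | 0 <= x])); last exact: closed_ge.
    by move=> z _; apply: contM; [exact: cont_cst|exact: sphere_coord_continuous].
  have cW b : closed (globe_map (@sphere_tail R n) @^-1` (cap_map n b @^-1` (~` U))).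
    apply: preimage_closed => [x _|].
      by apply: globe_map_continuous; exact: sphere_tail_continuous.
    by rewrite preimage_setC; apply/closedE; exact: oU.
  have partE b p : part b p -> cap_map n b (globe_map (@sphere_tail R n) p) = p.
    by case: p => [b'|[z u]] // h; congr (inr (_, _)); exact: cap_tail.
  rewrite (_ : ~` U =
    (globe_map (@sphere_tail R n) @^-1` (cap_map n true @^-1` (~` U)) `&` part true) `|`
    (globe_map (@sphere_tail R n) @^-1` (cap_map n false @^-1` (~` U)) `&` part false)).
    by apply: closedU; apply: closedI.
  apply/seteqP; split=> p.
    have [sp|sp] : part true p \/ part false p.
      case: p => [b|[z u]]; [by left|rewrite /part /= /cap_sign].
      by have [h|h] := leP 0 (val z 0 ord0); [left|right]; lra.
    + by move=> Up; left; split=> //; rewrite /preimage /mkset partE.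
    + by move=> Up; right; split=> //; rewrite /preimage /mkset partE.
  by move=> [[Wp sp]|[Wp sp]]; rewrite -(partE _ _ sp).
- move=> b U oU _; rewrite (_ : _ @^-1` U = equator_map n @^-1` U) //.
  by apply/seteqP; split=> p; rewrite /preimage /mkset /= globe_map_comp
    (globe_map_ext _ (sd_cap_eq b)).
- move=> _ [z [phi [rphi ->]]]; apply: gen_reparam => //; apply: gen_base.
  have [b bE] := sphere_cap z; have [iz|[y yE]] := inner_or_sphere (sphere_tail z).
    by right; exists b, (sphere_tail z); rewrite ptE bE.
  left; exists (globe_pt y); split; first exact: expath_globe_pt.
  by rewrite eqE -(sd_cap_eq b) -yE bE.
- move=> b y; rewrite ptE sd_cap_eq -eqE; apply: gen_base; left.
  by exists (globe_pt y); split=> //; exact: expath_globe_pt.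
Qed.

Lemma has_relcell_comp (A B C : mdspace) (i : mdhom A B) (j : mdhom B C) :
  has_relcell i -> has_relcell j -> has_relcell (j \oM i).
Proof. by move=> [d _] [d' _]; exists (RelcellData (relcell_comp (rd_rc d) (rd_rc d'))). Qed.

Lemma from_empty_comp (B C : mdspace) (j : mdhom B C) : j \oM from_empty B = from_empty C.
Proof. by apply: mdhom_ext => -[]. Qed.

Lemma globS_has_relcell n : has_relcell (from_empty (GlobS n)).
Proof.
elim: n => [|n IH]; last first.
  rewrite -(from_empty_comp (equator_map n)); apply: has_relcell_comp IH _.
  by exists (RelcellData (relcell_equator n)).
have cvoid k : mdhom (GlobD (match k : void return nat with end)) (GlobS 0) by case: k.
have rc : relcell (from_empty (GlobS 0)) (fun _ _ : void => False) cvoid.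
  split=> //; try by case.
  - by move=> x; constructor 2; have [b ->] := globS0_pole x; exists b.
  - by move=> U _ _; exact: globS0_open.
  - by move=> h [z]; case: (sphere0 z).
by exists (RelcellData rc).
Qed.

Lemma has_relcell_cellular (X : mdspace) : has_relcell (from_empty X) -> cellular X.
Proof. by move=> [d _]; exact: cellular_relcell (rd_rc d). Qed.

Lemma has_relcell_q_cofibration (A X : mdspace) (i : mdhom A X) :
  has_relcell i -> q_cofibration i.
Proof. by move=> [d _]; exact: q_cofibration_relcell (rd_rc d). Qed.

Lemma globF_cellular n (F : set (GlobD n)) : has_relcell (GlobSF F) -> cellular (GlobF F).
Proof.
move=> h; apply: has_relcell_cellular; rewrite -(from_empty_comp (GlobSF F)).
exact: has_relcell_comp (globS_has_relcell n) h.
Qed.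

Lemma globD_cellular n : cellular (GlobD n).
Proof.
apply: has_relcell_cellular; rewrite -(from_empty_comp (GlobSD n)).
apply: has_relcell_comp (globS_has_relcell n) _.
have cg : continuous (idfun : GlobD n -> GlobD n) by move=> x; exact: cvg_id.
have := @relcell_one R dH n (GlobD n) (mdid _) idfun cg (fun _ => erefl) (fun _ => erefl)
  (fun _ => id) (fun h eh => ex_intro _ h (conj eh erefl)).
have -> : mdid (GlobD n) \oM GlobSD n = GlobSD n by apply: mdhom_ext.
by move=> rc; exists (RelcellData rc).
Qed.

Lemma globDF_subdivision n (F : set (GlobD n)) : finite_set F ->
  (forall p, F p -> cell_int p) -> globular_subdivision (GlobDF F).
Proof.
move=> Ff Fi; split; first exact: globD_cellular.
  exact/globF_cellular/globF_has_relcell.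
by exists idfun; split=> // x; exact: cvg_id.
Qed.

End GlobFCells.

(** * Cells of cellular spaces *)

Section DecompositionRelcell.
Context {R : realType} {dH : bool}.
Local Notation I := (@itv01 R).
Local Notation mdspace := (mdspace R dH).
Local Notation GlobSD := (GlobSD R dH).
Context {X : mdspace} (D : cellular_decomposition X).
Local Notation T := (cd_tower D).
Implicit Types u v w : cd_ord D.

Let cells u v (h : is_succ u v) : cell_attachment T h := cd_cell h.

Lemma cd_relcell : relcell (from_empty X) (@pair_lt _ setT)
  (@pair_char R dH _ T cells setT X (fun u _ => cd_leg D u)).
Proof.
apply: colimit_relcell => //; [exact: cd_bot_discrete|exact: cd_bot_states|
  exact: cd_bot_expath|exact: total_colimit (cd_colimit D)].
Qed.

Lemma stage_relcell w : relcell (from_empty (T w)) (@pair_lt _ [set u | (u <= w)%O])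
  (@pair_char R dH _ T cells [set u | (u <= w)%O] (T w) (fun u h => tower_map T h)).
Proof.
apply: colimit_relcell; [exact: cd_bot_discrete|exact: cd_bot_states|
  exact: cd_bot_expath| |exact: stage_colimit].
by move=> u v uv /= vw; exact: le_trans vw.
Qed.

Definition total_pair u v (h : is_succ u v) : @succ_pair _ (setT : set (cd_ord D)) :=
  SuccPair h Logic.I.

Lemma cd_char_not_state u v (h : is_succ u v) p : cell_int p -> ~ states (cd_char h p).
Proof. exact: (rc_not_state cd_relcell (k := total_pair h)). Qed.

Lemma cd_char_inj u v (h : is_succ u v) p p' :
  cell_int p -> cell_int p' -> cd_char h p = cd_char h p' -> p = p'.
Proof. exact: (rc_cell_inj cd_relcell (k := total_pair h)). Qed.

Lemma cd_char_disjoint u v (h : is_succ u v) u' v' (h' : is_succ u' v') p p' :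
  cell_int p -> cell_int p' -> cd_char h p = cd_char h' p' -> u = u'.
Proof.
move=> ip ip' e; have := rc_disjoint cd_relcell (j := total_pair h) (k := total_pair h') ip ip' e.
by move/(congr1 (@pair_lo _ _)).
Qed.

Lemma cd_leg_map u v (uv : (u <= v)%O) x : cd_leg D v (tower_map T uv x) = cd_leg D u x.
Proof. exact: (mdcompE ((cd_colimit D).1 u v uv)). Qed.

Lemma stage_cover w (x : T w) : states x \/ exists u v (h : is_succ u v) (vw : (v <= w)%O) p,
  cell_int p /\ x = tower_map T vw (cell_char (cd_cell h) p).
Proof.
have [_ [H _ _]] := generated_stage (@cd_bot_states _ _ _ D)
  (@cd_bot_expath _ _ _ D) cells w.
exact: H.
Qed.

Lemma stage_state w (x : T w) : states x -> exists y, x = tower_map T (le0x w) y.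
Proof.
have [_ [_ H _]] := generated_stage (@cd_bot_states _ _ _ D)
  (@cd_bot_expath _ _ _ D) cells w.
exact: H.
Qed.

(** Each point of a stage is a state or lies in an open cell. Open cells are already disjoint and
    injectively mapped in the colimit, and the states are separated by the bijection at the bottom
    stage. *)
Lemma cd_leg_inj w : injective (cd_leg D w).
Proof.
move=> x y e; have [sx|[a [b [h [bw [p [ip xE]]]]]]] := stage_cover x;
  have [sy|[a' [b' [h' [bw' [p' [ip' yE]]]]]]] := stage_cover y.
- have [x0 x0E] := stage_state sx; have [y0 y0E] := stage_state sy; subst x y.
  rewrite !cd_leg_map in e; have [_ inj _] := cd_bot_bij D.
  by rewrite (inj x0 y0) ?inE.
- have := mdhom_states (cd_leg D w) sx; rewrite e yE cd_leg_map.
  by move/(@cd_char_not_state _ _ h' p' ip').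
- have := mdhom_states (cd_leg D w) sy; rewrite -e xE cd_leg_map.
  by move/(@cd_char_not_state _ _ h p ip).
- move: e; rewrite xE yE !cd_leg_map => e.
  have aa := @cd_char_disjoint _ _ h _ _ h' p p' ip ip' e; subst a'.
  have bb := succ_uniq h h'; subst b'; have hh := Prop_irrelevance h h'; subst h'.
  by rewrite (@cd_char_inj _ _ h p p' ip ip' e) (bool_irrelevance bw bw').
Qed.

Lemma tower_map_inj u v (uv : (u <= v)%O) : injective (tower_map T uv).
Proof.
by move=> x y e; apply: (@cd_leg_inj u); rewrite -!(cd_leg_map uv) e.
Qed.

Lemma tower_map_reflect u v (uv : (u <= v)%O) x : states (tower_map T uv x) -> states x.
Proof.
move=> /stage_state[y yE]; have -> : x = tower_map T (le0x u) y.
  apply: (tower_map_inj (uv := uv)).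
  by rewrite yE (tower_mapC (le0x u) uv (le0x v)).
by apply: mdhom_states; rewrite cd_bot_states.
Qed.

(** The point lies in an open cell attached by stage [w], and disjointness in [X] identifies this
    cell with the given one. *)
Lemma cd_char_early u v (h : is_succ u v) w (x : T w) p :
  cell_int p -> cd_leg D w x = cd_char h p -> (v <= w)%O.
Proof.
move=> ip e; have [sx|[a [b [h' [bw [p' [ip' xE]]]]]]] := stage_cover x.
  by have := mdhom_states (cd_leg D w) sx; rewrite e => /(cd_char_not_state ip).
move: e; rewrite xE cd_leg_map => e.
have aa := @cd_char_disjoint _ _ h' _ _ h p' p ip' ip e; subst a.
by rewrite (succ_uniq h h').
Qed.

Lemma cd_char_boundary u v (h : is_succ u v) q p :
  cell_int p -> cd_char h (GlobSD _ q) <> cd_char h p.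
Proof.
move=> ip; rewrite /cd_char /= (mdcompE (esym (cell_pushout (cd_cell h)).1)) /=.
rewrite cd_leg_map => /(@cd_char_early _ _ h u _ p ip).
by rewrite leNgt h.1.
Qed.

Lemma cellular_stage w : cellular (T w).
Proof. exact: cellular_relcell (stage_relcell w). Qed.

End DecompositionRelcell.

(** * Closedness and finiteness of sets of states *)

Section StatesClosed.
Context {R : realType} {dH : bool}.
Local Notation mdspace := (mdspace R dH).
Local Notation GlobSD := (GlobSD R dH).

Lemma cellular_has_relcell (X : mdspace) : cellular X -> has_relcell (from_empty X).
Proof. by case=> D; exists (RelcellData (cd_relcell D)). Qed.

Lemma globSD_closed n (C : set (GlobS R dH n)) : closed C -> closed (GlobSD n @` C).
Proof.
move=> cC; apply: compact_closed; first exact: globe_disk_hausdorff.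
apply: continuous_compact.
  by apply: continuous_subspaceT; exact: mdhom_continuous.
exact: subclosed_compact cC (@globe_sphere_compact R n) _.
Qed.

(** Well-founded induction on the cells: the preimage in a cell contains no interior point, so it is
    the image of a subset of the globe of the sphere. That subset is closed by [rc_attach], and its
    image is closed by compactness. *)
Lemma states_closed (X : mdspace) (C : set X) : cellular X -> C `<=` @states R dH X -> closed C.
Proof.
move=> /cellular_has_relcell[[K lt dim c rc] _] Cs.
rewrite -openC; apply: (rc_open rc) => [|k]; first exact: from_empty_open.
apply: (@well_founded_ind K lt (rc_wf rc) (fun k => open (c k @^-1` (~` C)))) => {}k IH.
suff : closed (c k @^-1` C) by rewrite preimage_setC openC.
have -> : c k @^-1` C = GlobSD (dim k) @` ((c k \oM GlobSD (dim k)) @^-1` C).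
  apply/seteqP; split=> [p Cp|_ [q Cq <-]//].
  have [ip|/cell_intNE[q pq]] := pselect (cell_int p).
    by case: (rc_not_state rc ip (Cs _ Cp)).
  by rewrite pq in Cp *; exists q.
apply: globSD_closed.
suff : open ((c k \oM GlobSD (dim k)) @^-1` (~` C)) by rewrite preimage_setC openC.
by apply: (rc_attach rc) => //; exact: from_empty_open.
Qed.

Lemma compact_discrete_finite (Z : topologicalType) (F : set Z) : compact [set: Z] ->
  (forall S, S `<=` F -> closed S) -> finite_set F.
Proof.
move=> cZ cF; have [[x0 _]|F0] := pselect (exists x, F x); last first.
  by have -> : F = set0 by apply/seteqP; split=> // x Fx; case: F0; exists x.
pose PZ : ptopologicalType := HB.pack Z (isPointed.Build Z x0).
(* The cover consists of the complements of [F] minus one point; each member contains only that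
   point of [F]. *)
have : compact (F : set PZ) by apply: subclosed_compact (cF F (@subset_refl _ _)) cZ _.
rewrite compact_cover => /(_ Z F (fun x => ~` (F `\ x)))[x Fx|x Fx|D' DF cov].
- by rewrite openC; apply: (cF) => y [].
- by exists x => // -[_]; apply.
apply: (sub_finite_set _ (finite_fset D')) => x Fx.
have [y yD xy] := cov x Fx; suff -> : x = y by [].
by apply: contrapT => xney; apply: xy; split.
Qed.

End StatesClosed.

(** * Segments of execution paths in cellular spaces *)

Section PathCutting.
Context {R : realType} {dH : bool}.
Local Notation I := (@itv01 R).
Local Notation mdspace := (mdspace R dH).
Local Notation GlobD := (GlobD R dH).

Lemma empty_cell_path (X : mdspace) K (dim : K -> nat) (c : forall k, mdhom (GlobD (dim k)) X) S h :
  cell_paths (from_empty X) c S h -> exists k z, [/\ S k, inner z & h = c k \o globe_pt z].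
Proof. by case=> [[q [[] _]]|]. Qed.

Lemma inner_path_state (X : mdspace) (A : mdspace) (i : mdhom A X) K lt (dim : K -> nat)
    (c : forall k, mdhom (GlobD (dim k)) X) (k : K) (z : diskT R (dim k)) (t : I) :
  relcell i lt c -> inner z -> states (c k (globe_pt z t)) -> t = i0 \/ t = i1.
Proof.
move=> rc iz st; have [/(rc_not_state rc)//|ni] := pselect (cell_int (globe_pt (R := R) z t)).
have /andP[t0 t1] := val_itv01 t.
have [e0|/eqP n0] := eqVneq (val t) 0; first by left; apply: itv01_inj; rewrite e0 val_i0.
have [e1|/eqP n1] := eqVneq (val t) 1; first by right; apply: itv01_inj; rewrite e1 val_i1.
case: ni; apply/cell_int_pt; split=> //.
by rewrite !lt_neqAle t0 t1 !andbT; apply/andP; split; apply/eqP => // /esym.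
Qed.

(** A cell fibre over an interior point meets states only at its ends, so a segment of it between
    states is constant or reparametrises the whole fibre; [gen_cut] extends this to all execution
    paths. *)
Lemma cut_expath (X : mdspace) (h : I -> X) (psi : I -> I) : cellular X -> expath h ->
  monotone_path psi -> states (h (psi i0)) -> states (h (psi i1)) ->
  expath (h \o psi) \/ forall t, h (psi t) = h (psi i0).
Proof.
move=> /cellular_has_relcell[[K lt dim c rc] _] /(rc_expath rc) G mpsi s0 s1.
have [||H|H] := @gen_cut R X (@states R dH X) _ (@expath R dH X) _ _ h psi G mpsi s0 s1.
- move=> _ /empty_cell_path[k [z [_ _ ->]]]; rewrite /= globe_pt0 globe_pt1.
  by split; apply: mdhom_states; [exists false|exists true].
- move=> _ phi /empty_cell_path[k [z [_ iz ->]]] mphi /= S0 S1.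
  have e01 : val (phi i0) <= val (phi i1) by apply: mphi.1; exact: i0_le.
  have const : phi i0 = phi i1 -> forall t, phi t = phi i0.
    move=> e t; apply: itv01_inj; apply/le_anti/andP; split.
      by rewrite e; apply: mphi.1; exact: le_i1.
    by apply: mphi.1; exact: i0_le.
  have [p0|p0] := inner_path_state rc iz S0; have [p1|p1] := inner_path_state rc iz S1.
  + by right=> t; rewrite const // p0 p1.
  + left; apply: gen_base.
    apply: (@expath_reparam R dH X (c k \o globe_pt z) phi).
      exact: (mdhom_expath (c k) (expath_globe_pt (rV_hausdorff (A := _)) z)).
    exact: monotone_path_reparam.
  + right=> t; rewrite const //; apply: itv01_inj; apply/le_anti.
    by rewrite e01 p0 p1 i0_le.
  + by right=> t; rewrite const // p0 p1.
- left; elim: H => [p //|p phi _ ep rphi|p q _ ep _ eq pq].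
    exact: expath_reparam.
  exact: expath_concat.
- by right.
Qed.

End PathCutting.

(** * Connection maps *)

Section ConnectionMaps.
Context {R : realType} {dH : bool}.
Local Notation I := (@itv01 R).
Local Notation mdspace := (mdspace R dH).

Lemma cell_end_of_state (X : mdspace) (D : cellular_decomposition X) s (x : X) :
  states x -> cell_end_of D s x = x.
Proof.
move=> sx; apply: xgetPN => a [u [v [h [[p ip e] _]]]].
by move: sx; rewrite -e; apply: cd_char_not_state; rewrite -cell_intE in ip.
Qed.

(* The right-hand side does not refer to the decomposition, hence the
   compatibility with maps that reflect states. *)
Lemma cell_end_of_path (X : mdspace) (D : cellular_decomposition X) s (g : I -> X) (t : I) :
  expath g -> 0 < val t < 1 -> (forall r : I, 0 < val r < 1 -> ~ states (g r)) ->
  cell_end_of D s (g t) = g (if s then i1 else i0).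
Proof.
move=> eg t01 ns.
have [a [b [p [phi [[a0 b1] ab /andP[at_ tb] [Pp rphi] E]]]]] :=
  gen_local t (rc_expath (cd_relcell D) eg).
have {Pp} [[u v h hv] [z [_ iz pE]]] := empty_cell_path Pp; subst p.
have {}E r : g (affine_path a (b - a) r) = cd_char h (globe_pt z (phi r)) by exact: E.
have pole b' : states (cd_char h (globe_pole b')) by apply: mdhom_states; exists b'.
have [ph0 ph1] := reparam01 rphi.
have Ea : g (clamp a) = cd_char h (globe_pole false).
  by rewrite -(globe_pt0 z) -{1}ph0 -E /affine_path val_i0 mulr0 addr0.
have Eb : g (clamp b) = cd_char h (globe_pole true).
  by rewrite -(globe_pt1 z) -{1}ph1 -E /affine_path val_i1 mulr1 addrC subrK.
(* A positive [a] would be an interior time at which [g] is at an end of the cell, hence at a state;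
   likewise for [b < 1]. So [g] is a reparametrised fibre of one cell. *)
have a00 : a = 0.
  apply/le_anti; rewrite a0 andbT leNgt; apply/negP => ap.
  apply: (ns (clamp a)); last by rewrite Ea.
  by rewrite clampK ?ap ?(lt_le_trans ab) ?a0 ?(le_trans (ltW ab)).
have b11 : b = 1.
  apply/le_anti; rewrite b1 /= leNgt; apply/negP => bp.
  apply: (ns (clamp b)); last by rewrite Eb.
  by rewrite clampK ?bp ?(le_lt_trans a0 ab) ?b1 ?(le_trans a0 (ltW ab)).
subst a b.
have gE r : g r = cd_char h (globe_pt z (phi r)).
  by rewrite -E /affine_path subr0 add0r mul1r valcK.
have it : cell_int (globe_pt (R := R) z (phi t)).
  apply: contrapT => /(@cell_intNE R dH)[[b' e|[y w] e]].
    by apply: (ns t t01); rewrite gE e; exact: pole.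
  have : globe_time (globe_pt (R := R) z (phi t)) = globe_time (globe_pt (R := R) z (phi t)) by [].
  have [[_ e']|[_ e']|[w' [_ e']]] := globe_ptP z (phi t); rewrite e' in e; try by [].
  case: e => zy _; by have := sphere_not_inner (y := y); rewrite -zy.
have [u' [v' [h' [[p' ip' e'] ->]]]] : [set a | exists (u v : cd_ord D) (h : is_succ u v),
    globular_cell h (g t) /\ a = cell_end h s] (cell_end_of D s (g t)).
  apply: xgetPex; exists (cell_end h s), u, v, h; split=> //.
  by exists (globe_pt z (phi t)); rewrite -?gE // -cell_intE.
rewrite -cell_intE in ip'; rewrite gE in e'.
have uu := cd_char_disjoint ip' it e'; subst u'.
have vv := succ_uniq h h'; subst v'; have hh := Prop_irrelevance h h'; subst h'.
rewrite /cell_end gE; case: s; first by rewrite ph1 globe_pt1.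
by rewrite ph0 globe_pt0.
Qed.

(** A point that is not a state lies inside a cell fibre without interior states. As [j] reflects
    states, it carries this fibre to a path of the same kind, and both cell ends are read off from
    these paths. *)
Lemma cell_end_of_map (X X' : mdspace) (D : cellular_decomposition X)
    (D' : cellular_decomposition X') (j : mdhom X X') s x :
  (forall x, states (j x) -> states x) ->
  cell_end_of D' s (j x) = j (cell_end_of D s x).
Proof.
move=> js; have [sx|nsx] := pselect (states x).
  by rewrite !cell_end_of_state //; exact: mdhom_states.
have [[[]]|//|[[u v h hv] [p [ip e]]]] := rc_cover (cd_relcell D) x.
have {}e : x = cd_char h p by exact: e.
case: p ip e => [//|[z w]] iz; rewrite globe_inr => e.
have w01 := opn01P w.
have vw : val (clamp (val w)) = val w by rewrite clampK //; case/andP: w01 => /ltW -> /ltW ->.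
pose g : I -> X := cd_char h \o globe_pt z.
have eg : expath g := mdhom_expath (cd_char h) (expath_globe_pt (rV_hausdorff (A := _)) z).
have ng (r : I) : 0 < val r < 1 -> ~ states (g r).
  by move=> r01; apply: cd_char_not_state; apply/cell_int_pt.
rewrite e -[cd_char _ _]/(g (clamp (val w))) (cell_end_of_path _ _ eg) ?vw //.
have ejg : expath (j \o g) := mdhom_expath j eg.
rewrite -[j (g _)]/((j \o g) _) (cell_end_of_path _ _ ejg) ?vw // => r r01 /js.
exact: ng.
Qed.

End ConnectionMaps.

(** * The subdivided tower *)

Section InducedStructure.
Context {R : realType} {dH : bool}.
Local Notation I := (@itv01 R).
Local Notation mdspace := (mdspace R dH).
Context {Y : mdspace}.

Lemma gen_expath (X : mdspace) (P : set (I -> X)) g :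
  P `<=` @expath R dH X -> gen P g -> expath g.
Proof.
move=> PX; elim=> [p /PX //|p phi _ ep rphi|p q _ ep _ eq pq].
  exact: expath_reparam.
exact: expath_concat.
Qed.

Section Object.
Context {A : mdspace} (j : mdhom A Y).

(* The largest multipointed d-space structure on the space of [A] that makes [j]
   a map to [Y]. *)
Program Definition induced : mdspace :=
  @MDSpace R dH A [set x | states (j x)] [set g | continuous g /\ expath (j \o g)]
    (mdcar_in_Top A) _ _ _ _.
Next Obligation. by move=> g []. Qed.
Next Obligation. by move=> g [_ /expath_states[]]. Qed.
Next Obligation.
move=> g phi [cg eg] rphi; split; last exact: (expath_reparam eg rphi).
exact: continuous_fcomp (reparam_continuous rphi) cg.
Qed.
Next Obligation.
move=> g1 g2 [c1 e1] [c2 e2] e; split; first exact: concat_continuous.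
by rewrite -concat_comp; apply: expath_concat => //=; rewrite e.
Qed.

Program Definition to_induced : mdhom A induced := @MDHom R dH A induced idfun _ _ _.
Next Obligation. by move=> x; exact: cvg_id. Qed.
Next Obligation. by move=> x sx; exact: mdhom_states. Qed.
Next Obligation.
by move=> g eg; split; [exact: expath_continuous|exact: mdhom_expath].
Qed.

Program Definition induced_leg : mdhom induced Y := @MDHom R dH induced Y j _ _ _.
Next Obligation. exact: (@mdhom_continuous _ _ _ _ j). Qed.
Next Obligation. by []. Qed.
Next Obligation. by move=> g []. Qed.

End Object.

Lemma induced_map_expath (A B : mdspace) (jA : mdhom A Y) (jB : mdhom B Y) (h : mdhom A B) :
  jB \oM h = jA -> forall g, @expath R dH (induced jA) g -> @expath R dH (induced jB) (h \o g).
Proof.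
move=> e g [cg eg]; split; first exact: continuous_fcomp cg (@mdhom_continuous _ _ _ _ h).
by rewrite -[jB \o _]/((jB \oM h) \o g) e.
Qed.

Lemma induced_map_states (A B : mdspace) (jA : mdhom A Y) (jB : mdhom B Y) (h : mdhom A B) :
  jB \oM h = jA -> forall x, @states R dH (induced jA) x -> @states R dH (induced jB) (h x).
Proof. by move=> e x sx; rewrite /= (mdcompE e). Qed.

Definition induced_map (A B : mdspace) (jA : mdhom A Y) (jB : mdhom B Y) (h : mdhom A B)
    (e : jB \oM h = jA) : mdhom (induced jA) (induced jB) :=
  @MDHom R dH (induced jA) (induced jB) h (@mdhom_continuous _ _ _ _ h)
    (induced_map_states e) (induced_map_expath e).

End InducedStructure.

Section SubdividedTower.
Context {R : realType} {dH : bool}.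
Local Notation I := (@itv01 R).
Local Notation mdspace := (mdspace R dH).
Context {X Y : mdspace} (f : mdhom X Y) (hf : globular_subdivision f).
Context (D : cellular_decomposition X).
Implicit Types u v w : cd_ord D.

Lemma subdivision_inj : injective f.
Proof. by have [_ _ [g [_ fK _]]] := hf; exact: can_inj fK. Qed.

Lemma subdivision_surj y : exists x, y = f x.
Proof. by have [_ _ [g [_ _ gK]]] := hf; exists (g y). Qed.

(** A segment of a cell fibre of [X] that becomes an execution path of [Y]; the strict inequality
    makes it pass through the open cell, which it therefore determines. *)
Definition fibre_path u v (h : is_succ u v) (z : diskT R (cd_dim h)) (psi : I -> I) : Prop :=
  [/\ inner z, monotone_path psi, val (psi i0) < val (psi i1) &
    expath (f \o (cd_char h \o (globe_pt z \o psi)))].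

Lemma fibre_path_inner u v (h : is_succ u v) z psi : fibre_path (h := h) z psi ->
  exists t, cell_int (globe_pt (R := R) z (psi t)).
Proof.
move=> [iz mpsi lt01 _]; have [t tE] : exists t, val (psi t) = (val (psi i0) + val (psi i1)) / 2.
  by apply: monotone_path_ivt => //; apply/andP; split; lra.
exists t; apply/cell_int_pt; split=> //; rewrite tE.
have := i0_le (psi i0); have := le_i1 (psi i1); rewrite val_i0 val_i1 => ? ?.
by apply/andP; split; lra.
Qed.

(* The midpoint of a cell fibre of [Y] is not a state, so it lies on a cell fibre
   of [X]. The latter is an execution path of [Y], locally a reparametrised cell
   fibre of [Y]: necessarily the given one, which is thus one of its segments. *)
Lemma subdivision_expath g : expath g -> gen [set p | exists u v (h : is_succ u v) z psi,
  fibre_path (h := h) z psi /\ p = f \o (cd_char h \o (globe_pt z \o psi))] g.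
Proof.
have [_ /cellular_has_relcell[[K lt dim c rc] _] _] := hf.
move=> /(rc_expath rc); apply: gen_trans => _ /empty_cell_path[k [z [_ iz ->]]].
apply: gen_base.
have t01 : 0 < val (clamp (2^-1 : R)) < 1.
  by rewrite clampK; apply/andP; split; lra.
have it : cell_int (globe_pt (R := R) z (clamp 2^-1)) by apply/cell_int_pt.
have [x xE] := subdivision_surj (c k (globe_pt z (clamp 2^-1))).
have nsx : ~ states x.
  by move=> /(mdhom_states f); rewrite -xE; exact: (rc_not_state rc).
have [[[]]|//|[[u v h hv] [p [ip e]]]] := rc_cover (cd_relcell D) x.
have {}e : x = cd_char h p by exact: e.
case: p ip e => [//|[z' w]] iz'; rewrite globe_inr => e.
have w01 := opn01P w.
have vw : val (clamp (val w)) = val w by rewrite clampK //; case/andP: w01 => /ltW -> /ltW ->.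
pose d : I -> Y := f \o (cd_char h \o globe_pt z').
have ed : expath d.
  exact: mdhom_expath (mdhom_expath (cd_char h) (expath_globe_pt (rV_hausdorff (A := _)) z')).
have [a [b [q [phi [[a0 b1] ab /andP[at_ tb] [Pq rphi] E]]]]] :=
  gen_local (clamp (val w)) (rc_expath rc ed).
have {Pq} [k' [z'' [_ iz'' qE]]] := empty_cell_path Pq; subst q.
rewrite vw in at_ tb.
have ba : 0 < b - a by lra.
have sE : val (clamp ((val w - a) / (b - a))) = (val w - a) / (b - a).
  rewrite clampK //; apply/andP; split; first by apply: divr_ge0; lra.
  by rewrite ler_pdivrMr // mul1r; lra.
have dw : d (clamp (val w)) = c k' (globe_pt z'' (phi (clamp ((val w - a) / (b - a))))).
  rewrite -[RHS]E /affine_path sE; congr (d (clamp _)).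
  by rewrite mulrCA divff ?gt_eqF // mulr1 addrC subrK.
have dE : d (clamp (val w)) = c k (globe_pt z (clamp 2^-1)) by rewrite xE e.
set s0 : I := clamp (_ / _) in dw.
have i'' : cell_int (globe_pt (R := R) z'' (phi s0)).
  apply: contrapT => ni; have [//|[q' qE]] : cell_int (globe_pt (R := R) z'' (phi s0)) \/
      exists b', globe_pt (R := R) z'' (phi s0) = globe_pole b'.
    have [[_ ->]|[_ ->]|[u' [_ e']]] := globe_ptP z'' (phi s0);
      [by right; exists false|by right; exists true|left].
    by rewrite e'.
  apply: (rc_not_state rc it); rewrite -dE dw qE.
  by apply: mdhom_states; exists q'.
have kk : k' = k by apply: (rc_disjoint rc i'' it); rewrite -dw.
subst k'; have zz : globe_pt z (clamp 2^-1) = globe_pt z'' (phi s0).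
  by apply: (rc_cell_inj rc it i''); rewrite -dw.
have [_ /(_ t01) zz'] := globe_pt_inj zz; subst z''.
(* [d] is injective on open times, because [f] and the open cell are. If [phi] took a value twice it
   would be constant in between, and [d] would agree at two distinct inner times; so [phi] is
   injective and its inverse is again a reparametrisation. *)
have dinj (r r' : I) : 0 < val r < 1 -> 0 < val r' < 1 -> d r = d r' -> r = r'.
  move=> r1 r1' /subdivision_inj /cd_char_inj ee; apply: itv01_inj.
  by have [] := globe_pt_inj (ee (proj2 (cell_int_pt _ _) (conj iz' r1))
    (proj2 (cell_int_pt _ _) (conj iz' r1'))).
have affE (s : I) : val (affine_path a (b - a) s) = a + (b - a) * val s.
  rewrite /affine_path clampK //; have /andP[s0' s1'] := val_itv01 s.
  by apply/andP; split; nra.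
have phi_inj_lt (s s' : I) : val s < val s' -> phi s <> phi s'.
  move=> ss' pp; have := i0_le s; have := le_i1 s'; rewrite val_i0 val_i1 => s1 s00.
  pose m1 : I := clamp (val s + (val s' - val s) / 3).
  pose m2 : I := clamp (val s + (val s' - val s) / 3 * 2).
  have m1E : val m1 = val s + (val s' - val s) / 3 by rewrite clampK //; apply/andP; split; lra.
  have m2E : val m2 = val s + (val s' - val s) / 3 * 2 by rewrite clampK //; apply/andP; split; lra.
  have pm (m : I) : val s <= val m <= val s' -> phi m = phi s.
    move=> /andP[l1 l2]; apply: itv01_inj; apply/le_anti/andP; split; last exact: rphi.1.
    by rewrite pp; exact: rphi.1.
  have : affine_path a (b - a) m1 = affine_path a (b - a) m2.
    apply: dinj; rewrite ?affE ?m1E ?m2E; [by apply/andP; split; nra..|].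
    by rewrite !E !pm //; apply/andP; rewrite ?m1E ?m2E; split; lra.
  move=> /(congr1 val); rewrite !affE m1E m2E => /addrI /mulfI; rewrite gt_eqF // => /(_ isT).
  by lra.
have phi_inj (s s' : I) : phi s = phi s' -> s = s'.
  move=> pp; apply: itv01_inj; apply/le_anti/andP; split; rewrite leNgt; apply/negP => l.
    by case: (phi_inj_lt _ _ l).
  by case: (phi_inj_lt _ _ l).
have [sigma phiK] := reparam_section rphi.
have sigmaK : cancel phi sigma by move=> s; apply: phi_inj; rewrite phiK.
have rs : reparam sigma.
  split=> [s s' ss'|s _]; last by exists (phi s).
  rewrite leNgt; apply/negP => l; case: (phi_inj_lt _ _ l); apply: itv01_inj.
  rewrite !phiK; apply/le_anti; rewrite ss' andbT.
  by rewrite -(phiK s) -(phiK s'); apply: rphi.1; exact: ltW.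
have pE : c k \o globe_pt z = f \o (cd_char h \o (globe_pt z' \o (affine_path a (b - a) \o sigma))).
  by apply/funext => s; have := E (sigma s); rewrite phiK => ee; exact: esym ee.
exists u, v, h, z', (affine_path a (b - a) \o sigma); split=> //.
split=> //.
- apply: monotone_path_comp; last exact: reparam_monotone.
  by apply: affine_path_monotone; exact: ltW.
- rewrite -![(affine_path _ _ \o _) _]/(affine_path _ _ (sigma _)).
  by have [-> ->] := reparam01 rs; rewrite !affE val_i0 val_i1; lra.
- by rewrite -pE; exact: (mdhom_expath (c k) (expath_globe_pt (rV_hausdorff (A := _)) z)).
Qed.

End SubdividedTower.

Section SubdividedStages.
Context {R : realType} {dH : bool}.
Local Notation I := (@itv01 R).
Local Notation mdspace := (mdspace R dH).
Local Notation GlobD := (GlobD R dH).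
Context {X Y : mdspace} (f : mdhom X Y) (hf : globular_subdivision f).
Context (D : cellular_decomposition X).
Local Notation T := (cd_tower D).
Implicit Types u v w : cd_ord D.

Definition substage u : mdspace := induced (f \oM cd_leg D u).

Lemma substage_map_eq u v (uv : (u <= v)%O) :
  (f \oM cd_leg D v) \oM tower_map T uv = f \oM cd_leg D u.
Proof. by rewrite -mdcompA ((cd_colimit D).1 u v uv). Qed.

Definition substage_map u v (uv : (u <= v)%O) : mdhom (substage u) (substage v) :=
  induced_map (substage_map_eq uv).

Definition substage_sub u : mdhom (T u) (substage u) := to_induced (f \oM cd_leg D u).
Definition substage_leg u : mdhom (substage u) Y := induced_leg (f \oM cd_leg D u).

Lemma substage_leg_inj u : injective (substage_leg u).
Proof. by move=> x y /(subdivision_inj hf) /cd_leg_inj. Qed.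

Lemma substage_map_reflect u v (uv : (u <= v)%O) g : continuous g ->
  expath (substage_map uv \o g) -> @expath R dH (substage u) g.
Proof.
move=> cg [_ eg]; split=> //.
by rewrite -(substage_map_eq uv).
Qed.

(** Generation in [Y] is lifted through the injective leg. A generator passes through the interior
    of its cell, so that cell is attached by stage [w]; the lift is the corresponding segment inside
    the stage, hence continuous. *)
Lemma substage_expath w g : @expath R dH (substage w) g ->
  gen [set p | exists u v (h : is_succ u v) (vw : (v <= w)%O) z psi,
    [/\ fibre_path f (h := h) z psi, @expath R dH (substage w) p &
        p = tower_map T vw \o (cell_char (cd_cell h) \o (globe_pt z \o psi))]] g.
Proof.
move=> [_ /(subdivision_expath hf D)] /(gen_lift (@substage_leg_inj w)).
apply: gen_sub => p [u [v [h [z [psi [fp e]]]]]].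
have [t it] := fibre_path_inner fp.
have vw : (v <= w)%O.
  apply: (cd_char_early (x := p t) it); apply: (subdivision_inj hf).
  exact: (congr1 (fun q => q t) e).
have pE : p = tower_map T vw \o (cell_char (cd_cell h) \o (globe_pt z \o psi)).
  apply/funext => s; apply: (@substage_leg_inj w).
  have -> : substage_leg w (p s) = f (cd_char h (globe_pt z (psi s))) := congr1 (fun q => q s) e.
  by congr (f _); rewrite /= cd_leg_map.
exists u, v, h, vw, z, psi; split=> //; split.
  have [_ [_ cpsi] _ _] := fp; rewrite pE.
  apply: continuous_fcomp (@mdhom_continuous _ _ _ _ (tower_map T vw)).
  apply: continuous_fcomp (@mdhom_continuous _ _ _ _ (cell_char (cd_cell h))).
  exact: continuous_fcomp cpsi (@globe_pt_continuous _ _ z).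
by have [_ _ _] := fp; rewrite -e.
Qed.

Section Cell.
Context {u v : cd_ord D} (h : is_succ u v).
Local Notation F := (cell_states f h).

Lemma cell_states_int p : F p -> cell_int p.
Proof. by case=> + _; rewrite -cell_intE. Qed.

(* Subsets of [Y^0] are closed in the cellular space [Y], so all subsets of the
   set below are closed in a compact space. *)
Lemma cell_states_finite : finite_set F.
Proof.
apply: (compact_discrete_finite (@globe_disk_compact R _)) => S SF.
have -> : S = (f \oM cd_char h) @^-1` ((f \oM cd_char h) @` S).
  apply/seteqP; split=> [p Sp|p [q Sq] /(subdivision_inj hf) e]; first by exists p.
  have iq := cell_states_int (SF _ Sq).
  have [ip|/(@cell_intNE R dH)[q' pq]] := pselect (cell_int p).
    by rewrite -(cd_char_inj iq ip e).
  by case: (@cd_char_boundary _ _ _ D _ _ h q' q iq); rewrite -pq.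
apply: preimage_closed; first by move=> x _; exact: mdhom_continuous.
apply: (@states_closed R dH); first by case: hf.
by move=> _ [p /SF[_ sp] <-].
Qed.

Lemma globF_state_cell p : globF_state F p -> states (f (cd_char h p)).
Proof. by case=> [sp|[_ //]]; do 2!apply: mdhom_states. Qed.

Lemma cell_globF_state z t : inner z -> states (f (cd_char h (globe_pt z t))) ->
  globF_state F (globe_pt z t).
Proof.
move=> iz st; have [ip|ni] := pselect (cell_int (globe_pt (R := R) z t)).
  by right; split=> //; rewrite -cell_intE.
left; have [[_ ->]|[_ ->]|[w [_ e]]] := globe_ptP z t; [exact: imageT..|].
by case: ni; rewrite e.
Qed.

Lemma fibre_path_globF z psi : fibre_path f (h := h) z psi ->
  @expath R dH (GlobF F) (globe_pt z \o psi).
Proof.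
move=> [iz mpsi lt01 /expath_states[s0 s1]].
apply: globF_path => //; [exact: cell_globF_state..|].
by move=> /globe_pt_inj[e _]; move: lt01; rewrite e ltxx.
Qed.

(** Over a boundary point the path is a reparametrised fibre. Over an interior point the fibre is an
    execution path of the cellular space [Y], cut between two states; the segment is not constant,
    since [f] and the open cell are injective. *)
Lemma globF_fibre_expath z psi : monotone_path psi ->
  globF_state F (globe_pt z (psi i0)) -> globF_state F (globe_pt z (psi i1)) ->
  globe_pt (R := R) z (psi i0) <> globe_pt z (psi i1) ->
  expath (f \o (cd_char h \o (globe_pt z \o psi))).
Proof.
move=> mpsi s0 s1 ne; have [iz|[y zy]] := inner_or_sphere z; last first.
  rewrite zy in s0 s1 ne *; have rpsi := sphere_path cell_states_int mpsi s0 s1 ne.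
  apply: (mdhom_expath f); apply: (mdhom_expath (cd_char h)).
  exact: (expath_reparam (expath_globe_pt (rV_hausdorff (A := _)) (sphere_disk y)) rpsi).
pose d : I -> Y := f \o (cd_char h \o globe_pt z).
have ed : expath d.
  exact: mdhom_expath (mdhom_expath (cd_char h) (expath_globe_pt (rV_hausdorff (A := _)) z)).
have cY : cellular Y by case: hf.
have [//|const] := cut_expath cY ed mpsi (globF_state_cell s0) (globF_state_cell s1).
have lt01 : val (psi i0) < val (psi i1).
  rewrite lt_neqAle mpsi.1 ?andbT; last exact: i0_le.
  by apply/eqP => /itv01_inj e; apply: ne; rewrite e.
have := i0_le (psi i0); have := le_i1 (psi i1); rewrite val_i0 val_i1 => l1 l0.
have pt (c : R) : 0 < c < 1 -> exists2 t,
    cell_int (globe_pt (R := R) z (psi t)) &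
    val (psi t) = val (psi i0) + (val (psi i1) - val (psi i0)) * c.
  move=> c01; have [|t tE] := @monotone_path_ivt R psi
    (val (psi i0) + (val (psi i1) - val (psi i0)) * c) mpsi.
    by apply/andP; split; nra.
  exists t => //; apply/cell_int_pt; split=> //; rewrite tE.
  by apply/andP; split; nra.
(* Any two different fractions strictly between 0 and 1 would do: they give two interior points of
   the segment with different images. *)
have [|t it tE] := pt 3^-1; first by apply/andP; split; lra.
have [|s is_ sE] := pt 2^-1; first by apply/andP; split; lra.
have /(subdivision_inj hf) /(cd_char_inj it is_) /globe_pt_inj[] : d (psi t) = d (psi s).
  by rewrite !const.
rewrite tE sE => /addrI /mulfI; rewrite subr_eq0 gt_eqF // => /(_ isT) e _.
by move: e; clear; lra.
Qed.

Lemma cell_globF_states p : @states R dH (GlobF F) p -> @states R dH (substage v) (cell_char (cd_cell h) p).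
Proof. exact: globF_state_cell. Qed.

Lemma cell_globF_expath g : @expath R dH (GlobF F) g ->
  @expath R dH (substage v) (cell_char (cd_cell h) \o g).
Proof.
move=> eg; split.
  apply: continuous_fcomp (@mdhom_continuous _ _ _ _ (cell_char (cd_cell h))).
  exact: (expath_continuous eg).
case: eg => s0 s1 ne [z [psi [mpsi cpsi gE]]]; subst g.
exact: globF_fibre_expath.
Qed.

Definition subdivided_cell : mdhom (GlobF F) (substage v) :=
  @MDHom R dH (GlobF F) (substage v) (cell_char (cd_cell h))
    (@mdhom_continuous _ _ _ _ (cell_char (cd_cell h))) cell_globF_states cell_globF_expath.

Lemma cell_cover (x : T v) :
  (exists y, x = tower_next T h y) \/ exists p, cell_int p /\ x = cell_char (cd_cell h) p.
Proof.
have [[] [y ->]] := generated_point (pushout_generated (cell_pushout (cd_cell h))) x.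
  by left; exists y.
have [ip|/(@cell_intNE R dH)[q ->]] := pselect (cell_int y); first by right; exists y.
left; exists (cell_attach (cd_cell h) q).
exact: (esym (mdcompE (cell_pushout (cd_cell h)).1 q)).
Qed.

(** The underlying space is that of the pushout for [X], which provides a continuous map once [W] is
    given all continuous paths. States and paths are checked on generators: a segment of a fibre
    belongs to an earlier cell, hence to [substage u], or to the new one, hence to [GlobF]. *)
Lemma subdivided_pushout : is_pushout (substage_sub u \oM cell_attach (cd_cell h))
  (GlobSF F) (substage_map (is_succ_le h)) subdivided_cell.
Proof.
have [sq univ] := cell_pushout (cd_cell h); split.
  by apply: mdhom_ext => p; exact: (mdcompE sq p).
move=> W a b ab; have hW := mdcar_in_Top W.
have [|w0 [[w0a w0b] _]] := univ _ (@all_paths_hom R dH (T u) _ hW a (@mdhom_continuous _ _ _ _ a))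
    (@all_paths_hom R dH (GlobD _) _ hW b (@mdhom_continuous _ _ _ _ b)).
  by apply: mdhom_ext => p; exact: (mdcompE ab p).
have wa x : w0 (tower_next T h x) = a x := mdcompE w0a x.
have wb x : w0 (cell_char (cd_cell h) x) = b x := mdcompE w0b x.
have ws (x : substage v) : states x -> @states R dH W (w0 x).
  have [[y ->]|[p [ip ->]]] := cell_cover x => sx.
    by rewrite wa; apply: mdhom_states; move: sx; rewrite /= cd_leg_map.
  rewrite wb; apply: mdhom_states; right; split=> //.
  by rewrite -cell_intE.
have wp (g : I -> substage v) : expath g -> @expath R dH W ((w0 : substage v -> W) \o g).
  move=> /substage_expath G; apply: (gen_expath (P := @expath R dH W)) => //.
  apply: gen_comp G => q [a' [b' [h' [bv [z [psi [fp ep qE]]]]]]]; subst q; apply: gen_base.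
  have [bu|ub] := leP b' u.
    pose p := tower_map T bu \o (cell_char (cd_cell h') \o (globe_pt z \o psi)).
    have pE : tower_map T bv \o (cell_char (cd_cell h') \o (globe_pt z \o psi)) =
        substage_map (is_succ_le h) \o p.
      by apply/funext => s; rewrite /p /= (tower_mapC bu (is_succ_le h) bv).
    have ep' : @expath R dH (substage u) p.
      apply: (@substage_map_reflect u v (is_succ_le h)); last by rewrite -pE.
      have [_ [_ cpsi] _ _] := fp.
      apply: continuous_fcomp (@mdhom_continuous _ _ _ _ (tower_map T bu)).
      apply: continuous_fcomp (@mdhom_continuous _ _ _ _ (cell_char (cd_cell h'))).
      exact: continuous_fcomp cpsi (@globe_pt_continuous _ _ z).
    have -> : (w0 : substage v -> W) \o (tower_map T bv \o (cell_char (cd_cell h') \o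
        (globe_pt z \o psi))) = a \o p.
      by rewrite pE; apply/funext => s; exact: wa.
    exact: mdhom_expath.
  have bv' : b' = v by apply/le_anti; rewrite bv (h.2 _ ub).
  subst b'; have au := succ_inj h h'; subst a'; have hh := Prop_irrelevance h h'; subst h'.
  have -> : (w0 : substage v -> W) \o (tower_map T bv \o (cell_char (cd_cell h) \o
        (globe_pt z \o psi))) = b \o (globe_pt z \o psi).
    by apply/funext => s; rewrite /= tower_mapI; exact: wb.
  exact: mdhom_expath (fibre_path_globF fp).
pose w1 := @MDHom R dH (substage v) W w0 (@mdhom_continuous _ _ _ _ w0) ws wp.
exists w1; split; first by split; apply: mdhom_ext => x; [exact: wa|exact: wb].
move=> w2 [w2a w2b]; apply: mdhom_ext => x.
have [[y ->]|[p [ip ->]]] := cell_cover x.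
  by rewrite [w1 _]wa; exact: (esym (mdcompE w2a y)).
by rewrite [w1 _]wb; exact: (esym (mdcompE w2b p)).
Qed.

End Cell.

End SubdividedStages.

Section SubdividedColimits.
Context {R : realType} {dH : bool}.
Local Notation I := (@itv01 R).
Local Notation mdspace := (mdspace R dH).
Context {X Y : mdspace} (f : mdhom X Y) (hf : globular_subdivision f).
Context (D : cellular_decomposition X).
Local Notation T := (cd_tower D).
Local Notation substage := (@substage R dH X Y f D).
Implicit Types u v w : cd_ord D.

(** [e] is a homeomorphism out of a colimit in the tower of [X]. The continuous map out of [Q] comes
    from that colimit, and it is a morphism because the substages generate the states and the paths
    of [Q]. This covers both limit stages and [Y] itself. *)
Lemma subdivided_colimit (S : set (cd_ord D)) (P Q : mdspace)
    (k : forall u, S u -> mdhom (T u) P) (e : mdhom P Q) (g : Q -> P)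
    (kQ : forall u, S u -> mdhom (substage u) Q) :
  partial_colimit k -> continuous g -> cancel e g -> cancel g e ->
  (forall u hu x, kQ u hu x = e (k u hu x)) ->
  (forall x, states x -> exists u hu y, @states R dH (substage u) y /\ x = kQ u hu y) ->
  (forall p, expath p -> gen [set p | exists u hu q, @expath R dH (substage u) q /\ p = kQ u hu \o q] p) ->
  forall (W : mdspace) (k' : forall u, S u -> mdhom (substage u) W),
    (forall u u' (uu : (u <= u')%O) hu hu', k' u' hu' \oM substage_map f uu = k' u hu) ->
    exists! w : mdhom Q W, forall u hu, w \oM kQ u hu = k' u hu.
Proof.
move=> pc cg eK gK kE sQ pQ W k' cc; have hW := mdcar_in_Top W.
have [|w0 [w0k _]] := pc.2 _ (fun u hu => @all_paths_hom R dH (T u) _ hW (k' u hu)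
    (@mdhom_continuous _ _ _ _ (k' u hu))).
  by move=> u u' uu hu hu'; apply: mdhom_ext => x; exact: (mdcompE (cc u u' uu hu hu') x).
pose w1 : Q -> W := w0 \o g.
have w1k u hu x : w1 (kQ u hu x) = k' u hu x.
  by rewrite /w1 kE /= eK; exact: (mdcompE (w0k u hu) x).
have cw : continuous w1 by exact: continuous_fcomp cg (@mdhom_continuous _ _ _ _ w0).
have sw (x : Q) : states x -> states (w1 x).
  by move=> /sQ[u [hu [y [sy ->]]]]; rewrite w1k; exact: mdhom_states.
have pw (p : I -> Q) : expath p -> expath (w1 \o p).
  move=> /pQ G; apply: (gen_expath (P := @expath R dH W)) => //.
  apply: gen_comp G => q [u [hu [q' [eq' ->]]]]; apply: gen_base.
  have -> : w1 \o (kQ u hu \o q') = k' u hu \o q' by apply/funext => s; exact: w1k.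
  exact: mdhom_expath.
exists (@MDHom R dH Q W w1 cw sw pw); split; first by move=> u hu; apply: mdhom_ext => x; exact: w1k.
move=> w2 w2k; apply: mdhom_ext => x.
have [[u hu] [y yE]] := generated_point (partial_colimit_generated pc) (g x).
have -> : x = kQ u hu y by rewrite kE -[k u hu y]yE gK.
by rewrite [LHS]w1k; exact: (esym (mdcompE (w2k u hu) y)).
Qed.

Lemma substage_map_id u (h : (u <= u)%O) : substage_map f h = mdid (substage u).
Proof. by apply: mdhom_ext => x; exact: tower_mapI. Qed.

Lemma substage_map_comp u v w (uv : (u <= v)%O) (vw : (v <= w)%O) (uw : (u <= w)%O) :
  substage_map f vw \oM substage_map f uv = substage_map f uw.
Proof. by apply: mdhom_ext => x; exact: tower_mapC. Qed.

Lemma substage_map_lim v : is_limit v ->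
  forall (W : mdspace) (k : forall u, (u < v)%O -> mdhom (substage u) W),
  (forall u u' (uu' : (u <= u')%O) (h : (u < v)%O) (h' : (u' < v)%O),
    k u' h' \oM substage_map f uu' = k u h) ->
  exists! w : mdhom (substage v) W,
    forall u (h : (u < v)%O), w \oM substage_map f (ltW h) = k u h.
Proof.
move=> lv W k ck; have pc := limit_colimit T lv.
apply: (subdivided_colimit (S := [set u | (u < v)%O]) (e := substage_sub f v) (g := idfun)
  (kQ := fun u h => substage_map f (ltW h)) pc) => //.
- by move=> x; exact: cvg_id.
- move=> x sx; have [[u hu] [y yE]] := generated_point (partial_colimit_generated pc) x.
  exists u, hu, y; split=> //.
  by move: sx; rewrite yE /= cd_leg_map.
- move=> p /(substage_expath hf); apply: gen_sub => q [a [b [h [bv [z [psi [fp eq qE]]]]]]].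
  (* Cells are attached at successor steps, so the step of a cell ends strictly below the limit. *)
  have bv' : (b < v)%O.
    rewrite lt_neqAle bv andbT; apply/eqP => bE; subst b.
    exact: (lv.2 a h).
  pose q' := cell_char (cd_cell h) \o (globe_pt z \o psi).
  have q'E : q = substage_map f (ltW bv') \o q'.
    by rewrite qE (bool_irrelevance bv (ltW bv')).
  exists b, bv', q'; split=> //.
  apply: (@substage_map_reflect R dH X Y f D b v (ltW bv')); last by rewrite -q'E.
  have [_ [_ cpsi] _ _] := fp.
  apply: continuous_fcomp (@mdhom_continuous _ _ _ _ (cell_char (cd_cell h))).
  exact: continuous_fcomp cpsi (@globe_pt_continuous _ _ z).
Qed.

Definition subdivided_tower : tower R dH (cd_ord D) :=
  @Tower R dH (cd_ord D) substage (@substage_map R dH X Y f D) substage_map_id substage_map_comp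
    substage_map_lim.

Lemma substage_leg_colimit : @is_colimit R dH _ subdivided_tower Y (@substage_leg R dH X Y f D).
Proof.
have cc : @is_cocone R dH _ subdivided_tower Y (@substage_leg R dH X Y f D).
  by move=> u v uv; apply: mdhom_ext => x; exact: (mdcompE (substage_map_eq f uv)).
split=> // W k' ck.
have pc := total_colimit (cd_colimit D); have [_ _ [g [cg fK gK]]] := hf.
have [w [w1 w2]] : exists! w : mdhom Y W, forall u, [set: cd_ord D] u ->
    w \oM substage_leg f u = k' u.
  apply: (fun h1 h2 h3 h4 => subdivided_colimit (kQ := fun u _ => substage_leg f u)
    pc cg fK gK h1 h2 h3 (k' := fun u _ => k' u) h4) => //.
  - move=> y sy; have [[u hu] [x xE]] := generated_point (partial_colimit_generated pc) (g y).
    exists u, Logic.I, x; have e : y = substage_leg f u x by rewrite -[LHS]gK xE.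
    by split=> //; move: sy; rewrite e.
  - move=> p /(subdivision_expath hf D); apply: gen_sub => q [a [b [h [z [psi [fp qE]]]]]].
    pose q' := cell_char (cd_cell h) \o (globe_pt z \o psi).
    exists b, Logic.I, q'; split=> //; split; last by have [_ _ _] := fp.
    have [_ [_ cpsi] _ _] := fp.
    apply: continuous_fcomp (@mdhom_continuous _ _ _ _ (cell_char (cd_cell h))).
    exact: continuous_fcomp cpsi (@globe_pt_continuous _ _ z).
  - by move=> u v uv _ _; exact: ck.
by exists w; split=> [u|w' w'k]; [exact: w1 u Logic.I|apply: w2 => u _; exact: w'k].
Qed.

Lemma substage_cellular w : cellular (substage w).
Proof.
apply: has_relcell_cellular; rewrite -(from_empty_comp (substage_sub f w)).
apply: (has_relcell_refine (e := substage_sub f w) (g := (idfun : substage w -> T w))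
  (F := fun q : @succ_pair _ [set u | (u <= w)%O] => cell_states f (pair_succ q))
  (b := fun q => substage_map f (pair_in q) \oM subdivided_cell hf (pair_succ q))
  (stage_relcell w)) => //.
- by move=> x; exact: cvg_id.
- by move=> q p; exact: cell_states_int.
- move=> x sx; have [|[a [b [h [bw [p [ip xE]]]]]]] := stage_cover x; [by left|right].
  exists (SuccPair h bw), p; split=> //; split; first by rewrite -cell_intE.
  by move: sx; rewrite xE /= cd_leg_map.
- move=> p /(substage_expath hf); apply: gen_sub => q [a [b [h [bw [z [psi [fp _ qE]]]]]]].
  right; exists (SuccPair h bw), (globe_pt z \o psi); split=> //.
  exact: fibre_path_globF.
- move=> q; apply: globF_has_relcell; first exact: cell_states_finite.
  by move=> p; exact: cell_states_int.
Qed.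

Lemma substage_sub_subdivision w : globular_subdivision (substage_sub f w).
Proof.
split; [exact: cellular_stage|exact: substage_cellular|].
by exists idfun; split=> // x; exact: cvg_id.
Qed.

(** The map is the identity on underlying spaces, so whatever inverse has been chosen is the
    identity too. *)
Lemma substage_connection_map u (su : globular_subdivision (substage_sub f u))
    (Du : cellular_decomposition (T u)) s (a : substage u) :
  connection_map su Du s a = cell_end_of Du s (a : T u).
Proof.
rewrite /connection_map; case: cid => g [_ gK _] /=.
by congr cell_end_of; rewrite -[RHS]gK.
Qed.

End SubdividedColimits.

Theorem theorem7p10 (R : realType) (dH : bool) (X Y : mdspace R dH)
    (f : mdhom X Y) (hf : globular_subdivision f)
    (D : cellular_decomposition X) :
  exists (Yt : tower R dH (cd_ord D))
         (Yleg : forall u : cd_ord D, mdhom (Yt u) Y)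
         (fT : forall u : cd_ord D, mdhom (cd_tower D u) (Yt u))
         (sub : forall u : cd_ord D, globular_subdivision (fT u)),
    [/\ is_colimit Yleg,
        forall (u v : cd_ord D) (uv : (u <= v)%O),
          fT v \oM tower_map (cd_tower D) uv = tower_map Yt uv \oM fT u,
        forall u : cd_ord D, f \oM cd_leg D u = Yleg u \oM fT u,
        forall (u v : cd_ord D) (h : is_succ u v),
          [/\ finite_set (cell_states f h),
              globular_subdivision (GlobDF (cell_states f h)) &
              exists b : mdhom (GlobF (cell_states f h)) (Yt v),
                [/\ is_pushout (fT u \oM cell_attach (cd_cell h))
                      (GlobSF (cell_states f h)) (tower_next Yt h) b,
                    q_cofibration (GlobSF (cell_states f h)),
                    q_cofibration (tower_next Yt h) &
                    b \oM GlobDF (cell_states f h) =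
                      fT v \oM cell_char (cd_cell h)]] &
        forall (u v : cd_ord D) (h : is_succ u v) (s : bool)
          (Du : cellular_decomposition (cd_tower D u))
          (Dv : cellular_decomposition (cd_tower D v)) (a : Yt u),
          states a ->
          connection_map (sub v) Dv s (tower_next Yt h a) =
            tower_next (cd_tower D) h (connection_map (sub u) Du s a)].
Proof.
exists (subdivided_tower hf D), (@substage_leg R dH X Y f D), (@substage_sub R dH X Y f D),
  (substage_sub_subdivision hf (D := D)); split.
- exact: substage_leg_colimit.
- by move=> u v uv; apply: mdhom_ext.
- by move=> u; apply: mdhom_ext.
- move=> u v h; have fin := cell_states_finite hf h.
  have Fint : forall p, cell_states f h p -> cell_int p by exact: cell_states_int.
  have qF : q_cofibration (GlobSF (cell_states f h)).
    exact/has_relcell_q_cofibration/globF_has_relcell.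
  split=> //; first exact: globDF_subdivision.
  have po := subdivided_pushout hf h.
  exists (subdivided_cell hf h); split=> //; first exact: q_cofibration_pushout po qF.
  exact: mdhom_ext.
(* The transition maps of the tower of [X] reflect states, so they commute with cell ends for
   arbitrary decompositions of the two stages. *)
- move=> u v h s Du Dv a _; rewrite !substage_connection_map.
  by apply: cell_end_of_map => x; exact: tower_map_reflect.
Qed.
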